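(* Let $0<\delta<1/4$, $K_3 > K_2 > K_1 > 1$, $p \in (0,1/2]$. There is a function $c(p)>0$ such that for every $\epsilon \in (0, c(p)]$ and every $M \ge 1$ the following holds. There are $L = L(p,\epsilon,\delta,K_1,K_2,K_3) > 0$ and $\gamma = \gamma(p,\epsilon,\delta,K_1,K_2,K_3) \in (0,\epsilon)$ (not depending on $M$), and $n_0 = n_0(p,\epsilon,\delta,K_1,K_2,K_3,M) \ge 1$ and $\eta = \eta(p,\epsilon,\delta,K_1,K_2,K_3,M) \in (0,1]$, such that: if $n \ge n_0$, $1 \le N \le \binom{n}{\lfloor pn\rfloor}\exp(-\epsilon n)$, $\mathcal{A}$ is $(N,n,K_1,K_2,K_3,\delta)$-admissible, and $f \in \ell_1(\mathbb{Z})$ is nonnegative with $\|f\|_1 = 1$ and $\log_2 f$ is $\eta$-Lipschitz (i.e. $|\log_2 f(s) - \log_2 f(t)| \le \eta|s-t|$ for all $s,t\in\mathbb{Z}$), then for every integer $m \in [pn - \gamma n, pn + \gamma n]$, \[\mathbb{P}\big[\|f_{\mathcal{A},m,n}\|_\infty \ge L (N\sqrt{n})^{-1}\big] \le \exp(-Mn).\]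
   Context: Admissible sets: for integers $N,n \ge 1$ and reals $0<\delta<1/4$, $K_3>K_2>K_1>1$, a set $\mathcal{A} \subseteq \mathbb{Z}^n$ is $(N,n,K_1,K_2,K_3,\delta)$-admissible if: $\mathcal{A} = A_1\times\cdots\times A_n$ with each $A_i\subseteq\mathbb{Z}$; $|A_1|\cdots|A_n| \le (K_3N)^n$; $\max_i\max\{|a| : a\in A_i\} \le nN$; $A_i$ is an integer interval of size at least $2N+1$ for $i > 2\delta n$; and either (P1),(P2) or (Q1),(Q2) hold, where (P1): for $i\le\delta n$, $A_{2i}$ is an integer interval of size at least $2N+1$ contained in $[-K_1N,K_1N]$; (P2): for $i \le \delta n$, $A_{2i-1}$ is symmetric about $0$, is a union of two integer intervals of total size at least $2N$, and $A_{2i-1}\cap[-K_2N,K_2N]=\emptyset$; (Q1): for $i\le\delta n$, $A_{2i}$ is an integer interval of size at least $2N+1$ contained in $[K_1N,K_2N]$; (Q2): for $i\le\delta n$, $A_{2i-1}$ is an integer interval of size at least $2N+1$ contained in $[-K_2N,-K_1N]$. Random averages: $(X_1,\dots,X_n)$ is uniformly distributed on $\mathcal{A}$. For $f:\mathbb{Z}\to\mathbb{R}$ and integers $0\le s\le \ell\le n$, the random function $f_{\mathcal{A},s,\ell}:\mathbb{Z}\to\mathbb{R}$ is \[f_{\mathcal{A},s,\ell}(t) = \binom{\ell}{s}^{-1}\sum_{v\in\{0,1\}^\ell_s} f(t + v_1X_1 + \cdots + v_\ell X_\ell),\] where $\{0,1\}^\ell_s$ is the set of vectors in $\{0,1\}^\ell$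 with coordinate sum $s$. $\ell_1(\mathbb{Z})$ is the set of $f:\mathbb{Z}\to\mathbb{R}$ with $\sum_z|f(z)|<\infty$. *)

(* Defs.v *)
From HB Require Import structures.
From mathcomp Require Import all_boot all_order all_algebra.
From mathcomp Require Import finmap.
From mathcomp Require Import all_classical all_reals.
From mathcomp Require Import esum sequences exp.
Set Implicit Arguments. Unset Strict Implicit. Unset Printing Implicit Defensive.
Import Order.TTheory GRing.Theory Num.Theory.
Local Open Scope ring_scope.
Local Open Scope fset_scope.

Section Defs.
Variable R : realType.

Definition int_interval (S : {fset int}) : Prop :=
  exists a b : int, forall x : int, (x \in S) = (a <= x <= b).

(* The admissibility conditions; A i is the i-th factor, 1 <= i <= n
   (1-indexed as in the paper). *)
Definition admissible (N n : nat) (K1 K2 K3 delta : R) (A : nat -> {fset int}) : Prop :=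
  [/\ ((\prod_(1 <= i < n.+1) #|` A i|)%N%:R <= (K3 * N%:R) ^+ n),
      (forall i, (1 <= i <= n)%N -> forall a, a \in A i -> `|a| <= (n * N)%N%:Z),
      (forall i, (i <= n)%N -> 2 * delta * n%:R < i%:R ->
          int_interval (A i) /\ (2 * N + 1 <= #|` A i|)%N) &
      (
       (forall i, (1 <= i)%N -> i%:R <= delta * n%:R ->
          (int_interval (A (2 * i)%N) /\ (2 * N + 1 <= #|` A (2 * i)%N|)%N /\
           forall a, a \in A (2 * i)%N -> `|a%:~R| <= K1 * N%:R :> R) /\
          ((forall a, (a \in A (2 * i).-1) = (- a \in A (2 * i).-1)) /\
           (exists I1 I2 : {fset int}, int_interval I1 /\ int_interval I2 /\
              A (2 * i).-1 = I1 `|` I2 /\ (2 * N <= #|` I1| + #|` I2|)%N) /\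
           forall a, a \in A (2 * i).-1 -> K2 * N%:R < `|a%:~R| :> R))
       \/
       (forall i, (1 <= i)%N -> i%:R <= delta * n%:R ->
          (int_interval (A (2 * i)%N) /\ (2 * N + 1 <= #|` A (2 * i)%N|)%N /\
           forall a, a \in A (2 * i)%N -> (K1 * N%:R <= (a%:~R : R) <= K2 * N%:R)) /\
          (int_interval (A (2 * i).-1) /\ (2 * N + 1 <= #|` A (2 * i).-1|)%N /\
           forall a, a \in A (2 * i).-1 -> (- (K2 * N%:R) <= (a%:~R : R) <= - (K1 * N%:R)))))].

(* Enumeration (without repetition) of A = A_1 x ... x A_n as lists [x_1; ...; x_n]. *)
Definition samples (A : nat -> {fset int}) (n : nat) : seq (seq int) :=
  foldr (fun i acc => [seq x :: y | x <- enum_fset (A i), y <- acc]) [:: [::]] (iota 1 n).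

Definition prob (A : nat -> {fset int}) (n : nat) (E : seq int -> bool) : R :=
  (count E (samples A n))%:R / (size (samples A n))%:R.

(* f_{A,s,l}(t) at the sample x = [x_1; ...; x_n] (X_j = nth 0 x (j-1)). *)
Definition ravg (f : int -> R) (x : seq int) (s l : nat) (t : int) : R :=
  ('C(l, s)%:R)^-1 *
  \sum_(v : {ffun 'I_l -> bool} | (\sum_(j < l) nat_of_bool (v j))%N == s)
     f (t + \sum_(j < l) (nat_of_bool (v j))%:Z * nth 0 x j).

Definition supnorm (g : int -> R) : R := sup (range (fun t => `|g t|)).

Definition in_l1 (f : int -> R) : Prop :=
  (\esum_(z in [set: int]) (`|f z|)%:E < +oo)%E.
Definition l1norm (f : int -> R) : R := fine (\esum_(z in [set: int]) (`|f z|)%:E).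

Definition log2 (x : R) : R := ln x / ln 2.

(* log_2 f is (defined, i.e. f > 0, and) eta-Lipschitz *)
Definition log2_lipschitz (eta : R) (f : int -> R) : Prop :=
  (forall t, 0 < f t) /\
  forall s t : int, `|log2 (f s) - log2 (f t)| <= eta * `|(s - t)%:~R|.

End Defs.

(* Main.v *)
(** A coordinate [X_j] turns a function [g] into an average of [g] and of its
   translate by [X_j], so [f_{A,m,n}] arises from [f] by revealing the
   coordinates one at a time, in any order.  As [f] varies slowly it can be
   truncated to a large cyclic group at a negligible cost.

   - Pairs [(X_(2i-1), X_(2i))] whose entries are at distance at least a multiple
     of [N] bring the mass of every window of length [N] down to [C / sqrt n]
     (Kleitman's form of the Littlewood-Offord argument).
   - A coordinate spread over at least [N] integers then hits the superlevel set
     at height [K / (N sqrt n)] with probability [O(1 / K)], so that the [k]-th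
     moment of the excess over this height is multiplied by almost 1 at each
     step.  As [N <= 'C(n, pn) exp (- eps n)], taking [k] of order [M / eps] bounds
     the supremum by [K / (N sqrt n)], but with [K] depending on [M].
   - To remove this dependence, let [psi] be the difference between the function
     and its mean over windows of length [N].  An interval coordinate decreases
     the energy of [psi] by a definite factor unless it is close to carrying one
     copy of [psi] to the other; such shifts are rare, since their differences
     are almost periods of [psi], whereas slow variation makes [psi] average out
     along progressions.  So the excess over [2 C / (N sqrt n)] has mass at most
     an arbitrarily small [theta].
   - A second block of pairs lowers the window mass of this excess to
     [theta C / sqrt n], and the moment argument applied to the excess yields the
     final bound, in which [K] only enters through a constant power. *)

Require Import Defs.
From HB Require Import structures.
From mathcomp Require Import all_boot all_order all_algebra.
From mathcomp Require Import finmap.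
From mathcomp Require Import all_classical all_reals.
From mathcomp Require Import esum sequences exp.
From mathcomp Require Import ring lra zify.
Import Order.TTheory GRing.Theory Num.Theory.
Local Open Scope ring_scope.
Set Implicit Arguments. Unset Strict Implicit. Unset Printing Implicit Defensive.

(** * Averages over products *)

Section Averages.
Variable R : realFieldType.
Implicit Types (A : seq int) (As Bs : seq (seq int)).

(** The order of the choices carries the theorem: the window constant [C0], hence [L], and [gamma]
    are fixed before [M], so that [M] may only enter through exponents, [n0] and [eta]. Every phase
    loses an exponential factor (3 per coordinate in a moment, 2 per step in the energy) and regains
    it from its own source. The first one uses [exp (- eps n)] raised to the power [k1]. The second
    one uses a contraction at each of about [a n] coordinates, whose factor [alpha] may be chosen as
    small as [exp (- M / a)]. The last one uses outer coordinates that are still hidden: a slice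
    [2 h] levels below [(n, m)] has a binomial coefficient at most [(1 - qq) ^+ (2 h)] times
    ['C(n, m)], so its [k3]-th moment starts exponentially small. The last phase cannot be run at
    once: at a height free of [M] the hitting probability is a constant, whereas [2 ^+ k3] times it
    has to be at most 1/2. This is what forces the mass of the excess down to about [2 ^- k3]. *)

Definition avg A (F : int -> R) : R := (\sum_(x <- A) F x) / (size A)%:R.

Lemma avg_le A (F G : int -> R) :
  {in A, forall x, F x <= G x} -> avg A F <= avg A G.
Proof.
move=> FG; rewrite /avg ler_wpM2r ?invr_ge0 ?ler0n //.
by rewrite !big_seq; apply: ler_sum.
Qed.

Lemma avgD A (F G : int -> R) : avg A (fun x => F x + G x) = avg A F + avg A G.
Proof. by rewrite /avg big_split mulrDl. Qed.

Lemma avgZ A c (F : int -> R) : avg A (fun x => c * F x) = c * avg A F.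
Proof. by rewrite /avg -mulr_sumr mulrA. Qed.

Lemma avg_sum (I : Type) (r : seq I) (P : pred I) A (F : I -> int -> R) :
  avg A (fun x => \sum_(i <- r | P i) F i x) = \sum_(i <- r | P i) avg A (F i).
Proof. by rewrite /avg exchange_big /= mulr_suml. Qed.

(** An inequality, since the average over the empty list is 0 by the convention on division by
    zero. *)
Lemma avg_cst_le A c : 0 <= c -> avg A (fun=> c) <= c.
Proof.
move=> c0; rewrite /avg big_const_seq count_predT iter_addr_0.
case: (size A) => [|k]; first by rewrite mulr0n mul0r.
by rewrite -[c *+ _]mulr_natr mulfK // pnatr_eq0.
Qed.

Lemma avg_exchange A B (F : int -> int -> R) :
  avg A (fun x => avg B (F x)) = avg B (fun y => avg A (F^~ y)).
Proof.
rewrite /avg -!mulr_suml exchange_big /=.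
by rewrite -!mulrA [_^-1 * _]mulrC.
Qed.

Fixpoint expect As (F : seq int -> R) : R :=
  if As is A :: As' then avg A (fun x => expect As' (fun y => F (x :: y)))
  else F [::].

Definition insupp As (y : seq int) := all2 (fun (A : seq int) x => x \in A) As y.

Lemma insupp_size As y : insupp As y -> size y = size As.
Proof. by rewrite /insupp all2E => /andP[/eqP]. Qed.

Lemma insupp_cat As Bs y : insupp (As ++ Bs) y ->
  exists a b, [/\ y = a ++ b, insupp As a & insupp Bs b].
Proof.
elim: As y => [|A As IH] y /=; first by exists [::], y.
case: y => //= x y /andP[xA /IH[a [b [-> ha hb]]]].
by exists (x :: a), b; split=> //; rewrite /insupp /= xA.
Qed.

Lemma expect_le As (F G : seq int -> R) :
  (forall y, insupp As y -> F y <= G y) -> expect As F <= expect As G.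
Proof.
elim: As F G => [|A As IH] F G FG /=; first exact: FG.
apply: avg_le => x xA; apply: IH => y yAs; apply: FG.
by rewrite /insupp /= xA.
Qed.

Lemma eq_expect As (F G : seq int -> R) :
  (forall y, insupp As y -> F y = G y) -> expect As F = expect As G.
Proof.
by move=> FG; apply/le_anti/andP; split; apply: expect_le => y /FG ->.
Qed.

Lemma expectD As (F G : seq int -> R) :
  expect As (fun y => F y + G y) = expect As F + expect As G.
Proof.
elim: As F G => [|A As IH] F G //=.
rewrite -avgD /avg; congr (_ / _); apply: eq_bigr => x _; exact: IH.
Qed.

Lemma expectZ As c (F : seq int -> R) :
  expect As (fun y => c * F y) = c * expect As F.
Proof.
elim: As F => [|A As IH] F //=.
rewrite -avgZ /avg; congr (_ / _); apply: eq_bigr => x _; exact: IH.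
Qed.

Lemma expect_cst_le As c : 0 <= c -> expect As (fun=> c) <= c.
Proof.
move=> c0; elim: As => [|A As IH] //=.
apply: le_trans (avg_cst_le A c0); exact: avg_le.
Qed.

Lemma expect_le_cst As (F : seq int -> R) c : 0 <= c ->
  (forall y, insupp As y -> F y <= c) -> expect As F <= c.
Proof. by move=> c0 Fc; apply: le_trans (expect_cst_le As c0); exact: expect_le. Qed.

Lemma avg_expect A As (F : int -> seq int -> R) :
  avg A (fun x => expect As (F x)) = expect As (fun y => avg A (F^~ y)).
Proof.
elim: As F => [|B As IH] F //=.
rewrite avg_exchange /avg; congr (_ / _); apply: eq_bigr => x _; exact: IH.
Qed.

Lemma expect_cons A As (F : seq int -> R) :
  expect (A :: As) F = expect As (fun y => avg A (fun x => F (x :: y))).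
Proof. by rewrite -avg_expect. Qed.

Lemma expect_exchange As Bs (F : seq int -> seq int -> R) :
  expect As (fun x => expect Bs (F x)) = expect Bs (fun y => expect As (F^~ y)).
Proof.
elim: As F => [|A As IH] F //=.
rewrite -(avg_expect _ _ (fun x y => expect As (fun z => F (x :: z) y))) /avg.
congr (_ / _); apply: eq_bigr => x _; exact: IH.
Qed.

Lemma expect_cat As Bs (F : seq int -> R) :
  expect (As ++ Bs) F = expect As (fun x => expect Bs (fun y => F (x ++ y))).
Proof.
elim: As F => [|A As IH] F //=.
by rewrite /avg; congr (_ / _); apply: eq_bigr => x _; exact: IH.
Qed.

Lemma expect_cat_inner As Bs (F : seq int -> R) :
  expect (As ++ Bs) F = expect Bs (fun y => expect As (fun x => F (x ++ y))).
Proof. by rewrite expect_cat expect_exchange. Qed.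

Definition pr As (E : seq int -> bool) : R := expect As (fun y => (E y)%:R).

Lemma markov As (F : seq int -> R) (E : seq int -> bool) c : 0 < c ->
  (forall y, insupp As y -> 0 <= F y) ->
  (forall y, insupp As y -> E y -> c <= F y) -> pr As E <= expect As F / c.
Proof.
move=> c0 F0 EF; rewrite mulrC -expectZ; apply: expect_le => y yA.
case: (boolP (E y)) => [/(EF _ yA) cF|_] /=.
  by rewrite mulrC ler_pdivlMr // mul1r.
by rewrite mulr_ge0 ?F0 // invr_ge0 ltW.
Qed.

(** The suffix drawn from [Bs] is revealed first and tested by [good]; only after a good suffix is a
    bound on the conditional probability asked for. This chains the phases, the end of the list
    being revealed first. *)
Lemma pr_cond As Bs (E : seq int -> bool) (good : seq int -> bool) d : 0 <= d ->
  (forall y, insupp Bs y -> good y -> pr As (fun x => E (x ++ y)) <= d) ->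
  pr (As ++ Bs) E <= pr Bs (fun y => ~~ good y) + d.
Proof.
move=> d0 Ed; rewrite /pr expect_cat_inner.
apply: (@le_trans _ _ (expect Bs (fun y => (~~ good y)%:R + d))); last first.
  by rewrite expectD lerD2l expect_cst_le.
apply: expect_le => y yB; case: (boolP (good y)) => [gy|_] /=.
  by rewrite add0r Ed.
apply: (@le_trans _ _ 1); last by rewrite lerDl.
by apply: expect_le_cst => // x _; rewrite lern1 leq_b1.
Qed.

Lemma pr_exists (I : Type) (r : seq I) As (E : I -> seq int -> bool)
    (F : seq int -> bool) d :
  (forall y, insupp As y -> F y -> has (E^~ y) r) ->
  (forall i, pr As (E i) <= d) -> pr As F <= (size r)%:R * d.
Proof.
move=> FE Ed.
apply: (@le_trans _ _ (expect As (fun y => \sum_(i <- r) (E i y)%:R))).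
  apply: expect_le => y yA; rewrite -natr_sum ler_nat.
  case: (boolP (F y)) => // /(FE _ yA); elim: r {FE} => //= i r IH.
  by rewrite big_cons => /orP[->|/IH] //= h; apply: leq_trans h (leq_addl _ _).
elim: r {FE} => [|i r IH].
  by rewrite mul0r; apply: expect_le_cst => // y _; rewrite big_nil.
rewrite /= -natr1 mulrDl mul1r addrC.
have -> : expect As (fun y => \sum_(j <- i :: r) (E j y)%:R) =
   expect As (fun y => (E i y)%:R + \sum_(j <- r) (E j y)%:R).
  by apply: eq_expect => y _; rewrite big_cons.
by rewrite expectD lerD // Ed.
Qed.

End Averages.

(** * Slice sums over the cube, one coordinate at a time *)

Section Push.
Variables (R : realFieldType) (V : zmodType) (e : V).
Implicit Types (F : nat -> V -> R) (xs ys : seq int).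

(* [pushes xs F s t] is the sum of [F (s - |v|) (t + (v . xs) e)] over all 0/1
   vectors [v] with [|v| <= s]. *)
Definition push (x : int) F (s : nat) (t : V) : R :=
  F s t + (if s is s'.+1 then F s' (t + e *~ x) else 0).

Definition pushes xs F := foldr push F xs.

(** After pushing all of [xs], slice [s] carries ['C(size xs, s)] times the random average; leaving
    this factor in turns the recursion into Pascal's rule. *)
Definition seed (f : V -> R) (s : nat) (t : V) : R := if s == 0%N then f t else 0.

Lemma pushes_cat xs ys F : pushes (xs ++ ys) F = pushes xs (pushes ys F).
Proof. by rewrite /pushes foldr_cat. Qed.

Lemma eq_push x F G : F =2 G -> push x F =2 push x G.
Proof. by move=> FG [|s] t; rewrite /push !FG. Qed.

Lemma eq_pushes xs F G : F =2 G -> pushes xs F =2 pushes xs G.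
Proof. by elim: xs => //= x xs IH FG; apply: eq_push; exact: IH. Qed.

Lemma pushC x y F : push x (push y F) =2 push y (push x F).
Proof.
move=> [|[|s]] t; rewrite /push ?addr0; first by [].
  by ring.
rewrite -!addrA [e *~ y + _]addrC; ring.
Qed.

Lemma push_pushes x xs F : push x (pushes xs F) =2 pushes xs (push x F).
Proof.
elim: xs F => //= y xs IH F s t.
by rewrite pushC; exact: eq_push (IH F) s t.
Qed.

Lemma pushesC xs ys F : pushes xs (pushes ys F) =2 pushes ys (pushes xs F).
Proof.
elim: xs F => //= x xs IH F s t.
rewrite (eq_push _ (IH F)) push_pushes.
by [].
Qed.

Lemma pushes_ge0 xs F : (forall s t, 0 <= F s t) ->
  forall s t, 0 <= pushes xs F s t.
Proof.
move=> F0; elim: xs => //= x xs IH [|s] t; rewrite /push ?addr0 ?addr_ge0 //.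
Qed.

Lemma seed_ge0 f : (forall t, 0 <= f t) -> forall s t, 0 <= seed f s t.
Proof. by move=> f0 [|s] t; rewrite /seed /= ?f0. Qed.

(* Stated for a predicate because it serves sup bounds, sums and window sums
   alike. *)
Lemma pushes_pascal (P : (V -> R) -> R -> Prop) xs F (l s : nat) c :
  (forall g h a b x, P g a -> P h b ->
    P (fun t => g t + h (t + e *~ x)) (a + b)) ->
  (forall g h a, g =1 h -> P g a -> P h a) ->
  (forall s', (s' <= s <= s' + size xs)%N -> P (F s') (c * 'C(l, s')%:R)) ->
  P (pushes xs F s) (c * 'C(size xs + l, s)%:R).
Proof.
move=> PD Pe; elim: xs s => [|x xs IH] s PF /=.
  by apply: PF => /=; lia.
case: s PF => [|s] PF.
  apply: (Pe (pushes xs F 0%N)); first by move=> t; rewrite /push addr0.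
  rewrite !bin0; have := IH 0%N; rewrite bin0; apply => s' /andP[h1 h2].
  by apply: PF => /=; lia.
rewrite addSn binS natrD mulrDr; apply: PD; apply: IH => s' /andP[h1 h2].
  by apply: PF => /=; lia.
by apply: PF => /=; lia.
Qed.

Lemma pushes_le_cst xs F (l s : nat) c :
  (forall s' t, (s' <= s <= s' + size xs)%N -> F s' t <= c * 'C(l, s')%:R) ->
  forall t, pushes xs F s t <= c * 'C(size xs + l, s)%:R.
Proof.
move=> Fc; apply: (@pushes_pascal (fun g a => forall t, g t <= a)).
- by move=> g h a b x ga hb t; rewrite lerD.
- by move=> g h a gh ga t; rewrite -gh.
- by move=> s' hs t; apply: Fc.
Qed.

End Push.

Section PushSum.
Variables (R : realFieldType) (V : finZmodType) (e : V).

Lemma sum_shift (g : V -> R) a : \sum_t g (t + a) = \sum_t g t.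
Proof. by rewrite [RHS](reindex_inj (addIr a)). Qed.

Lemma pushes_sum_le xs (F : nat -> V -> R) (l s : nat) c :
  (forall s', (s' <= s <= s' + size xs)%N -> \sum_t F s' t <= c * 'C(l, s')%:R) ->
  \sum_t pushes e xs F s t <= c * 'C(size xs + l, s)%:R.
Proof.
move=> Fc; apply: (@pushes_pascal R V e (fun g a => \sum_t g t <= a)) => //.
- by move=> g h a b x ga hb; rewrite big_split /= (sum_shift h) lerD.
- by move=> g h a gh; rewrite (eq_bigr _ (fun i _ => gh i)).
Qed.

Lemma seed_sum_le (f : V -> R) s c : \sum_t f t <= c ->
  \sum_t seed f s t <= c * 'C(0, s)%:R.
Proof. by case: s => [|s] fc; rewrite /seed /= ?mulr1 // mulr0 big1. Qed.

Lemma pushes_seed_sum_le xs (f : V -> R) s : \sum_t f t <= 1 ->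
  \sum_t pushes e xs (seed f) s t <= 'C(size xs, s)%:R.
Proof.
move=> f1; rewrite -[leRHS]mul1r -[size xs]addn0.
by apply: pushes_sum_le => s' _; exact: seed_sum_le.
Qed.

End PushSum.

(** * Littlewood-Offord bounds for separated pairs *)

Fixpoint gapped (D : nat) (zs : seq int) : bool :=
  if zs is x :: x' :: zs' then (D%:Z <= `|x - x'|) && gapped D zs' else zs == [::].

Section ExtremalWalk.
Variable R : realFieldType.

(* By Kleitman's argument the pair block whose window sums are largest has all
   its pairs equal to (1, -1). *)
Definition unit_pairs (h : nat) : seq int := flatten (nseq h [:: 1; -1]).

Definition walk (be : nat -> R) (h : nat) : nat -> int -> R :=
  pushes (1 : int) (unit_pairs h) (fun s d => if d == 0 then be s else 0).

(** The points from [1 - r] to [r]. Two points stand for one window of length [D]: the shifts 1 and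
    -1 differ by 2, as the entries of a general pair differ by at least [D]. *)
Definition kbound be h s r : R := \sum_(i < r.*2) walk be h s (i%:Z - r%:Z + 1).

Lemma kbound0 be h s : kbound be h s 0 = 0.
Proof. by rewrite /kbound big_ord0. Qed.

Lemma kbound_base be s r : 0 <= be s -> (0 < r)%N -> kbound be 0 s r = be s.
Proof.
move=> b0 r0; rewrite /kbound /walk /=.
have r1 : (r.-1 < r.*2)%N by lia.
rewrite (bigD1 (Ordinal r1)) //= big1 => [|i ne].
  by rewrite addr0 /= ifT //; apply/eqP; lia.
rewrite ifF //; apply/negP => /eqP h; move/eqP: ne; apply; apply: val_inj => /=.
lia.
Qed.

(** Two intervals of equal length are replaced by their union and their intersection. This is the
    equality case of the exchange in [wsum_two_shifts]. *)
Lemma kbound_swap (k : int -> R) r :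
  \sum_(i < r.+1.*2) k (i%:Z - r.+1%:Z) + \sum_(i < r.+1.*2) k (i%:Z - r.+1%:Z + 2) =
  \sum_(i < r.+2.*2) k (i%:Z - r.+1%:Z) + \sum_(i < r.*2) k (i%:Z - r.+1%:Z + 2).
Proof.
have S n (f : nat -> R) :
    \sum_(i < n.+2) f i = \sum_(i < n) f i + (f n + f n.+1).
  by rewrite !big_ord_recr /= addrA.
have -> : \sum_(i < r.+1.*2) k (i%:Z - r.+1%:Z + 2) =
    \sum_(i < r.*2) k (i%:Z - r.+1%:Z + 2) + (k (r%:Z + 1) + k (r%:Z + 2)).
  have -> : r.+1.*2 = r.*2.+2 by lia.
  rewrite (S _ (fun i => k (i%:Z - r.+1%:Z + 2))).
  by congr (_ + (k _ + k _)); lia.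
have -> : \sum_(i < r.+2.*2) k (i%:Z - r.+1%:Z) =
    \sum_(i < r.+1.*2) k (i%:Z - r.+1%:Z) + (k (r%:Z + 1) + k (r%:Z + 2)).
  have -> : r.+2.*2 = r.+1.*2.+2 by lia.
  rewrite (S _ (fun i => k (i%:Z - r.+1%:Z))).
  by congr (_ + (k _ + k _)); lia.
by rewrite addrA addrAC.
Qed.

Lemma kbound_rec be h s r :
  kbound be h.+1 s r.+1 = kbound be h s r.+1 +
   (if s is s'.+1 then kbound be h s' r.+2 + kbound be h s' r +
      (if s' is s''.+1 then kbound be h s'' r.+1 else 0) else 0).
Proof.
rewrite /kbound.
have W s0 d : walk be h.+1 s0 d = push 1 1 (push 1 (-1) (walk be h)) s0 d by [].
under eq_bigr => i _ do rewrite W.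
case: s => [|s]; rewrite /push.
  by rewrite addr0; apply: eq_bigr => i _; rewrite !addr0.
rewrite !big_split /=.
rewrite -!addrA; congr (_ + _).
have := kbound_swap (walk be h s) r.
have -> : \sum_(i < r.+1.*2) walk be h s (i%:Z - r.+1%:Z) =
  \sum_(i < r.+1.*2) walk be h s (i%:Z - r.+1%:Z + 1 + 1 *~ -1).
  by apply: eq_bigr => i _; congr walk; rewrite mulrNz mulr1z; lia.
have -> : \sum_(i < r.+1.*2) walk be h s (i%:Z - r.+1%:Z + 2) =
  \sum_(i < r.+1.*2) walk be h s (i%:Z - r.+1%:Z + 1 + 1 *~ 1).
  by apply: eq_bigr => i _; congr walk; rewrite mulr1z; lia.
have -> : \sum_(i < r.+2.*2) walk be h s (i%:Z - r.+1%:Z) =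
  \sum_(i < r.+2.*2) walk be h s (i%:Z - r.+2%:Z + 1).
  by apply: eq_bigr => i _; congr walk; lia.
have -> : \sum_(i < r.*2) walk be h s (i%:Z - r.+1%:Z + 2) =
  \sum_(i < r.*2) walk be h s (i%:Z - r%:Z + 1).
  by apply: eq_bigr => i _; congr walk; lia.
rewrite addrA => ->; rewrite -addrA; congr (_ + (_ + _)).
case: s => [|s]; first by rewrite /= big1 //.
by apply: eq_bigr => i _; congr walk; rewrite mulrNz mulr1z; lia.
Qed.

End ExtremalWalk.

Section LittlewoodOfford.
Variables (R : realFieldType) (V : finZmodType) (e : V) (rho : int) (D : nat).
Hypothesis e_inj : forall z : int, `|z| <= rho -> e *~ z = 0 -> z = 0.

Definition wsum (g : V -> R) (ys : seq int) (a : V) : R :=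
  \sum_(y <- ys) \sum_(i < D) g (a + e *~ (y + i%:Z)).

Definition separated (ys : seq int) := pairwise (fun y y' : int => y + D%:Z <= y') ys.

(** Disjoint windows of integers stay disjoint in [V]: two of their points differ by at most
    [2 (Y + D)], within the range [rho] where multiples of [e] are distinct. *)
Lemma wsum_base (g : V -> R) ys a (Y : int) : (forall t, 0 <= g t) ->
  separated ys -> all (fun y : int => `|y| <= Y) ys -> (Y + D%:Z) *+ 2 <= rho ->
  wsum g ys a <= \sum_t g t.
Proof.
move=> g0 sy yY hr.
pose pts : seq int := [seq y + i%:Z | y <- ys, i <- iota 0 D].
have bnd (z : int) : z \in pts -> `|z| <= Y + D%:Z.
  by case/allpairsP => -[y i] /= [/(allP yY) /= h]; rewrite mem_iota => /andP[_ h2] ->; lia.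
have up : uniq pts.
  rewrite /pts; elim: ys sy {yY bnd pts} => //= y ys IH /andP[hy sy].
  rewrite cat_uniq IH // andbT map_inj_in_uniq ?iota_uniq /=; last first.
    by move=> i j _ _; lia.
  apply/hasPn => z /allpairsP[[y' i] /= [hy']]; rewrite mem_iota => hi ->.
  apply/negP => /mapP[j]; rewrite mem_iota => hj.
  by have := allP hy _ hy'; lia.
have upT : uniq [seq a + e *~ z | z <- pts].
  rewrite map_inj_in_uniq // => z z' /bnd hz /bnd hz' /addrI E.
  have : e *~ (z - z') = 0 by rewrite mulrzBr E subrr.
  move/e_inj => h; apply/eqP; rewrite -subr_eq0; apply/eqP/h.
  apply: le_trans (ler_normB _ _) _; apply: le_trans hr.
  by rewrite mulr2n lerD.
have -> : wsum g ys a = \sum_(t <- [seq a + e *~ z | z <- pts]) g t.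
  rewrite /wsum big_map big_allpairs_dep /=; apply: eq_bigr => y _.
  by rewrite -(big_mkord xpredT (fun i => g (a + e *~ (y + i%:Z)))) /index_iota subn0.
rewrite big_uniq //= [leRHS](bigID (mem [seq a + e *~ z | z <- pts])) /=.
by rewrite lerDl sumr_ge0.
Qed.

Lemma wsum_shift g ys a x :
  wsum (fun t => g (t + e *~ x)) ys a = wsum g [seq y + x | y <- ys] a.
Proof.
rewrite /wsum big_map; apply: eq_bigr => y _; apply: eq_bigr => i _.
by rewrite -addrA -mulrzDr addrAC.
Qed.

Lemma wsumD g g' ys a :
  wsum (fun t => g t + g' t) ys a = wsum g ys a + wsum g' ys a.
Proof.
by rewrite /wsum -big_split; apply: eq_bigr => y _; rewrite -big_split.
Qed.

Lemma separated_shift ys x : separated ys -> separated [seq y + x | y <- ys].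
Proof.
rewrite /separated pairwise_map; apply: sub_pairwise => y y' /=; lia.
Qed.

(** Kleitman's exchange: the first window moves from the family shifted by [x] to the one shifted by
    [x']. If [x + D <= x'] and [y] is leftmost, both new families are still separated, with one
    window more and one window less. *)
Lemma wsum_two_shifts g y ys a x x' :
  wsum g [seq z + x | z <- y :: ys] a + wsum g [seq z + x' | z <- y :: ys] a =
  wsum g (y + x :: [seq z + x' | z <- y :: ys]) a + wsum g [seq z + x | z <- ys] a.
Proof. by rewrite /wsum /= !big_cons; ring. Qed.

(** Induction on the pairs. Taking none or both entries of a pair keeps the number of windows;
    taking exactly one gives two shifted families, which the exchange rebalances. This is the
    recursion [kbound_rec] with an inequality. Positions of windows move by at most [2 X] per pair,
    which explains the condition on [rho]. *)
Lemma littlewood_offord_windows (b : nat -> V -> R) (be : nat -> R) (X : int) zs :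
  (forall s t, 0 <= b s t) -> (forall s, 0 <= be s) -> gapped D zs ->
  all (fun x : int => `|x| <= X) zs -> 0 <= X ->
  forall h s ys a (Y : int), size zs = h.*2 ->
  (forall s', (s' <= s <= s' + h.*2)%N -> \sum_t b s' t <= be s') ->
  separated ys -> all (fun y : int => `|y| <= Y) ys ->
  (Y + X *+ h.*2 + D%:Z) *+ 2 <= rho ->
  wsum (pushes e zs b s) ys a <= kbound be h s (size ys).
Proof.
move=> b0 be0 gz zX X0 h; elim: h zs gz zX => [|h IH] zs gz zX s ys a Y sz bb sy yY hr.
  have -> : zs = [::] by apply/nilP; rewrite /nilp sz.
  case: ys sy yY => [|y ys] sy yY; first by rewrite /wsum big_nil kbound0.
  rewrite kbound_base //.
  apply: le_trans (wsum_base a (b0 s) sy yY _) (bb s _); last by lia.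
  by rewrite mulr0n addr0 in hr.
case: zs gz zX sz => [|x [|x' zs]] //= /andP[gx gz] /and3P[hx hx' zX] sz.
case: ys sy yY => [|y ys] sy yY; first by rewrite /wsum big_nil kbound0.
have hr' : (Y + X + (X *+ h.*2) + D%:Z) *+ 2 <= rho.
  apply: le_trans hr; rewrite doubleS !mulrS; lia.
have hr2 : (Y + (X + X) + (X *+ h.*2) + D%:Z) *+ 2 <= rho.
  apply: le_trans hr; rewrite doubleS !mulrS; lia.
have szz : size zs = h.*2 by lia.
have IHs s' (ys' : seq int) (Y' : int) : (s' <= s <= s' + 2)%N -> separated ys' ->
    all (fun y : int => `|y| <= Y') ys' -> Y' <= Y + (X + X) ->
    wsum (pushes e zs b s') ys' a <= kbound be h s' (size ys').
  move=> hs' sys' yY' hY'; apply: (IH zs gz zX s' ys' a Y') => //.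
    by move=> s'' hs''; apply: bb; lia.
  by apply: le_trans hr2; rewrite lerMn2r /=; lia.
rewrite kbound_rec.
have sh (z : int) (l : seq int) (Y' : int) : `|z| <= Y' -> all (fun y : int => `|y| <= Y) l ->
    all (fun y : int => `|y| <= Y + Y') [seq y0 + z | y0 <- l].
  move=> hz /allP hl; apply/allP => w /mapP[w' /hl h1 ->].
  by apply: le_trans (ler_normD _ _) _; exact: lerD.
have syt : separated ys by move: sy => /andP[].
have yYt : all (fun y : int => `|y| <= Y) ys by move: yY => /andP[].
have two s' : (s' <= s <= s' + 2)%N ->
   wsum (pushes e zs b s') [seq z + x | z <- y :: ys] a +
   wsum (pushes e zs b s') [seq z + x' | z <- y :: ys] a <=
   kbound be h s' (size ys).+2 + kbound be h s' (size ys).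
  move=> hs'.
  have key (z z' : int) : `|z| <= X -> `|z'| <= X -> z + D%:Z <= z' ->
     wsum (pushes e zs b s') [seq w + z | w <- y :: ys] a +
     wsum (pushes e zs b s') [seq w + z' | w <- y :: ys] a <=
     kbound be h s' (size ys).+2 + kbound be h s' (size ys).
    move=> hz hz' zz; rewrite wsum_two_shifts; apply: lerD.
      apply: le_trans (IHs _ _ (Y + X) hs' _ _ _) _; last by rewrite /= size_map.
      - rewrite /separated pairwise_cons; apply/andP; split; last exact: (separated_shift z' sy).
        apply/allP => w; rewrite in_cons => /orP[/eqP->|/mapP[w' hw' ->]]; first by move: zz; clear; lia.
        by move: sy => /andP[/allP /(_ _ hw') h1 _]; move: (h1 : y + D%:Z <= w') zz; clear; lia.
      - have := sh z' (y :: ys) X hz' yY; rewrite /= => ->; rewrite andbT.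
        move: yY => /andP[h1 _].
        by apply: le_trans (ler_normD _ _) _; exact: lerD.
      - by move: X0; clear; lia.
    apply: le_trans (IHs _ _ (Y + X) hs' _ _ _) _; last by rewrite /= size_map.
    - exact: separated_shift.
    - exact: sh.
    - by move: X0; clear; lia.
  (* The smaller shift is the one that must give up its first window. *)
  have [le|gt] := lerP x x'.
    by apply: key => //; lia.
  by rewrite addrC; apply: key => //; lia.
case: s IHs two bb => [|s] IHs two bb.
  rewrite addr0; apply: le_trans (IHs 0%N (y :: ys) Y _ _ _ _) => //; last by lia.
  rewrite /wsum ler_sum // => y' _; apply: ler_sum => i _.
  by rewrite /push !addr0.
have -> : wsum (push e x (push e x' (pushes e zs b)) s.+1) (y :: ys) a =
  wsum (pushes e zs b s.+1) (y :: ys) a +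
  (wsum (pushes e zs b s) [seq z + x | z <- y :: ys] a +
   wsum (pushes e zs b s) [seq z + x' | z <- y :: ys] a +
   (if s is s'.+1 then wsum (pushes e zs b s')
       [seq z + (x + x') | z <- y :: ys] a else 0)).
  rewrite -!wsum_shift /push.
  case: s {IHs two bb} => [|s].
    rewrite addr0 -!wsumD; apply: eq_bigr => z _; apply: eq_bigr => i _.
    by rewrite addr0; ring.
  rewrite -wsum_shift -!wsumD; apply: eq_bigr => z _; apply: eq_bigr => i _.
  by rewrite !mulrzDr !addrA; ring.
apply: lerD; first by apply: (IHs s.+1 (y :: ys) Y) => //; lia.
apply: lerD; first by apply: two; lia.
case: s IHs {two bb} => // s IHs.
apply: le_trans (IHs s _ (Y + (X + X)) _ _ _ _) _ => //; last by rewrite /= size_map.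
- lia.
- exact: separated_shift.
- by apply: (sh (x + x') (y :: ys)) => //; lia.
Qed.

End LittlewoodOfford.

(** * Central binomial coefficients and balanced choices from the pairs *)

Lemma central_bin_rec m : (m.+1 * 'C(m.+1.*2, m.+1) = 2 * m.*2.+1 * 'C(m.*2, m))%N.
Proof.
have h1 := mul_bin_diag m.*2.+1 m.
have h2 := mul_bin_diag m.*2 m.
have h3 : 'C(m.*2.+1, m.+1) = 'C(m.*2.+1, m).
  by rewrite -(bin_sub (n:=m.*2.+1) (m:=m)); [congr 'C(_, _); lia|lia].
rewrite doubleS.
have h4 := mul_bin_down m.*2.+1 m.+1.
rewrite /= in h1 h2 h4.
have E := binS m.*2.+1 m.
rewrite E h3 /=.
have h5 := mul_bin_down m.*2.+1 m.
rewrite /= in h5.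
have e5 : (m.*2.+1 - m = m.+1)%N by lia.
rewrite e5 in h5; nia.
Qed.

(** With the matching lower bound it replaces Stirling's formula; both follow by induction from the
    rational ratio of consecutive central coefficients. *)
Lemma central_bin_upper (R : realFieldType) m :
  (m.*2.+1)%:R * ('C(m.*2, m)%:R) ^+ 2 <= 16 ^+ m :> R.
Proof.
elim: m => [|m IH]; first by rewrite expr0 bin0 expr1n mulr1.
have := congr1 (fun k => k%:R : R) (central_bin_rec m).
rewrite !natrM.
set c := ('C(m.*2, m))%:R; set c' := ('C(m.+1.*2, m.+1))%:R => E.
rewrite -/c in IH.
have m1 : 0 < (m.+1)%:R :> R by rewrite ltr0n.
rewrite -(ler_pM2l (exprn_gt0 2 m1)) mulrCA -exprMn E [16 ^+ _]exprS.
have -> : (m.+1.*2.+1)%:R = 2 * m%:R + 3 :> R by rewrite -muln2 -natr1 natrM -natr1; ring.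
have e1 : (m.*2.+1)%:R = 2 * m%:R + 1 :> R by rewrite -muln2 -natr1 natrM; ring.
have e2 : (m.+1)%:R = m%:R + 1 :> R by rewrite -natr1.
rewrite ?e1 ?e2 in IH *.
have m0 : 0 <= m%:R :> R by rewrite ler0n.
set y := m%:R in m0 IH *.
have h : (2 * y + 3) * (2 * (2 * y + 1) * c) ^+ 2 =
  (4 * (2 * y + 3) * (2 * y + 1)) * ((2 * y + 1) * c ^+ 2) by ring.
rewrite h; apply: (@le_trans _ _ (4 * (2 * y + 3) * (2 * y + 1) * 16 ^+ m)).
  apply: ler_wpM2l => //; nra.
have p : 0 <= 16 ^+ m :> R by apply: exprn_ge0; lra.
rewrite mulrA; apply: ler_wpM2r => //; nra.
Qed.

Lemma central_bin_lower (R : realFieldType) m :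
  16 ^+ m <= (4 * m%:R + 1) * ('C(m.*2, m)%:R) ^+ 2 :> R.
Proof.
elim: m => [|m IH]; first by rewrite expr0 bin0 expr1n mulr1 mulr0 add0r.
have := congr1 (fun k => k%:R : R) (central_bin_rec m).
rewrite !natrM.
set c := ('C(m.*2, m))%:R; set c' := ('C(m.+1.*2, m.+1))%:R => E.
rewrite -/c in IH.
have m1 : 0 < (m.+1)%:R :> R by rewrite ltr0n.
rewrite -(ler_pM2l (exprn_gt0 2 m1)) [leRHS]mulrCA -exprMn E [16 ^+ _]exprS.
have e1 : (m.*2.+1)%:R = 2 * m%:R + 1 :> R by rewrite -muln2 -natr1 natrM; ring.
have e2 : (m.+1)%:R = m%:R + 1 :> R by rewrite -natr1.
rewrite ?e1 ?e2 in IH *.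
have m0 : 0 <= m%:R :> R by rewrite ler0n.
set y := m%:R in m0 IH *.
apply: (@le_trans _ _ ((y + 1) ^+ 2 * (16 * ((4 * y + 1) * c ^+ 2)))).
  by apply: ler_wpM2l; [apply: sqr_ge0|lra].
have -> : (4 * (y + 1) + 1) * (2 * (2 * y + 1) * c) ^+ 2 =
  ((4 * y + 5) * 4 * (2 * y + 1) ^+ 2) * c ^+ 2 by ring.
have -> : (y + 1) ^+ 2 * (16 * ((4 * y + 1) * c ^+ 2)) =
  ((y + 1) ^+ 2 * 16 * (4 * y + 1)) * c ^+ 2 by ring.
apply: ler_wpM2r; first exact: sqr_ge0.
have -> : (4 * y + 5) * 4 * (2 * y + 1) ^+ 2 =
   (y + 1) ^+ 2 * 16 * (4 * y + 1) + 4 by ring.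
lra.
Qed.

(** Both sides times [(a! (h - a)!)^2] equal [(2 h)!]. The ratio of ['C(h, a)^2] to ['C(2 h, 2 a)]
    is thereby expressed through central coefficients only. *)
Lemma bin_square_central h a : (a <= h)%N ->
  ('C(h, a) ^ 2 * 'C(h.*2, h) = 'C(h.*2, a.*2) * 'C(a.*2, a) * 'C((h - a).*2, h - a))%N.
Proof.
move=> ah.
have F1 := bin_fact ah.
have F (b : nat) : ('C(b.*2, b) * (b`! * b`!) = (b.*2)`!)%N.
  have := @bin_fact b.*2 b; rewrite (_ : b.*2 - b = b)%N; last by lia.
  by apply; lia.
have F2 := F h.
have F3 : ('C(h.*2, a.*2) * ((a.*2)`! * ((h - a).*2)`!) = (h.*2)`!)%N.
  by rewrite doubleB; apply: bin_fact; lia.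
have F4 := F a; have F5 := F (h - a)%N.
have p1 := fact_gt0 a; have p2 := fact_gt0 (h - a).
have pp : (0 < (a`! * (h-a)`!) ^ 2)%N by rewrite expn_gt0 muln_gt0 p1 p2.
apply/eqP; rewrite -(eqn_pmul2r pp); apply/eqP.
transitivity (h.*2)`!.
  rewrite -F2 -F1; ring.
rewrite -F3 -F4 -F5; ring.
Qed.

Section MiddleTerms.
Variable R : realFieldType.

Lemma bin_ratio_sqr h a : (a <= h)%N ->
  (('C(h, a) ^ 2)%:R / 'C(h.*2, a.*2)%:R) ^+ 2 <=
  2 * ((a.*2.+1)%:R^-1 + ((h - a).*2.+1)%:R^-1) :> R.
Proof.
move=> ah.
have c2 : 0 < 'C(h.*2, a.*2)%:R :> R by rewrite ltr0n bin_gt0; lia.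
have ch : 0 < 'C(h.*2, h)%:R :> R by rewrite ltr0n bin_gt0; lia.
have E : ('C(h, a) ^ 2)%:R / 'C(h.*2, a.*2)%:R =
   'C(a.*2, a)%:R * 'C((h - a).*2, h - a)%:R / 'C(h.*2, h)%:R :> R.
  apply/eqP; rewrite eqr_div ?lt0r_neq0 // -!natrM bin_square_central //.
  by apply/eqP; congr (_%:R); ring.
rewrite E expr_div_n exprMn.
have u1 := central_bin_upper R a; have u2 := central_bin_upper R (h - a).
have l := central_bin_lower R h.
set x := 'C(a.*2, a)%:R in u1 *; set y := 'C((h-a).*2, h - a)%:R in u2 *.
set z := 'C(h.*2, h)%:R in ch l *.
have pa : 0 < (a.*2.+1)%:R :> R by rewrite ltr0n.
have pb : 0 < ((h - a).*2.+1)%:R :> R by rewrite ltr0n.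
have hab : (a.*2.+1)%:R + ((h - a).*2.+1)%:R = 2 * h%:R + 2 :> R.
  by rewrite -natrD (_ : _ + _ = 2 * h + 2)%N; [rewrite natrD natrM|lia].
set A := (a.*2.+1)%:R in pa hab u1 *; set B := ((h-a).*2.+1)%:R in pb hab u2 *.
rewrite ler_pdivrMr ?exprn_gt0 //.
have -> : 2 * (A^-1 + B^-1) * z ^+ 2 = (2 * (A + B) * z ^+ 2) / (A * B).
  by field; rewrite !(addrC 1) !natr1 !pnatr_eq0.
rewrite ler_pdivlMr ?mulr_gt0 //.
have -> : x ^+ 2 * y ^+ 2 * (A * B) = (A * x ^+ 2) * (B * y ^+ 2) by ring.
apply: (@le_trans _ _ (16 ^+ a * 16 ^+ (h - a))).
  by apply: ler_pM => //; rewrite mulr_ge0 ?sqr_ge0 // ltW.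
rewrite -exprD subnKC //; apply: le_trans l _.
rewrite hab; apply: ler_wpM2r; first exact: sqr_ge0.
lra.
Qed.

(** The number of ways to take [j] entries from [h] pairs [(1, -1)] with equally many of both signs,
    up to one. *)
Definition midbin (h j : nat) : R := ('C(h, j./2) * 'C(h, uphalf j))%:R.

(** It trades the square root of an inverse variance for an expression linear in that inverse, which
    Vandermonde's sum can average; [q] will be the square root of [n]. *)
Lemma amgm (q x : R) : 0 < q -> x <= (q^-1 + q * x ^+ 2) / 2.
Proof.
move=> q0; rewrite ler_pdivlMr //.
rewrite -subr_ge0.
have -> : q^-1 + q * x ^+ 2 - x * 2 = q * (q^-1 - x) ^+ 2 by field; rewrite lt0r_neq0.
by rewrite mulr_ge0 ?sqr_ge0 // ltW.
Qed.

Lemma midbin_le h j (q : R) : 0 < q ->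
  midbin h j <= 'C(h.*2, j)%:R *
    (q^-1 + 4 * q * ((j.+1)%:R^-1 + ((h.*2 - j).+1)%:R^-1)) / 2.
Proof.
move=> q0.
have pos k : 0 <= (k.+1)%:R^-1 :> R by rewrite invr_ge0 ler0n.
have rpos : 0 <= 'C(h.*2, j)%:R *
    (q^-1 + 4 * q * ((j.+1)%:R^-1 + ((h.*2 - j).+1)%:R^-1)) / 2.
  rewrite divr_ge0 // mulr_ge0 ?ler0n //.
  apply: addr_ge0; first by rewrite invr_ge0 ltW.
  by apply: mulr_ge0; [apply: mulr_ge0 => //; exact: ltW|exact: addr_ge0].
have [jh|jh] := leqP j h.*2; last first.
  rewrite /midbin (_ : 'C(h, uphalf j) = 0%N) ?muln0 //.
  by apply: bin_small; lia.
set a := j./2.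
have ah : (a <= h)%N by rewrite /a; lia.
pose x : R := ('C(h, a) ^ 2)%:R / 'C(h.*2, a.*2)%:R.
have c2 : 0 < 'C(h.*2, a.*2)%:R :> R by rewrite ltr0n bin_gt0; lia.
have x0 : 0 <= x by rewrite divr_ge0 ?ler0n.
have step : midbin h j <= 'C(h.*2, j)%:R * x.
  (* For [j = 2 a + 1], passing from [2 a] to [j] multiplies ['C(h, a)^2] by [(h - a) / (a + 1)],
     and ['C(2 h, 2 a)] by the no smaller [2 (h - a) / (2 a + 1)]. *)
  have [oj|ej] := boolP (odd j); last first.
    have -> : midbin h j = ('C(h, a) ^ 2)%:R.
      by rewrite /midbin -/a (_ : uphalf j = a) ?mulnn // /a; lia.
    have -> : j = a.*2 by rewrite /a; lia.
    by rewrite /x mulrC divfK ?gt_eqF.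
  have ja : j = a.*2.+1 by rewrite /a; lia.
  have -> : midbin h j = ('C(h, a) * 'C(h, a.+1))%:R.
    by rewrite /midbin -/a (_ : uphalf j = a.+1) // /a; lia.
  have b1 : (a.+1 * 'C(h, a.+1) = (h - a) * 'C(h, a))%N by rewrite mul_bin_left.
  have b2 : (j * 'C(h.*2, j) = (h - a).*2 * 'C(h.*2, a.*2))%N.
    by rewrite ja mul_bin_left doubleB.
  rewrite /x mulrA ler_pdivlMr // -!natrM ler_nat.
  have ltah : (0 < h - a)%N by rewrite /a; lia.
  rewrite -(leq_pmul2l ltah) -(leq_pmul2l (isT : 0 < 2)%N).
  have j0 : (0 < j)%N by lia.
  rewrite -(leq_pmul2l (ltn0Sn a)).
  apply: (@leq_trans ('C(h, a) * ((h - a) * 'C(h, a)) * (j * 'C(h.*2, j)))%N).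
    rewrite -b1 b2 -[(h - a).*2]mul2n; apply: eq_leq.
    by move: (h - a)%N => d; ring.
  rewrite ja; nia.
apply: le_trans step _; rewrite -mulrA; apply: ler_wpM2l; first exact: ler0n.
apply: le_trans (amgm x q0) _.
rewrite ler_pM2r ?invr_gt0 // lerD2l -[4 * q]mulrC -mulrA ler_pM2l //.
apply: le_trans (bin_ratio_sqr ah) _.
have i1 : (a.*2.+1)%:R^-1 <= 2 * (j.+1)%:R^-1 :> R.
  rewrite -div1r ler_pdivrMr ?ltr0n // mulrAC ler_pdivlMr ?ltr0n // mul1r.
  by rewrite -natrM ler_nat /a; lia.
have i2 : ((h - a).*2.+1)%:R^-1 <= ((h.*2 - j).+1)%:R^-1 :> R.
  by rewrite lef_pV2 ?posrE ?ltr0n // ler_nat /a; lia.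
move: i1 i2 (pos (h.*2 - j)%N).
move: ((a.*2.+1)%:R^-1 : R) ((j.+1)%:R^-1 : R) (((h - a).*2.+1)%:R^-1 : R)
  (((h.*2 - j).+1)%:R^-1 : R) => A B C E; clear; lra.
Qed.

End MiddleTerms.

Section WalkFormula.
Variable R : realFieldType.

Lemma pushes_nseq (V : zmodType) (e : V) h x (F : nat -> V -> R) s t :
  pushes e (nseq h x) F s t =
  \sum_(a < s.+1) 'C(h, a)%:R * F (s - a)%N (t + e *~ x *+ a).
Proof.
elim: h s t => [|h IH] s t.
  rewrite big_ord_recl /= bin0 mul1r subn0 mulr0n addr0 big1 ?addr0 // => i _.
  by rewrite /bump /= bin_small ?mul0r.
rewrite /= /push; case: s => [|s].
  by rewrite IH addr0 !big_ord_recl !big_ord0 !bin0.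
rewrite !IH [in RHS]big_ord_recl [in LHS]big_ord_recl -addrA; congr (_ + _).
  by rewrite !bin0.
rewrite -big_split /=; apply: eq_bigr => i _.
rewrite /bump /= !add1n subSS binS natrD mulrDl mulrS addrA; congr (_ + _).
Qed.

Lemma unit_pairs_nseq h (F : nat -> int -> R) :
  pushes (1 : int) (unit_pairs h) F =2
  pushes (1 : int) (nseq h 1) (pushes (1 : int) (nseq h (-1)) F).
Proof.
elim: h => //= h IH s t; apply: eq_push => s' t'.
have -> : pushes 1 (nseq h 1) (push 1 (-1) (pushes 1 (nseq h (-1)) F)) s' t' =
   push 1 (-1) (pushes 1 (nseq h 1) (pushes 1 (nseq h (-1)) F)) s' t'.
  by rewrite push_pushes.
exact: eq_push.
Qed.

Lemma walk_diag (be : nat -> R) h s (d : bool) :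
  walk be h s d%:Z = \sum_(a < s.+1)
    (if (a.*2 + d <= s)%N then
       'C(h, a)%:R * 'C(h, a + d)%:R * be (s - (a.*2 + d))%N else 0).
Proof.
rewrite /walk unit_pairs_nseq pushes_nseq; apply: eq_bigr => a _.
rewrite pushes_nseq.
have [le|gt] := leqP (a.*2 + d)%N s; last first.
  rewrite big1 ?mulr0 // => b _; rewrite ifF ?mulr0 //.
  by apply/eqP; rewrite mulr1z mulrNz mulr1z mulNrn; have := ltn_ord b; lia.
have lb : (a + d < (s - a).+1)%N by lia.
rewrite (bigD1 (Ordinal lb)) //= big1 ?addr0; last first.
  move=> b; rewrite -val_eqE /= => nb; rewrite ifF ?mulr0 //.
  by apply/eqP; rewrite mulr1z mulrNz mulr1z mulNrn; lia.
rewrite ifT; last by apply/eqP; rewrite mulr1z mulrNz mulr1z mulNrn; lia.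
by rewrite mulrA; congr (_ * be _); lia.
Qed.

Lemma big_double (w : nat -> R) n :
  \sum_(a < n) (w a.*2 + w a.*2.+1) = \sum_(j < n.*2) w j.
Proof.
by elim: n => [|n IH]; rewrite ?big_ord0 // doubleS !big_ord_recr /= IH addrA.
Qed.

(** The central points 0 and 1 correspond to an even and to an odd number [j] of entries taken from
    the pairs; interleaving them gives a single sum over [j]. *)
Lemma kbound1E (be : nat -> R) h s :
  kbound be h s 1 = \sum_(j < s.+1) midbin R h j * be (s - j)%N.
Proof.
pose w j := if (j <= s)%N then midbin R h j * be (s - j)%N else 0.
transitivity (\sum_(a < s.+1) (w a.*2 + w a.*2.+1)).
  have -> : kbound be h s 1 = walk be h s false%:Z + walk be h s true%:Z.
    by rewrite /kbound !big_ord_recl big_ord0 addr0.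
  rewrite !walk_diag -big_split; apply: eq_bigr => a _ /=.
  have m0 : midbin R h a.*2 = 'C(h, a)%:R * 'C(h, a)%:R.
    by rewrite /midbin uphalf_double doubleK natrM.
  have m1 : midbin R h a.*2.+1 = 'C(h, a)%:R * 'C(h, a.+1)%:R.
    by rewrite /midbin -natrM; congr ('C(_, _) * 'C(_, _))%:R; lia.
  by rewrite /w !addn0 !addn1 m0 m1.
rewrite big_double.
have E : (s.+1.*2 = s.+1 + s.+1)%N by rewrite addnn.
rewrite E big_split_ord /= [X in _ + X]big1 ?addr0 => [|i _]; last first.
  by rewrite /w ifF //; apply/negP; lia.
by apply: eq_bigr => i _; rewrite /w -ltnS ltn_ord.
Qed.

(** Within a slice the number [j] of entries taken from the pairs is hypergeometric, and after
    [midbin_le] only the means of [1 / (j + 1)] and [1 / (2 h - j + 1)] are needed. Absorption,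
    ['C(2 h, j) / (j + 1) = 'C(2 h + 1, j + 1) / (2 h + 1)] and its mirror image, reduces both to
    Vandermonde's sum. *)
Lemma kbound_bin (be : R) (l h s : nat) q : 0 < q -> 0 <= be -> (s <= l + h.*2)%N ->
  kbound (fun s => be * 'C(l, s)%:R) h s 1 <=
  be * ((q^-1 + 4 * q * ((l + h.*2).+1%:R / h.*2.+1%:R *
     ((s.+1)%:R^-1 + ((l + h.*2 - s).+1)%:R^-1))) / 2) * 'C(l + h.*2, s)%:R.
Proof.
move=> q0 be0 sl; rewrite kbound1E.
pose T j : R := 'C(h.*2, j)%:R * 'C(l, s - j)%:R.
have S0 : \sum_(j < s.+1) T j = 'C(l + h.*2, s)%:R.
  rewrite addnC -binomial.Vandermonde natr_sum; apply: eq_bigr => j _.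
  by rewrite natrM.
have H1 : (h.*2.+1)%:R != 0 :> R by rewrite pnatr_eq0.
have S1 : \sum_(j < s.+1) T j * (j.+1)%:R^-1 <=
   'C(l + h.*2, s)%:R * ((l + h.*2).+1%:R / h.*2.+1%:R * (s.+1)%:R^-1).
  have -> : 'C(l + h.*2, s)%:R * ((l + h.*2).+1%:R / h.*2.+1%:R * (s.+1)%:R^-1) =
     'C((l + h.*2).+1, s.+1)%:R / h.*2.+1%:R :> R.
    have := congr1 (fun k => k%:R : R) (mul_bin_diag (l + h.*2).+1 s).
    rewrite /= !natrM => E.
    have s1 : (s.+1)%:R != 0 :> R by rewrite pnatr_eq0.
    apply: (mulfI s1); rewrite [RHS]mulrA -E.
    move: s1 H1; move: ((s.+1)%:R : R) ((h.*2.+1)%:R : R) => u v u0 v0.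
    by field; rewrite u0 v0.
  have -> : 'C((l + h.*2).+1, s.+1)%:R =
     \sum_(j < s.+2) 'C(h.*2.+1, j)%:R * 'C(l, s.+1 - j)%:R :> R.
    rewrite (_ : (l + h.*2).+1 = h.*2.+1 + l)%N; last by lia.
    rewrite -binomial.Vandermonde natr_sum; apply: eq_bigr => j _; by rewrite natrM.
  rewrite [X in _ <= X / _]big_ord_recl mulrDl.
  apply: ler_wpDl; first by rewrite divr_ge0 ?mulr_ge0 ?ler0n.
  rewrite mulr_suml; apply: ler_sum => j _.
  rewrite !lift0 subSS /T.
  have := congr1 (fun k => k%:R : R) (mul_bin_diag h.*2.+1 j).
  rewrite /= !natrM => E.
  have j1 : (j.+1)%:R != 0 :> R by rewrite pnatr_eq0.
  have -> : 'C(h.*2, j)%:R = (j.+1)%:R * 'C(h.*2.+1, j.+1)%:R / (h.*2.+1)%:R :> R.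
    by rewrite -E mulrC mulKf.
  rewrite le_eqVlt; apply/orP; left; apply/eqP.
  move: j1 H1; move: ((j.+1)%:R : R) ((h.*2.+1)%:R : R) => u v u0 v0.
  by field; rewrite u0 v0.
have S2 : \sum_(j < s.+1) T j * ((h.*2 - j).+1)%:R^-1 <=
   'C(l + h.*2, s)%:R * ((l + h.*2).+1%:R / h.*2.+1%:R * ((l + h.*2 - s).+1)%:R^-1).
  have -> : 'C(l + h.*2, s)%:R * ((l + h.*2).+1%:R / h.*2.+1%:R * ((l + h.*2 - s).+1)%:R^-1) =
     'C((l + h.*2).+1, s)%:R / h.*2.+1%:R :> R.
    have := congr1 (fun k => k%:R : R) (mul_bin_down (l + h.*2).+1 s).
    rewrite /= !natrM => E.
    have s1 : ((l + h.*2 - s).+1)%:R != 0 :> R by rewrite pnatr_eq0.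
    have e : ((l + h.*2).+1 - s = (l + h.*2 - s).+1)%N by lia.
    rewrite e in E.
    apply: (mulfI s1); rewrite [RHS]mulrA -E.
    move: s1 H1; move: (((l + h.*2 - s).+1)%:R : R) ((h.*2.+1)%:R : R) => u v u0 v0.
    by field; rewrite u0 v0.
  have -> : 'C((l + h.*2).+1, s)%:R =
     \sum_(j < s.+1) 'C(h.*2.+1, j)%:R * 'C(l, s - j)%:R :> R.
    rewrite (_ : (l + h.*2).+1 = h.*2.+1 + l)%N; last by lia.
    rewrite -binomial.Vandermonde natr_sum; apply: eq_bigr => j _; by rewrite natrM.
  rewrite mulr_suml; apply: ler_sum => j _; rewrite /T.
  have [jh|jh] := leqP j h.*2; last first.
    rewrite bin_small // !mul0r divr_ge0 ?mulr_ge0 ?ler0n //.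
  have := congr1 (fun k => k%:R : R) (mul_bin_down h.*2.+1 j).
  rewrite /= !natrM.
  have -> : (h.*2.+1 - j = (h.*2 - j).+1)%N by lia.
  move=> E.
  have j1 : ((h.*2 - j).+1)%:R != 0 :> R by rewrite pnatr_eq0.
  have -> : 'C(h.*2, j)%:R = ((h.*2 - j).+1)%:R * 'C(h.*2.+1, j)%:R / (h.*2.+1)%:R :> R.
    by rewrite -E mulrC mulKf.
  rewrite le_eqVlt; apply/orP; left; apply/eqP.
  move: j1 H1; move: (((h.*2 - j).+1)%:R : R) ((h.*2.+1)%:R : R) => u v u0 v0.
  by field; rewrite u0 v0.
apply: (@le_trans _ _ (\sum_(j < s.+1) be / 2 * (q^-1 * T j + 4 * q *
    (T j * (j.+1)%:R^-1 + T j * ((h.*2 - j).+1)%:R^-1)))).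
  apply: ler_sum => j _.
  apply: le_trans (ler_wpM2r _ (midbin_le _ _ q0)) _.
    by rewrite mulr_ge0 ?ler0n.
  rewrite le_eqVlt; apply/orP; left; apply/eqP; rewrite /T.
  set a := (j.+1)%:R^-1; set b := (_.+1)%:R^-1.
  ring.
rewrite -mulr_sumr big_split /= -mulr_sumr S0 -mulr_sumr big_split /=.
apply: (@le_trans _ _ (be / 2 * (q^-1 * 'C(l + h.*2, s)%:R + 4 * q *
   ('C(l + h.*2, s)%:R * ((l + h.*2).+1%:R / h.*2.+1%:R * (s.+1)%:R^-1) +
    'C(l + h.*2, s)%:R * ((l + h.*2).+1%:R / h.*2.+1%:R * ((l + h.*2 - s).+1)%:R^-1))))).
  apply: ler_wpM2l; first by rewrite divr_ge0.
  rewrite lerD2l; apply: ler_wpM2l; first by rewrite mulr_ge0 // ltW.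
  exact: lerD.
rewrite le_eqVlt; apply/orP; left; apply/eqP.
set a := (s.+1)%:R^-1; set b := (_.+1)%:R^-1; set c := (_ / _); ring.
Qed.

End WalkFormula.

Section Windows.
Variables (R : realFieldType) (V : finZmodType) (e : V) (N : nat).

Definition winb (g : V -> R) (b : R) :=
  forall a, \sum_(i < N) g (a + e *~ i%:Z) <= b.

Lemma winbD g h a b x : winb g a -> winb h b ->
  winb (fun t => g t + h (t + e *~ x)) (a + b).
Proof.
move=> ga hb c; rewrite big_split /=; apply: lerD => //.
by apply: le_trans (hb (c + e *~ x)); apply: ler_sum => i _; rewrite addrAC.
Qed.

Lemma eq_winb g h b : g =1 h -> winb g b -> winb h b.
Proof. by move=> gh gb a; rewrite -(eq_bigr _ (fun i _ => gh _)). Qed.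

Lemma winb_le g h b : (forall t, g t <= h t) -> winb h b -> winb g b.
Proof. by move=> gh hb a; apply: le_trans (hb a); apply: ler_sum. Qed.

Lemma winb_pushes xs F (l s : nat) c :
  (forall s', (s' <= s <= s' + size xs)%N -> winb (F s') (c * 'C(l, s')%:R)) ->
  winb (pushes e xs F s) (c * 'C(size xs + l, s)%:R).
Proof.
move=> Fc; apply: (@pushes_pascal R V e winb) => //.
- by move=> g h a b x; exact: winbD.
- by move=> g h a; exact: eq_winb.
Qed.

Lemma big_ord_mul (g : nat -> R) m k :
  \sum_(i < m * k) g i = \sum_(j < m) \sum_(i < k) g (j * k + i)%N.
Proof.
elim: m => [|m IH]; first by rewrite !big_ord0.
by rewrite mulSnr big_split_ord /= IH big_ord_recr.
Qed.

Lemma sum_ord_le (g : nat -> R) m k : (m <= k)%N -> (forall i, 0 <= g i) ->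
  \sum_(i < m) g i <= \sum_(i < k) g i.
Proof.
move=> mk g0; rewrite -(subnKC mk) big_split_ord /= lerDl.
by apply: sumr_ge0.
Qed.

(* The bound [(1 + 16 / (c1 c2)) / 2] comes from AM-GM applied to the
   inverse square roots of the variance of the number of ones in the pairs. *)
Lemma littlewood_offord (rho X : int) (D Rr : nat) (b : nat -> V -> R)
    (be c1 c2 q n : R) (zs : seq int) (l h s : nat) :
  (forall z : int, `|z| <= rho -> e *~ z = 0 -> z = 0) ->
  (forall s t, 0 <= b s t) -> 0 <= be -> gapped D zs -> size zs = h.*2 ->
  all (fun x : int => `|x| <= X) zs -> 0 <= X ->
  (X *+ h.*2 + D%:Z) *+ 2 <= rho -> (N <= Rr * D)%N ->
  (forall s', (s' <= s <= s' + h.*2)%N -> \sum_t b s' t <= be * 'C(l, s')%:R) ->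
  0 < c1 -> 0 < c2 -> 0 < q -> q ^+ 2 = n ->
  (s <= l + h.*2)%N -> (l + h.*2).+1%:R <= 2 * n ->
  c1 * n <= (s.+1)%:R -> c1 * n <= ((l + h.*2 - s).+1)%:R -> c2 * n <= (h.*2.+1)%:R ->
  winb (pushes e zs b s)
    (be * (Rr%:R * ((1 + 16 / (c1 * c2)) / 2) / q) * 'C(l + h.*2, s)%:R).
Proof.
move=> inj b0 be0 gz sz zX X0 hrho ND bb c10 c20 q0 qn sl ln s1 s2 h2 a.
have n0 : 0 < n by rewrite -qn exprn_gt0.
set g := pushes e zs b s.
have g0 t : 0 <= g t by exact: pushes_ge0.
pose W := be * ((1 + 16 / (c1 * c2)) / 2 / q) * 'C(l + h.*2, s)%:R.
have key c : \sum_(i < D) g (c + e *~ i%:Z) <= W.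
  have := @littlewood_offord_windows R V e rho D inj b (fun s => be * 'C(l, s)%:R)
    X zs b0 _ gz zX X0 h s [:: 0] c 0 sz bb.
  rewrite /wsum big_seq1 /=.
  under eq_bigr => i _ do rewrite add0r.
  move=> H; apply: le_trans (H _ _ _ _) _ => //.
  - by move=> s'; rewrite mulr_ge0 ?ler0n.
  - by rewrite add0r.
  apply: le_trans (kbound_bin q0 be0 sl) _.
  rewrite /W; apply: ler_wpM2r; first exact: ler0n.
  apply: ler_wpM2l => //.
  rewrite [leRHS]mulrAC ler_pM2r ?invr_gt0 //.
  have i1 : (s.+1)%:R^-1 <= (c1 * n)^-1 :> R.
    by rewrite lef_pV2 ?posrE ?ltr0n ?mulr_gt0.
  have i2 : ((l + h.*2 - s).+1)%:R^-1 <= (c1 * n)^-1 :> R.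
    by rewrite lef_pV2 ?posrE ?ltr0n ?mulr_gt0.
  have i3 : (h.*2.+1)%:R^-1 <= (c2 * n)^-1 :> R.
    by rewrite lef_pV2 ?posrE ?ltr0n ?mulr_gt0.
  have i4 : (l + h.*2).+1%:R / h.*2.+1%:R <= 2 * n * (c2 * n)^-1 :> R.
    by apply: ler_pM => //; rewrite ?ler0n ?invr_ge0 ?ler0n.
  have -> : (1 + 16 / (c1 * c2)) / q =
     q^-1 + 4 * q * (2 * n * (c2 * n)^-1 * ((c1 * n)^-1 + (c1 * n)^-1)).
    by rewrite -qn; field; rewrite !lt0r_neq0.
  rewrite lerD2l; apply: ler_wpM2l; first by rewrite mulr_ge0 // ltW.
  apply: ler_pM => //; last exact: lerD.
    by rewrite divr_ge0 ?ler0n.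
  by rewrite addr_ge0 ?invr_ge0 ?ler0n.
apply: le_trans (sum_ord_le (g := fun i => g (a + e *~ i%:Z)) ND _) _ => //.
rewrite (big_ord_mul (fun i => g (a + e *~ i%:Z))).
apply: (@le_trans _ _ (\sum_(j < Rr) W)).
  apply: ler_sum => j _; apply: le_trans (key (a + e *~ (j * D)%N%:Z)).
  by apply: ler_sum => i _; rewrite PoszD mulrzDr addrA.
rewrite sumr_const card_ord -[W *+ Rr]mulr_natr /W.
rewrite le_eqVlt; apply/orP; left; apply/eqP; ring.
Qed.

End Windows.

(** * The potential method *)

Section Potential.
Variables (R : realFieldType) (V : finZmodType) (e : V) (N : nat).
Implicit Types (F : nat -> V -> R).

(* The factor 4 leaves room for a union of two intervals of total length at
   least [2 N]. *)
Definition spread (A : seq int) := forall (g : V -> R) b, (forall t, 0 <= g t) ->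
  winb e N g b -> forall t,
  avg A (fun x => g (t + e *~ x)) <= 4 * b / N%:R /\
  avg A (fun x => g (t - e *~ x)) <= 4 * b / N%:R.

Definition exc (tau : R) (l : nat) F (s : nat) (t : V) : R :=
  Num.max 0 (F s t - tau * 'C(l, s)%:R).

Lemma exc_ge0 tau l F s t : 0 <= exc tau l F s t.
Proof. by rewrite le_max lexx. Qed.

Lemma le_max0D (a b : R) : Num.max 0 (a + b) <= Num.max 0 a + Num.max 0 b.
Proof.
rewrite ge_max addr_ge0 ?le_max ?lexx //=.
by apply: lerD; rewrite le_max lexx orbT.
Qed.

Lemma exc_push tau l F x s t :
  exc tau l.+1 (push e x F) s t <= push e x (exc tau l F) s t.
Proof.
rewrite /exc /push; case: s => [|s]; first by rewrite !addr0 !bin0.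
apply: le_trans (le_max0D _ _); rewrite binS natrD mulrDr.
rewrite le_eqVlt; apply/orP; left; apply/eqP; congr Num.max; ring.
Qed.

Lemma exc_pushes tau l F xs s t :
  exc tau (size xs + l) (pushes e xs F) s t <= pushes e xs (exc tau l F) s t.
Proof.
elim: xs s t => //= x xs IH s t; rewrite addSn.
apply: le_trans (exc_push _ _ _ _ _ _) _; rewrite /push.
by apply: lerD => //; case: s.
Qed.

Definition potential tau k l F s := \sum_t exc tau l F s t ^+ k.

Lemma potential_ge0 tau k l F s : 0 <= potential tau k l F s.
Proof. by apply: sumr_ge0 => t _; rewrite exprn_ge0 ?exc_ge0. Qed.

(** There are cross terms only if both numbers are positive, that is, in the application, if the
    random shift takes a point of one superlevel set to a point of the other. *)
Lemma exprD_le_hit (a b : R) k : 0 <= a -> 0 <= b -> (0 < k)%N ->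
  (a + b) ^+ k <= a ^+ k + b ^+ k +
     2 ^+ k * ((0 < b)%R%:R * a ^+ k + (0 < a)%R%:R * b ^+ k).
Proof.
move=> a0 b0 k0.
have [a_gt|a_le] := ltP 0 a; last first.
  have -> : a = 0 by apply/le_anti; rewrite a_le.
  by rewrite expr0n eqn0Ngt k0 /= !add0r mulr0 mul0r !addr0 mulr0 addr0.
have [b_gt|b_le] := ltP 0 b; last first.
  have -> : b = 0 by apply/le_anti; rewrite b_le.
  by rewrite expr0n eqn0Ngt k0 /= !addr0 mulr0 mul0r addr0 mulr0 addr0.
rewrite !mul1r.
have ak : 0 <= a ^+ k by rewrite exprn_ge0.
have bk : 0 <= b ^+ k by rewrite exprn_ge0.
apply: (@le_trans _ _ (2 ^+ k * (a ^+ k + b ^+ k))); last first.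
  by rewrite lerDr addr_ge0.
have [ab|ba] := leP a b.
  apply: (@le_trans _ _ ((2 * b) ^+ k)).
    by apply: lerXn2r; rewrite ?nnegrE ?mulr_ge0 ?addr_ge0 //; lra.
  by rewrite exprMn ler_wpM2l ?exprn_ge0 // lerDr.
apply: (@le_trans _ _ ((2 * a) ^+ k)).
  by apply: lerXn2r; rewrite ?nnegrE ?mulr_ge0 ?addr_ge0 //; lra.
by rewrite exprMn ler_wpM2l ?exprn_ge0 // lerDl.
Qed.

(* [F s] is large only on a set that a spread coordinate rarely hits. *)
Definition rare (tau pi : R) l F s := exists g b c,
  [/\ 0 < c, forall t, 0 <= g t, winb e N g b,
      forall t, 0 < exc tau l F s t -> c <= g t & 4 * b / N%:R <= pi * c].

Lemma rare_avg A (tau pi : R) l F s : spread A -> rare tau pi l F s -> forall t,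
  avg A (fun x => (0 < exc tau l F s (t + e *~ x))%R%:R) <= pi /\
  avg A (fun x => (0 < exc tau l F s (t - e *~ x))%R%:R) <= pi.
Proof.
move=> sA [g [b [c [c0 g0 gb gc bpi]]]] t.
have [h1 h2] := sA g b g0 gb t.
have ind u : (0 < exc tau l F s u)%R%:R <= c^-1 * g u.
  case: (boolP (0 < exc tau l F s u)) => [/gc h|_] /=.
    by rewrite mulrC ler_pdivlMr // mul1r.
  by rewrite mulr_ge0 // invr_ge0 ltW.
have fin a : a <= 4 * b / N%:R -> c^-1 * a <= pi.
  by move=> h; rewrite mulrC ler_pdivrMr //; exact: le_trans h bpi.
split.
  by apply: le_trans (fin _ h1); rewrite -avgZ; apply: avg_le => x _; exact: ind.
by apply: le_trans (fin _ h2); rewrite -avgZ; apply: avg_le => x _; exact: ind.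
Qed.

(** Averaging over the shift turns each indicator of [exprD_le_hit] into a hitting probability, and
    [2 ^+ k * pi <= 1/2] leaves the factor 3/2. For one of the indicators the sum over [t] is
    translated back first, hence the reflected bound in [spread]. *)
Lemma potential_step A (tau pi : R) k l F s : spread A -> (0 < k)%N ->
  2 ^+ k * pi <= 2^-1 ->
  rare tau pi l F s -> rare tau pi l F s.+1 ->
  avg A (fun x => potential tau k l.+1 (push e x F) s.+1) <=
  3 / 2 * (potential tau k l F s.+1 + potential tau k l F s).
Proof.
move=> sA k0 kpi r0 r1.
pose E s t := exc tau l F s t.
have E0 s' t : 0 <= E s' t by exact: exc_ge0.
pose I (a : R) : R := (0 < a)%R%:R.
apply: (@le_trans _ _ (avg A (fun x => \sum_t (E s.+1 t ^+ k + E s t ^+ k +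
   2 ^+ k * (I (E s (t + e *~ x)) * E s.+1 t ^+ k +
             I (E s.+1 (t - e *~ x)) * E s t ^+ k))))).
  apply: avg_le => x _.
  apply: (@le_trans _ _ (\sum_t (E s.+1 t ^+ k + E s (t + e *~ x) ^+ k +
     2 ^+ k * (I (E s (t + e *~ x)) * E s.+1 t ^+ k +
               I (E s.+1 t) * E s (t + e *~ x) ^+ k)))).
    apply: ler_sum => t _; apply: le_trans (exprD_le_hit (E0 _ _) (E0 _ _) k0).
    apply: lerXn2r; rewrite ?nnegrE ?exc_ge0 ?addr_ge0 //.
    exact: exc_push.
  rewrite !big_split /= -!mulr_sumr !big_split /=.
  rewrite (sum_shift (fun t => E s t ^+ k)).
  rewrite le_eqVlt; apply/orP; left; apply/eqP.
  congr (_ + _ * (_ + _)).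
  rewrite -(sum_shift (fun t => I (E s.+1 (t - e *~ x)) * E s t ^+ k) (e *~ x)).
  by apply: eq_bigr => t _; rewrite addrK.
rewrite avg_sum.
apply: (@le_trans _ _ (\sum_t (E s.+1 t ^+ k + E s t ^+ k +
     2 ^+ k * (pi * E s.+1 t ^+ k + pi * E s t ^+ k)))).
  apply: ler_sum => t _; rewrite avgD; apply: lerD.
    by apply: avg_cst_le; rewrite addr_ge0 ?exprn_ge0.
  rewrite avgZ; apply: ler_wpM2l; first by rewrite exprn_ge0.
  rewrite avgD; apply: lerD.
    rewrite /avg -mulr_suml -mulrA [_ ^+ k * _]mulrC mulrA.
    by apply: ler_wpM2r; [rewrite exprn_ge0|case: (rare_avg sA r0 t)].
  rewrite /avg -mulr_suml -mulrA [_ ^+ k * _]mulrC mulrA.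
  by apply: ler_wpM2r; [rewrite exprn_ge0|case: (rare_avg sA r1 t)].
rewrite !big_split /= -!mulr_sumr !big_split /= -!mulr_sumr -!/(potential _ _ _ _ _).
have P1 := potential_ge0 tau k l F s.+1; have P0 := potential_ge0 tau k l F s.
rewrite -mulrDr mulrA.
have : 2 ^+ k * pi * (potential tau k l F s.+1 + potential tau k l F s) <=
   2^-1 * (potential tau k l F s.+1 + potential tau k l F s).
  by apply: ler_wpM2r => //; rewrite addr_ge0.
rewrite /potential in P0 P1 *; rewrite -/(E _ _); lra.
Qed.

(** Each coordinate costs 3, namely 3/2 for each of the two slices that feed a slice. The
    alternative in the step hypothesis is there for slices close to the ends of the cube, which have
    no useful window bound: there the moment is bounded for every outcome. *)
Lemma potential_bound (As : seq (seq int)) (dom : nat -> nat -> Prop)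
    (tau pi : R) k l F (Q : R) : (0 < k)%N -> 2 ^+ k * pi <= 2^-1 -> 0 <= Q ->
  {in As, forall A, spread A} ->
  (forall s, dom l s -> potential tau k l F s <= Q) ->
  (forall pre A As' s, As = pre ++ A :: As' -> dom (size As' + l).+1 s ->
    (forall ys, insupp (A :: As') ys ->
       potential tau k (size ys + l) (pushes e ys F) s <= Q) \/
    (exists s', [/\ s = s'.+1, dom (size As' + l)%N s, dom (size As' + l)%N s' &
       forall ys, insupp As' ys ->
         rare tau pi (size ys + l) (pushes e ys F) s' /\
         rare tau pi (size ys + l) (pushes e ys F) s])) ->
  forall s, dom (size As + l)%N s ->
    expect As (fun ys => potential tau k (size ys + l) (pushes e ys F) s)
      <= 3 ^+ size As * Q.
Proof.
move=> k0 kpi Q0; elim: As => [|A As IH] sAs base step s ds.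
  by rewrite /= expr0 mul1r; apply: base.
have three i : 1 <= 3 ^+ i :> R by rewrite exprn_ege1 ?ler1n.
case: (step [::] A As s erefl ds) => [det|[s' [-> d1 d0 hr]]].
  apply: le_trans (_ : Q <= _); last by rewrite ler_peMl.
  by apply: expect_le_cst => // ys /det.
have {}IH s0 : dom (size As + l)%N s0 ->
    expect As (fun ys => potential tau k (size ys + l) (pushes e ys F) s0)
      <= 3 ^+ size As * Q.
  apply: IH => //.
    by move=> B hB; apply: sAs; rewrite in_cons hB orbT.
  move=> pre B As' s1 E; apply: (step (A :: pre)); by rewrite E.
rewrite expect_cons.
apply: (@le_trans _ _ (expect As (fun ys => 3 / 2 *
   (potential tau k (size ys + l) (pushes e ys F) s'.+1 +
    potential tau k (size ys + l) (pushes e ys F) s')))).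
  apply: expect_le => ys yA; have [h0 h1] := hr ys yA.
  by apply: potential_step h1 => //; apply: sAs; rewrite mem_head.
rewrite expectZ expectD /= exprS.
move: (IH _ d1) (IH _ d0).
set a := expect _ _; set b := expect _ _; set c := 3 ^+ size As * Q.
rewrite -mulrA -/c; lra.
Qed.

End Potential.

(** * Fluctuations at scale N *)

Section Fluctuation.
Variables (R : realFieldType) (V : finZmodType) (e : V) (N : nat).
Hypothesis N0 : (0 < N)%N.
Implicit Types (g h : V -> R).

Definition smooth g t : R := (\sum_(i < N) g (t + e *~ i%:Z)) / N%:R.
Definition fluct g t : R := g t - smooth g t.
Definition energy g : R := \sum_t fluct g t ^+ 2.

Definition mix (q : R) g h (x : int) t : R := (1 - q) * g t + q * h (t + e *~ x).

Lemma eq_energy g h : g =1 h -> energy g = energy h.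
Proof.
move=> gh; apply: eq_bigr => t _; rewrite /fluct /smooth gh.
by under eq_bigr => i _ do rewrite gh.
Qed.

Lemma fluct_mix q g h x t :
  fluct (mix q g h x) t = (1 - q) * fluct g t + q * fluct h (t + e *~ x).
Proof.
rewrite /fluct /smooth /mix big_split /= -!mulr_sumr.
under [X in _ - (_ + q * X) / _]eq_bigr => i _ do rewrite addrAC.
ring.
Qed.

(** The identity for the squared norm of a convex combination: what is lost is the squared distance
    between the two fluctuations. *)
Lemma energy_mix q g h x :
  energy (mix q g h x) = (1 - q) * energy g + q * energy h
    - q * (1 - q) * \sum_t (fluct g t - fluct h (t + e *~ x)) ^+ 2.
Proof.
rewrite /energy -(sum_shift (fun t => fluct h t ^+ 2) (e *~ x)) !mulr_sumr.
rewrite -big_split -sumrB /=; apply: eq_bigr => t _; rewrite fluct_mix; ring.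
Qed.

Lemma smooth_ge0 g t : (forall t, 0 <= g t) -> 0 <= smooth g t.
Proof. by move=> g0; rewrite divr_ge0 ?ler0n // sumr_ge0. Qed.

Lemma smooth_le g b t : winb e N g b -> smooth g t <= b / N%:R.
Proof. by move=> gb; rewrite ler_wpM2r ?invr_ge0 ?ler0n. Qed.

Let Npos : 0 < N%:R :> R. Proof. by rewrite ltr0n. Qed.

Lemma smooth_sum g : \sum_t smooth g t = \sum_t g t.
Proof.
rewrite /smooth -mulr_suml exchange_big /=.
under eq_bigr => i _ do rewrite sum_shift.
by rewrite sumr_const card_ord -[_ *+ N]mulr_natr mulfK // lt0r_neq0.
Qed.

Lemma avgN_le (G : 'I_N -> R) b : (forall i, G i <= b) -> (\sum_(i < N) G i) / N%:R <= b.
Proof.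
move=> Gb; rewrite ler_pdivrMr //.
apply: le_trans (ler_sum _ (fun i _ => Gb i)) _.
by rewrite sumr_const card_ord -[_ *+ N]mulr_natr.
Qed.

Lemma fluct_norm_sum g : (forall t, 0 <= g t) -> \sum_t g t <= 1 ->
  \sum_t `|fluct g t| <= 2.
Proof.
move=> g0 g1; apply: (@le_trans _ _ (\sum_t (g t + smooth g t))).
  apply: ler_sum => t _; apply: le_trans (ler_normB _ _) _.
  by rewrite !ger0_norm ?smooth_ge0.
rewrite big_split /= smooth_sum; lra.
Qed.

Lemma energy_le g S : (forall t, 0 <= g t) -> \sum_t g t <= 1 ->
  (forall t, g t <= S) -> 0 <= S -> energy g <= 2 * S.
Proof.
move=> g0 g1 gS S0; apply: (@le_trans _ _ (\sum_t S * `|fluct g t|)).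
  apply: ler_sum => t _; rewrite -(real_normK (num_real _)) expr2; apply: ler_wpM2r => //.
  have s0 : 0 <= smooth g t by exact: smooth_ge0.
  have s1 : smooth g t <= S by apply: avgN_le => i.
  rewrite /fluct ler_norml; move: (g0 t) (gS t); lra.
rewrite -mulr_sumr mulrC; apply: ler_wpM2r => //; exact: fluct_norm_sum.
Qed.

(** Put [d = b / N]. Where [g] exceeds [2 d], its mean is at most [d], so the fluctuation is at
    least [g - d], and [(g - 2 d) d <= (g - d)^2]. *)
Lemma excess_energy g b : 0 < b -> winb e N g b ->
  \sum_t Num.max 0 (g t - 2 * b / N%:R) <= energy g * N%:R / b.
Proof.
move=> b0 gb; rewrite /energy -[leRHS]mulrA mulr_suml; apply: ler_sum => t _.
have c0 : 0 < N%:R / b by rewrite divr_gt0.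
rewrite ge_max; apply/andP; split; first by rewrite mulr_ge0 ?sqr_ge0 // ltW.
have [le|gt] := leP (g t) (2 * b / N%:R).
  by apply: (@le_trans _ _ 0); [lra|rewrite mulr_ge0 ?sqr_ge0 // ltW].
have h : smooth g t <= b / N%:R by exact: smooth_le.
have -> : N%:R / b = (b / N%:R)^-1 by rewrite invf_div.
have d0 : 0 < b / N%:R by rewrite divr_gt0.
rewrite ler_pdivlMr // /fluct.
move: h gt d0; rewrite -mulrA; set d := b / N%:R; set s := smooth g t => h gt d0.
nra.
Qed.

(** The additive [xi] pays for the truncation: across the seam of the cyclic group the
    multiplicative bound may fail. *)
Definition lip (j : nat) (lam xi : R) g := forall t (i : int),
  `|i| <= j%:Z -> g t <= lam * g (t + e *~ i) + xi.

Lemma lip_smooth j lam xi g : lip j lam xi g -> lip j lam xi (smooth g).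
Proof.
move=> gl t i ij; rewrite /smooth -[xi](mulfK (lt0r_neq0 Npos)) mulrA -mulrDl.
rewrite ler_wpM2r ?invr_ge0 ?ler0n // mulr_natr -(card_ord N) -sumr_const.
rewrite card_ord mulr_sumr -big_split /=; apply: ler_sum => k _.
by apply: le_trans (gl _ i ij) _; rewrite addrAC.
Qed.

Lemma winb_smooth g b : winb e N g b -> winb e N (smooth g) b.
Proof.
move=> gb a; rewrite /smooth -mulr_suml exchange_big /=.
apply: avgN_le => i; apply: le_trans (gb (a + e *~ i%:Z)).
by apply: ler_sum => k _; rewrite addrAC.
Qed.

Lemma long_window g b a m : (forall t, 0 <= g t) -> 0 <= b -> winb e N g b ->
  (N <= m)%N -> \sum_(i < m) g (a + e *~ i%:Z) <= 2 * m%:R * b / N%:R.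
Proof.
move=> g0 b0 gb Nm.
have hm : (m <= (m %/ N).+1 * N)%N by rewrite ltnW // ltn_ceil.
apply: le_trans (sum_ord_le (g := fun i => g (a + e *~ i%:Z)) hm _) _ => //.
rewrite (big_ord_mul (fun i => g (a + e *~ i%:Z))).
apply: (@le_trans _ _ (\sum_(j < (m %/ N).+1) b)).
  apply: ler_sum => j _; apply: le_trans (gb (a + e *~ (j * N)%N%:Z)).
  by apply: ler_sum => i _; rewrite PoszD mulrzDr addrA.
rewrite sumr_const card_ord -[b *+ _]mulr_natl mulrAC; apply: ler_wpM2r => //.
rewrite ler_pdivlMr // -!natrM ler_nat.
have := leq_divM m N; lia.
Qed.

Lemma window_shift g b a m k : (forall t, 0 <= g t) -> winb e N g b -> (k <= N)%N ->
  `|\sum_(i < m) g (a + e *~ i%:Z) - \sum_(i < m) g (a + e *~ k%:Z + e *~ i%:Z)| <= b.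
Proof.
move=> g0 gb kN.
pose G i := g (a + e *~ i%:Z).
have E1 : \sum_(i < k) G i + \sum_(i < m) g (a + e *~ k%:Z + e *~ i%:Z) =
   \sum_(i < m) G i + \sum_(i < k) g (a + e *~ m%:Z + e *~ i%:Z).
  transitivity (\sum_(i < k + m) G i).
    rewrite big_split_ord /=; congr (_ + _); apply: eq_bigr => i _.
    by rewrite /G PoszD mulrzDr addrA.
  rewrite addnC big_split_ord /=; congr (_ + _); apply: eq_bigr => i _.
  by rewrite /G PoszD mulrzDr addrA.
have b1 : \sum_(i < k) G i <= b.
  apply: le_trans (gb a).
  exact: (sum_ord_le kN (fun i => g0 _ : 0 <= G i)).
have b2 : \sum_(i < k) g (a + e *~ m%:Z + e *~ i%:Z) <= b.
  apply: le_trans (gb (a + e *~ m%:Z)).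
  exact: (sum_ord_le (g := fun i => g (a + e *~ m%:Z + e *~ i%:Z)) kN).
have p1 : 0 <= \sum_(i < k) G i by apply: sumr_ge0 => i _; apply: g0.
have p2 : 0 <= \sum_(i < k) g (a + e *~ m%:Z + e *~ i%:Z) by apply: sumr_ge0.
rewrite ler_norml -!/(G _); move: E1 b1 b2 p1 p2.
set A := \sum_(i < k) G i; set B := \sum_(i < m) _; set C := \sum_(i < m) _.
set D := \sum_(i < k) _; lra.
Qed.

(** The fluctuation is the mean of the differences between [g] and its translates by less than [N],
    so that its sum over an interval reduces to the two ends. It matters that the bound does not
    depend on [m]. *)
Lemma window_fluct g b a m : (forall t, 0 <= g t) -> winb e N g b ->
  `|\sum_(i < m) fluct g (a + e *~ i%:Z)| <= b.
Proof.
move=> g0 gb.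
have -> : \sum_(i < m) fluct g (a + e *~ i%:Z) =
  (\sum_(k < N) (\sum_(i < m) g (a + e *~ i%:Z) -
     \sum_(i < m) g (a + e *~ k%:Z + e *~ i%:Z))) / N%:R.
  rewrite !sumrB sumr_const card_ord mulrBl -[_ *+ N]mulr_natr mulfK ?lt0r_neq0 //.
  congr (_ - _); rewrite -mulr_suml; congr (_ / _).
  rewrite exchange_big /=; apply: eq_bigr => k _; apply: eq_bigr => i _.
  by rewrite addrAC.
rewrite normrM normfV [ `|N%:R|]ger0_norm ?ler0n //.
apply: le_trans (_ : (\sum_(k < N) b) / N%:R <= _); last first.
  by apply: avgN_le.
rewrite ler_wpM2r ?invr_ge0 ?ler0n //; apply: le_trans (ler_norm_sum _ _ _) _.
by apply: ler_sum => k _; apply: window_shift => //; exact: ltnW.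
Qed.

Lemma lip_diff j lam xi g t (i : int) : lip j lam xi g -> (forall t, 0 <= g t) ->
  1 <= lam <= 2 -> 0 <= xi -> `|i| <= j%:Z ->
  `|g t - g (t + e *~ i)| <= 2 * (lam - 1) * g (t + e *~ i) + 2 * xi.
Proof.
move=> gl g0 /andP[l1 l2] xi0 ij.
have h1 := gl t i ij.
have h2 := gl (t + e *~ i) (- i).
rewrite normrN mulrNz addrK in h2; have {}h2 := h2 ij.
move: h1 h2 (g0 t) (g0 (t + e *~ i)).
set a := g t; set c := g (t + e *~ i) => h1 h2 a0 c0.
rewrite ler_norml; apply/andP; split; last by nra.
have : (lam - 1) * a <= (lam - 1) * (lam * c + xi) by apply: ler_wpM2l; lra.
have : (lam - 1) * c * lam <= (lam - 1) * c * 2.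
  by apply: ler_wpM2l => //; rewrite mulr_ge0 // subr_ge0.
have : (lam - 1) * xi <= 1 * xi by apply: ler_wpM2r => //; lra.
nra.
Qed.

(** Each point of the progression is compared with the [w] consecutive points that start at it. *)
Lemma progression_vs_window j lam xi g b a P w : lip j lam xi g ->
  (forall t, 0 <= g t) -> 0 <= b -> winb e N g b -> 1 <= lam <= 2 -> 0 <= xi ->
  (0 < w <= j)%N -> (N <= P)%N ->
  `|w%:R * \sum_(y < P) g (a + e *~ (w * y)%N%:Z) -
     \sum_(z < P * w) g (a + e *~ z%:Z)| <=
  (P * w)%:R * (4 * (lam - 1) * b / N%:R + 2 * xi).
Proof.
move=> gl g0 b0 gb l12 xi0 /andP[w0 wj] NP.
rewrite (big_ord_mul (fun z => g (a + e *~ z%:Z))) mulr_sumr -sumrB.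
have -> : \sum_(y < P) (w%:R * g (a + e *~ (w * y)%N%:Z) -
      \sum_(i < w) g (a + e *~ (y * w + i)%N%:Z)) =
   \sum_(y < P) \sum_(i < w) (g (a + e *~ (w * y)%N%:Z) -
      g (a + e *~ (w * y)%N%:Z + e *~ i%:Z)).
  apply: eq_bigr => y _; rewrite sumrB sumr_const card_ord mulr_natl.
  congr (_ - _); apply: eq_bigr => i _.
  by rewrite PoszD mulrzDr addrA [(y * w)%N]mulnC.
apply: le_trans (ler_norm_sum _ _ _) _.
apply: (@le_trans _ _ (\sum_(y < P) \sum_(i < w)
    (2 * (lam - 1) * g (a + e *~ (y * w + i)%N%:Z) + 2 * xi))).
  apply: ler_sum => y _; apply: le_trans (ler_norm_sum _ _ _) _.
  apply: ler_sum => i _.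
  rewrite [(y * w + i)%N%:Z]PoszD mulrzDr addrA [(y * w)%N]mulnC.
  apply: (lip_diff _ gl) => //; have := ltn_ord i; lia.
rewrite -(big_ord_mul (fun z => 2 * (lam - 1) * g (a + e *~ z%:Z) + 2 * xi)).
rewrite big_split /= sumr_const card_ord -mulr_sumr [leRHS]mulrDr.
apply: lerD; last by rewrite -(mulr_natl (2 * xi)).
have NPw : (N <= P * w)%N by apply: leq_trans NP _; rewrite leq_pmulr.
have h := long_window a g0 b0 gb NPw.
case/andP: l12 => l1 l2.
apply: le_trans (ler_wpM2l _ h) _; first by rewrite mulr_ge0 // subr_ge0.
rewrite le_eqVlt; apply/orP; left; apply/eqP; ring.
Qed.

(* By the Lipschitz property a progression of small step sees the same as a full
   interval. *)
Lemma progression_fluct j lam xi g b a P w : lip j lam xi g ->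
  (forall t, 0 <= g t) -> 0 <= b -> winb e N g b -> 1 <= lam <= 2 -> 0 <= xi ->
  (0 < w <= j)%N -> (N <= P)%N ->
  `|\sum_(y < P) fluct g (a + e *~ (w * y)%N%:Z)| <=
   P%:R / N%:R * ((8 * (lam - 1) + w%:R^-1) * b + 4 * xi * N%:R).
Proof.
move=> gl g0 b0 gb l12 xi0 wj NP.
have h1 := progression_vs_window a gl g0 b0 gb l12 xi0 wj NP.
have h2 := progression_vs_window a (lip_smooth gl) (fun t => smooth_ge0 t g0) b0
  (winb_smooth gb) l12 xi0 wj NP.
have h3 := window_fluct a (P * w) g0 gb.
case/andP: wj => w0 wj.
have wp : 0 < w%:R :> R by rewrite ltr0n.
have Nn : N%:R != 0 :> R by rewrite lt0r_neq0.
have PN : N%:R <= P%:R :> R by rewrite ler_nat.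
(* After multiplication by [w] the progression becomes an interval of length [P * w], whose
   contribution is still only [b]: this is the source of the gain [w^-1]. *)
rewrite -(ler_pM2l wp) -{1}[w%:R]ger0_norm ?ler0n // -normrM.
rewrite !sumrB in h3 *.
have idn (w' P' N' l b' x : R) : w' != 0 -> N' != 0 ->
    w' * (P' / N' * ((8 * (l - 1) + w'^-1) * b' + 4 * x * N')) =
    P' * w' * (4 * (l - 1) * b' / N' + 2 * x) +
    P' * w' * (4 * (l - 1) * b' / N' + 2 * x) + P' / N' * b'.
  by clear=> w'0 N'0; field; rewrite N'0 w'0.
move: h1 h2 h3; rewrite natrM.
set A1 := \sum_(y < P) g _; set B1 := \sum_(z < P * w) g _.
set A2 := \sum_(y < P) smooth g _; set B2 := \sum_(z < P * w) smooth g _.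
set D := 4 * (lam - 1) * b / N%:R + 2 * xi => h1 h2 h3.
have -> : w%:R * (A1 - A2) = (w%:R * A1 - B1) - (w%:R * A2 - B2) + (B1 - B2) by ring.
apply: le_trans (ler_normD _ _) _.
apply: le_trans (lerD (ler_normB _ _) h3) _.
apply: le_trans (lerD (lerD h1 h2) (lexx _)) _.
have -> : w%:R * (P%:R / N%:R * ((8 * (lam - 1) + w%:R^-1) * b + 4 * xi * N%:R)) =
   P%:R * w%:R * D + P%:R * w%:R * D + (P%:R / N%:R) * b.
  by rewrite /D; exact: idn (lt0r_neq0 wp) Nn.
rewrite lerD2l -[leLHS]mul1r; apply: ler_wpM2r; first exact: b0.
by rewrite ler_pdivlMr // mul1r.
Qed.

End Fluctuation.

(** * Almost periods of the fluctuation *)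

Section AlmostPeriods.
Variables (R : realFieldType) (V : finZmodType) (e : V).

Lemma sqrD_le (a b : R) : (a + b) ^+ 2 <= 2 * a ^+ 2 + 2 * b ^+ 2.
Proof.
rewrite -subr_ge0 (_ : _ - _ = (a - b) ^+ 2) ?sqr_ge0 //; ring.
Qed.

Lemma sqr_sum_le n (G : 'I_n -> R) :
  (\sum_(i < n) G i) ^+ 2 <= n%:R * \sum_(i < n) G i ^+ 2.
Proof.
case: n G => [|n] G; first by rewrite !big_ord0 mulr0 expr0n.
set S := \sum_(i < n.+1) G i; set Q := \sum_(i < n.+1) G i ^+ 2.
have n0 : n.+1%:R != 0 :> R by rewrite pnatr_eq0.
have E : \sum_(i < n.+1) (n.+1%:R * G i - S) ^+ 2 = n.+1%:R * (n.+1%:R * Q - S ^+ 2).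
  transitivity (\sum_(i < n.+1) (n.+1%:R ^+ 2 * G i ^+ 2 - n.+1%:R * 2 * S * G i + S ^+ 2)).
    by apply: eq_bigr => i _; ring.
  rewrite !big_split /= sumr_const card_ord -[_ *+ n.+1]mulr_natl -mulr_sumr sumrN.
  by rewrite -mulr_sumr -/S -/Q; ring.
have : 0 <= n.+1%:R * (n.+1%:R * Q - S ^+ 2).
  by rewrite -E; apply: sumr_ge0 => i _; rewrite sqr_ge0.
by rewrite pmulr_rge0 ?ltr0n // subr_ge0.
Qed.

(** Telescoping and Cauchy-Schwarz. The loss [m ^+ 2] is why [iota] is of order [(j * r) ^- 2]. *)
Lemma multiple_period (psi : V -> R) z m :
  \sum_t (psi t - psi (t + e *~ (m%:Z * z))) ^+ 2 <=
  m%:R ^+ 2 * \sum_t (psi t - psi (t + e *~ z)) ^+ 2.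
Proof.
have tel t : psi t - psi (t + e *~ (m%:Z * z)) =
   \sum_(i < m) (psi (t + e *~ (i%:Z * z)) - psi (t + e *~ (i%:Z * z) + e *~ z)).
  elim: m => [|m IH]; first by rewrite big_ord0 mul0r mulr0z addr0 subrr.
  have Ez : e *~ (m.+1%:Z * z) = e *~ (m%:Z * z) + e *~ z.
    by rewrite -mulrzDr -addn1 PoszD mulrDl mul1r.
  by rewrite big_ord_recr /= -IH Ez !addrA subrK.
apply: (@le_trans _ _ (\sum_t m%:R * \sum_(i < m)
   (psi (t + e *~ (i%:Z * z)) - psi (t + e *~ (i%:Z * z) + e *~ z)) ^+ 2)).
  by apply: ler_sum => t _; rewrite tel; exact: sqr_sum_le.
rewrite -mulr_sumr exchange_big /=.
under eq_bigr => i _ do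
  rewrite (sum_shift (fun u => (psi u - psi (u + e *~ z)) ^+ 2)).
by rewrite sumr_const card_ord -(mulr_natl (\sum_t _)) mulrA expr2.
Qed.

End AlmostPeriods.

Section BadDensity.
Variables (R : realFieldType) (V : finZmodType) (e : V) (N : nat).
Hypothesis N0 : (0 < N)%N.

Variables (phi gt : V -> R) (lam xi b theta0 iota : R) (j r P : nat) (x0 : int).
Hypotheses (gt0 : forall t, 0 <= gt t) (gt1 : \sum_t gt t <= 1)
  (gtb : winb e N gt b) (b0 : 0 < b) (gtl : lip e (j * r) lam xi gt)
  (l12 : 1 <= lam <= 2) (xi0 : 0 <= xi) (j0 : (0 < j)%N) (r0 : (0 < r)%N)
  (NP : (N <= P)%N) (th0 : 0 < theta0)
  (io : 16 * iota * (j * r)%:R ^+ 2 <= 1)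
  (Eth : theta0 * b / N%:R <= energy e N gt).

Let psi := fluct e N gt.
Let E := energy e N gt.
Let defect x := \sum_t (phi t - psi (t + e *~ x)) ^+ 2.
Let eps1 := 8 * (lam - 1) + r%:R^-1 + 4 * xi * N%:R / b.
Let jR : 0 < j%:R :> R. Proof. by rewrite ltr0n. Qed.
Let NR : 0 < N%:R :> R. Proof. by rewrite ltr0n. Qed.

Let eps1_ge0 : 0 <= eps1.
Proof.
case/andP: l12 => l1 _; apply: addr_ge0; first apply: addr_ge0.
- by apply: mulr_ge0 => //; rewrite subr_ge0.
- by rewrite invr_ge0 ler0n.
- by apply: divr_ge0; [apply: mulr_ge0; [exact: mulr_ge0|exact: ler0n]|exact: ltW].
Qed.

Let E_gt0 : 0 < E.
Proof. by apply: lt_le_trans Eth; rewrite divr_gt0 // mulr_gt0. Qed.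

Let period_diff (x y : int) : defect x <= iota * E -> defect y <= iota * E ->
  \sum_t (psi t - psi (t + e *~ (y - x))) ^+ 2 <= 4 * iota * E.
Proof.
move=> dx dy.
rewrite -(sum_shift (fun t => (psi t - psi (t + e *~ (y - x))) ^+ 2) (e *~ x)).
apply: (@le_trans _ _ (\sum_t (2 * (phi t - psi (t + e *~ x)) ^+ 2 +
   2 * (phi t - psi (t + e *~ y)) ^+ 2))).
  apply: ler_sum => t _.
  have -> : t + e *~ x + e *~ (y - x) = t + e *~ y.
    by rewrite -addrA -mulrzDr [x + _]addrC subrK.
  have -> : psi (t + e *~ x) - psi (t + e *~ y) =
    - (phi t - psi (t + e *~ x)) + (phi t - psi (t + e *~ y)) by ring.
  by apply: le_trans (sqrD_le _ _) _; rewrite sqrrN.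
rewrite big_split /= -!mulr_sumr -!/(defect _); lra.
Qed.

(** Only multiples of [r] are used: two of them differ by at least [r], which makes the term [w^-1]
    of [progression_fluct] small, and by at most [j * r], the range of the Lipschitz bound. *)
Let M z t : R := \sum_(l < j) psi (t + e *~ ((l * r)%N%:Z * z)).

(** Each translate is within [E / 4] of [psi] in squared norm, by the choice of [iota]; so is their
    mean, which therefore retains a quarter of the energy. *)
Let M_large z : \sum_t (psi t - psi (t + e *~ z)) ^+ 2 <= 4 * iota * E ->
  E / 4 <= j%:R ^- 2 * \sum_t M z t ^+ 2.
Proof.
move=> hz.
have dist : \sum_t (psi t - M z t / j%:R) ^+ 2 <= E / 4.
  apply: (@le_trans _ _ (j%:R^-1 * \sum_(l < j)
     \sum_t (psi t - psi (t + e *~ ((l * r)%N%:Z * z))) ^+ 2)).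
    rewrite exchange_big mulr_sumr /=; apply: ler_sum => t _.
    have -> : psi t - M z t / j%:R =
        (\sum_(l < j) (psi t - psi (t + e *~ ((l * r)%N%:Z * z)))) / j%:R.
      rewrite sumrB sumr_const card_ord mulrBl -(mulr_natr (psi t)).
      by rewrite mulfK // lt0r_neq0.
    rewrite expr_div_n [leRHS]mulrC.
    apply: le_trans (ler_wpM2r _ (sqr_sum_le _)) _.
      by rewrite invr_ge0 sqr_ge0.
    rewrite le_eqVlt; apply/orP; left; apply/eqP.
    move: (\sum_(i < j) _) => S; move: (lt0r_neq0 jR) => jn.
    by field.
  rewrite mulrC ler_pdivrMr //.
  apply: (@le_trans _ _ (\sum_(l < j) E / 4)); last first.
    by rewrite sumr_const card_ord -(mulr_natr (E / 4)).
  apply: ler_sum => l _; apply: le_trans (multiple_period _ _ _ _) _.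
  apply: (@le_trans _ _ ((j * r)%:R ^+ 2 * (4 * iota * E))).
    apply: ler_pM => //; rewrite ?sqr_ge0 //.
      by apply: sumr_ge0 => t _; rewrite sqr_ge0.
    rewrite lerXn2r ?nnegrE ?ler0n // ler_nat leq_mul2r ltnW ?orbT //.
  have -> : (j * r)%:R ^+ 2 * (4 * iota * E) =
     (16 * iota * (j * r)%:R ^+ 2) * (E / 4) by field.
  by rewrite ler_piMl // divr_ge0 // ltW.
have : E <= \sum_t (2 * (M z t / j%:R) ^+ 2 + 2 * (psi t - M z t / j%:R) ^+ 2).
  apply: ler_sum => t _; rewrite -/psi.
  apply: le_trans (sqrD_le _ _); rewrite addrC subrK.
  exact: lexx.
rewrite big_split /= -!mulr_sumr.
have -> : \sum_t (M z t / j%:R) ^+ 2 = j%:R ^- 2 * \sum_t M z t ^+ 2.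
  by rewrite mulr_sumr; apply: eq_bigr => t _; rewrite expr_div_n mulrC.
move: dist; lra.
Qed.

(** Off the diagonal, translating [t] makes one factor independent of [y], while the other runs
    along a progression whose step is a multiple of [r]; [progression_fluct] is then paired with the
    norm bound 2 on [psi]. *)
Let corr (a : int) (l l' : 'I_j) : \sum_(y < P) \sum_t
    psi (t + e *~ ((l * r)%N%:Z * (y%:Z - a))) * psi (t + e *~ ((l' * r)%N%:Z * (y%:Z - a)))
  <= (l == l')%:R * (P%:R * E) + 2 * (P%:R / N%:R * (eps1 * b)).
Proof.
have C0 : 0 <= P%:R / N%:R * (eps1 * b).
  by apply: mulr_ge0; [rewrite divr_ge0 ?ler0n|apply: mulr_ge0 => //; exact: ltW].
have off (k k' : 'I_j) : (k < k')%N -> \sum_(y < P) \sum_t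
    psi (t + e *~ ((k * r)%N%:Z * (y%:Z - a))) * psi (t + e *~ ((k' * r)%N%:Z * (y%:Z - a)))
    <= 2 * (P%:R / N%:R * (eps1 * b)).
  move=> kk; pose w := ((k' - k) * r)%N.
  have -> : \sum_(y < P) \sum_t psi (t + e *~ ((k * r)%N%:Z * (y%:Z - a))) *
        psi (t + e *~ ((k' * r)%N%:Z * (y%:Z - a))) =
      \sum_t psi t * \sum_(y < P) psi (t - e *~ (w%:Z * a) + e *~ (w * y)%N%:Z).
    under [RHS]eq_bigr => t _ do rewrite mulr_sumr.
    rewrite [RHS]exchange_big /=; apply: eq_bigr => y _.
    rewrite -(sum_shift (fun t => psi t * _) (e *~ ((k * r)%N%:Z * (y%:Z - a)))).
    have Ez : (k' * r)%N%:Z * (y%:Z - a) =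
        (k * r)%N%:Z * (y%:Z - a) - w%:Z * a + (w * y)%N%:Z.
      have -> : (k' * r)%N = (k * r + w)%N by rewrite /w -mulnDl subnKC // ltnW.
      by rewrite !PoszD (PoszM w); ring.
    apply: eq_bigr => t _; congr (_ * psi _).
    by rewrite Ez !mulrzDr mulrNz !addrA.
  apply: (@le_trans _ _ (\sum_t `|psi t| * (P%:R / N%:R * (eps1 * b)))).
    apply: ler_sum => t _; apply: le_trans (ler_norm _) _; rewrite normrM.
    apply: ler_wpM2l => //.
    have wr : (r <= w)%N by rewrite /w leq_pmull // subn_gt0.
    have wj : (0 < w <= j * r)%N.
      by rewrite (leq_trans r0 wr) leq_mul2r (leq_trans (leq_subr _ _) (ltnW (ltn_ord k'))) orbT.
    apply: le_trans (progression_fluct N0 _ gtl gt0 (ltW b0) gtb l12 xi0 wj NP) _.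
    apply: ler_wpM2l; first by rewrite divr_ge0 ?ler0n.
    have -> : eps1 * b = (8 * (lam - 1) + r%:R^-1) * b + 4 * xi * N%:R.
      by rewrite /eps1 mulrDl divfK // lt0r_neq0.
    rewrite lerD2r; apply: ler_wpM2r; first exact: ltW.
    by rewrite lerD2l lef_pV2 ?posrE ?ltr0n // ?ler_nat // (leq_trans r0 wr).
  by rewrite -mulr_suml; apply: ler_wpM2r => //; exact: fluct_norm_sum.
case: (ltngtP l l') => [lt|lt|eq].
- have -> : (l == l') = false by apply/eqP => h; rewrite h ltnn in lt.
  by rewrite mul0r add0r off.
- have -> : (l == l') = false by apply/eqP => h; rewrite h ltnn in lt.
  rewrite mul0r add0r; apply: le_trans (off _ _ lt).
  rewrite le_eqVlt; apply/orP; left; apply/eqP.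
  by apply: eq_bigr => y _; apply: eq_bigr => t _; rewrite mulrC.
- have -> : l = l' by exact: val_inj.
  rewrite eqxx mul1r; apply: (@le_trans _ _ (P%:R * E)); last first.
    by rewrite lerDl mulr_ge0.
  rewrite le_eqVlt; apply/orP; left; apply/eqP.
  transitivity (\sum_(y < P) E); last by rewrite sumr_const card_ord mulr_natl.
  apply: eq_bigr => y _; rewrite /E /energy -/psi.
  rewrite -(sum_shift (fun t => psi t ^+ 2) (e *~ ((l' * r)%N%:Z * (y%:Z - a)))).
  by apply: eq_bigr => t _; rewrite expr2.
Qed.

(* Two shifts of small defect differ by an almost period [z] of [psi], so that
   averaging [psi] over its translates by the first multiples of [z] changes it
   little; but by [progression_fluct] the average over [z] of the squared norm
   of these averages is small. *)
Lemma bad_density :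
  \sum_(y < P) (\sum_t (phi t - psi (t + e *~ (x0 + y%:Z))) ^+ 2 <= iota * E)%R%:R <=
  (4 / j%:R + 8 * eps1 / theta0) * P%:R.
Proof.
under eq_bigr => y _ do rewrite -/(defect _).
pose B := [pred y : 'I_P | defect (x0 + y%:Z) <= iota * E].
have P0 : (0 < P)%N by apply: leq_trans NP.
have e1 := eps1_ge0.
case: (pickP B) => [a Ba|noB]; last first.
  rewrite big1 => [|y _]; last by have := noB y; rewrite /B /= => ->.
  by rewrite mulr_ge0 ?ler0n // addr_ge0 // divr_ge0 ?ler0n ?mulr_ge0 // ltW.
have S : \sum_(y < P) \sum_t M (y%:Z - a%:Z) t ^+ 2 <=
    j%:R * (P%:R * E) + j%:R ^+ 2 * (2 * (P%:R / N%:R * (eps1 * b))).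
  have -> : \sum_(y < P) \sum_t M (y%:Z - a%:Z) t ^+ 2 =
    \sum_(l < j) \sum_(l' < j) \sum_(y < P) \sum_t
      psi (t + e *~ ((l * r)%N%:Z * (y%:Z - a%:Z))) *
      psi (t + e *~ ((l' * r)%N%:Z * (y%:Z - a%:Z))).
    under [RHS]eq_bigr => l _ do rewrite exchange_big /=.
    rewrite [RHS]exchange_big /=; apply: eq_bigr => y _.
    under [RHS]eq_bigr => l _ do rewrite exchange_big /=.
    rewrite [RHS]exchange_big /=; apply: eq_bigr => t _.
    rewrite expr2 {1}/M mulr_suml; apply: eq_bigr => l _.
    by rewrite /M mulr_sumr.
  apply: (@le_trans _ _ (\sum_(l < j) \sum_(l' < j)
      ((l == l')%:R * (P%:R * E) + 2 * (P%:R / N%:R * (eps1 * b))))).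
    by apply: ler_sum => l _; apply: ler_sum => l' _; exact: corr.
  under eq_bigr => l _.
    rewrite big_split /= sumr_const card_ord -mulr_suml.
    rewrite (bigD1 l) //= eqxx big1 ?addr0 ?mul1r; last first.
      by move=> i; rewrite eq_sym => /negbTE ->.
  over.
  rewrite big_split /= !sumr_const !card_ord -(mulr_natl (P%:R * E)).
  set C := 2 * _; rewrite -(mulr_natl (C *+ j)) -(mulr_natl C) expr2 mulrA.
  by rewrite -mulrA [j%:R * (j%:R * C)]mulrA.
have L : (\sum_(y < P) (defect (x0 + y%:Z) <= iota * E)%R%:R) * (E / 4) <=
   j%:R ^- 2 * \sum_(y < P) \sum_t M (y%:Z - a%:Z) t ^+ 2.
  rewrite [leLHS]mulr_suml [leRHS]mulr_sumr; apply: ler_sum => y _.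
  case: (boolP (defect _ <= _)) => [By|_]; last first.
    rewrite mul0r mulr_ge0 ?invr_ge0 ?sqr_ge0 //.
    by apply: sumr_ge0 => t _; rewrite sqr_ge0.
  rewrite mul1r; apply: M_large.
  have := period_diff Ba By.
  by rewrite (_ : x0 + y%:Z - (x0 + a%:Z) = y%:Z - a%:Z) //; ring.
set Bc := \sum_(y < P) _ in L *.
have L2 : Bc * (E / 4) <= P%:R * E / j%:R + 2 * (P%:R / N%:R * (eps1 * b)).
  apply: le_trans L _; apply: le_trans (ler_wpM2l _ S) _.
    by rewrite invr_ge0 sqr_ge0.
  rewrite le_eqVlt; apply/orP; left; apply/eqP.
  move: (lt0r_neq0 jR); move: (j%:R : R) (P%:R / N%:R * (eps1 * b)) => u v un.
  by field.
have L3 : P%:R / N%:R * (eps1 * b) <= P%:R * (eps1 / theta0) * E.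
  have -> : P%:R / N%:R * (eps1 * b) = P%:R * (eps1 / theta0) * (theta0 * b / N%:R).
    move: (lt0r_neq0 th0) (lt0r_neq0 NR); move: (P%:R : R) (N%:R : R) => u v tn vn.
    by field; rewrite tn vn.
  by apply: ler_wpM2l => //; rewrite mulr_ge0 ?ler0n // divr_ge0 // ltW.
rewrite -(ler_pM2r (_ : 0 < E / 4)); last by rewrite divr_gt0.
apply: le_trans L2 _.
have -> : (4 / j%:R + 8 * eps1 / theta0) * P%:R * (E / 4) =
   P%:R * E / j%:R + 2 * (P%:R * (eps1 / theta0) * E).
  move: (lt0r_neq0 th0) (lt0r_neq0 jR); move: (P%:R : R) (j%:R : R) => u v tn vn.
  by field; rewrite tn vn.
by rewrite lerD2l ler_wpM2l.
Qed.

End BadDensity.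

(** Up to a permutation, as the enumeration of a finite set need not be increasing. *)
Definition interval_seq (A : seq int) (x0 : int) (P : nat) :=
  perm_eq A [seq x0 + y%:Z | y <- iota 0 P].

Lemma sum_interval_seq (R : realFieldType) A x0 P (F : int -> R) :
  interval_seq A x0 P -> \sum_(x <- A) F x = \sum_(y < P) F (x0 + y%:Z).
Proof.
move=> AP; rewrite (perm_big _ AP) big_map.
by rewrite -(big_mkord xpredT (fun y => F (x0 + y%:Z))) /index_iota subn0.
Qed.

Lemma size_interval_seq A x0 P : interval_seq A x0 P -> size A = P.
Proof. by move=> /perm_size ->; rewrite size_map size_iota. Qed.

(** * Decay of the energy under interval coordinates *)

Section EnergyDecay.
Variables (R : realFieldType) (V : finZmodType) (e : V) (N : nat).
Hypothesis N0 : (0 < N)%N.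

Variables (b lam xi theta0 iota alpha kappa Emax : R) (j r k : nat).

Let theta := theta0 * b / N%:R.
Let eps1 := 8 * (lam - 1) + r%:R^-1 + 4 * xi * N%:R / b.

Definition tame (g : V -> R) : Prop :=
  [/\ forall t, 0 <= g t, \sum_t g t <= 1, winb e N g b,
      lip e (j * r) lam xi g & energy e N g <= Emax].

Hypotheses (b0 : 0 < b) (l12 : 1 <= lam <= 2) (xi0 : 0 <= xi)
  (j0 : (0 < j)%N) (r0 : (0 < r)%N) (th0 : 0 < theta0) (io0 : 0 <= iota)
  (io : 16 * iota * (j * r)%:R ^+ 2 <= 1)
  (al : 4 / j%:R + 8 * eps1 / theta0 <= alpha) (E0 : 0 <= Emax)
  (ka : 0 <= kappa <= 1).

Definition energy_exc (g : V -> R) : R := Num.max 0 (energy e N g - theta).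

Let theta_gt0 : 0 < theta.
Proof. by rewrite divr_gt0 ?ltr0n // mulr_gt0. Qed.

Let exc0 g : 0 <= energy_exc g. Proof. by rewrite le_max lexx. Qed.

Lemma energy_exc_le g : energy e N g <= Emax -> energy_exc g <= Emax.
Proof. by move=> h; rewrite ge_max E0 /=; have := theta_gt0; lra. Qed.

Let maxX (x y : R) : 0 <= x -> 0 <= y -> Num.max x y ^+ k <= x ^+ k + y ^+ k.
Proof.
move=> x0 y0; have [_|_] := leP x y; first by rewrite lerDr exprn_ge0.
by rewrite lerDl exprn_ge0.
Qed.

(** If the energy of [h] is below [theta], convexity alone gains the factor [1 - q]. Otherwise the
    shifts outside a set of density [alpha] have defect more than [iota * theta], and the drop
    [q * (1 - q) * iota * theta] is a fraction [kappa] of any possible excess, as this never exceeds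
    [Emax]. On the exceptional shifts convexity still prevents an increase beyond the larger of the
    two excesses. *)
Lemma energy_step A x0 P q g h : interval_seq A x0 P -> (N <= P)%N ->
  0 <= q <= 1 -> kappa <= q -> kappa * Emax <= q * (1 - q) * iota * theta ->
  tame g -> tame h ->
  avg A (fun x => energy_exc (mix e q g h x) ^+ k) <=
  ((1 - kappa) ^+ k + alpha) * (energy_exc g ^+ k + energy_exc h ^+ k).
Proof.
move=> AP NP /andP[q0 q1] kq kE [_ _ _ _ gE] [h0 h1 hb hl hE].
case/andP: ka => ka0 ka1.
pose D x := \sum_t (fluct e N g t - fluct e N h (t + e *~ x)) ^+ 2.
have D0 x : 0 <= D x by apply: sumr_ge0 => t _; rewrite sqr_ge0.
pose m := Num.max (energy_exc g) (energy_exc h).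
have m0 : 0 <= m by rewrite le_max exc0.
have mg : energy e N g - theta <= m.
  by rewrite le_max /energy_exc le_max lexx orbT.
have mh : energy e N h - theta <= m.
  by rewrite le_max [X in _ || X]le_max lexx !orbT.
have mE : m <= Emax by rewrite ge_max !energy_exc_le.
pose S := energy_exc g ^+ k + energy_exc h ^+ k.
have S0 : 0 <= S by rewrite addr_ge0 ?exprn_ge0.
have mS : m ^+ k <= S by exact: maxX.
have qq : 0 <= q * (1 - q) by rewrite mulr_ge0 ?subr_ge0.
have newE x : energy e N (mix e q g h x) - theta =
  (1 - q) * (energy e N g - theta) + q * (energy e N h - theta) - q * (1 - q) * D x.
  by rewrite energy_mix -/(D x); ring.
have conv (u v : R) : u <= m -> v <= m -> (1 - q) * u + q * v <= m.
  by move=> um vm; nra.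
have contr x : energy_exc (mix e q g h x) <= (1 - kappa) * m ->
    energy_exc (mix e q g h x) ^+ k <= (1 - kappa) ^+ k * S.
  move=> hx; apply: (@le_trans _ _ (((1 - kappa) * m) ^+ k)).
    by rewrite lerXn2r // nnegrE ?exc0 // mulr_ge0 // subr_ge0.
  by rewrite exprMn; apply: ler_wpM2l => //; rewrite exprn_ge0 // subr_ge0.
have eps0 : 0 <= eps1.
  case/andP: l12 => l1 _; apply: addr_ge0; first apply: addr_ge0.
  - by apply: mulr_ge0 => //; rewrite subr_ge0.
  - by rewrite invr_ge0 ler0n.
  - by apply: divr_ge0; [apply: mulr_ge0; [exact: mulr_ge0|exact: ler0n]|exact: ltW].
have al0 : 0 <= alpha.
  by apply: le_trans al; rewrite addr_ge0 // divr_ge0 ?ler0n ?mulr_ge0 // ltW.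
have k0 : 0 <= (1 - kappa) ^+ k by rewrite exprn_ge0 // subr_ge0.
have [small|large] := ltP (energy e N h) theta.
  apply: (@le_trans _ _ ((1 - kappa) ^+ k * S)); last first.
    by apply: ler_wpM2r => //; rewrite lerDl.
  apply: le_trans (avg_le (G := fun=> (1 - kappa) ^+ k * S) _) _; last first.
    by apply: avg_cst_le; rewrite mulr_ge0.
  move=> x _; apply: contr; rewrite ge_max mulr_ge0 ?subr_ge0 //= newE.
  have : q * (1 - q) * D x >= 0 by rewrite mulr_ge0.
  have : (1 - q) * (energy e N g - theta) <= (1 - q) * m by rewrite ler_wpM2l ?subr_ge0.
  have : q * (energy e N h - theta) <= 0 by nra.
  nra.
pose bad x : R := (D x <= iota * energy e N h)%R%:R.
apply: (@le_trans _ _ (avg A (fun x => (1 - kappa) ^+ k * S + S * bad x))).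
  apply: avg_le => x _; rewrite /bad; case: (boolP (D x <= _)) => [_|nb] /=.
    apply: (@le_trans _ _ S); last by rewrite mulr1 lerDr mulr_ge0.
    apply: le_trans mS; rewrite lerXn2r ?nnegrE ?exc0 //.
    rewrite ge_max m0 /= newE.
    have : q * (1 - q) * D x >= 0 by rewrite mulr_ge0.
    by have := conv _ _ mg mh; lra.
  rewrite mulr0 addr0; apply: contr.
  rewrite ge_max mulr_ge0 ?subr_ge0 //= newE.
  rewrite -ltNge in nb.
  have d1 : q * (1 - q) * (iota * theta) <= q * (1 - q) * D x.
    apply: ler_wpM2l => //; apply: le_trans (ltW nb); exact: ler_wpM2l.
  have d2 : kappa * m <= kappa * Emax by apply: ler_wpM2l.
  have := conv _ _ mg mh; move: d1; rewrite mulrA; lra.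
rewrite avgD (avgZ A S bad) [leRHS]mulrDl; apply: lerD.
  by apply: avg_cst_le; rewrite mulr_ge0.
rewrite mulrC; apply: ler_wpM2r => //.
rewrite /avg (sum_interval_seq _ AP) (size_interval_seq AP).
have P0 : (0 < P)%N by apply: leq_trans NP.
rewrite ler_pdivrMr ?ltr0n //.
apply: le_trans (bad_density N0 _ x0 h0 h1 hb b0 hl l12 xi0 j0 r0 NP th0 io large) _.
by apply: ler_wpM2r; first exact: ler0n.
Qed.

Definition normalized (l : nat) (F : nat -> V -> R) s t : R := F s t / 'C(l, s)%:R.

Lemma normalized_push l F x s t : (s < l)%N ->
  normalized l.+1 (push e x F) s.+1 t =
  mix e (s.+1%:R / l.+1%:R) (normalized l F s.+1) (normalized l F s) x t.
Proof.
move=> sl; rewrite /normalized /push /mix.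
have c1 : 'C(l, s.+1)%:R != 0 :> R by rewrite pnatr_eq0 -lt0n bin_gt0.
have c2 : 'C(l, s)%:R != 0 :> R by rewrite pnatr_eq0 -lt0n bin_gt0 ltnW.
have c3 : 'C(l.+1, s.+1)%:R != 0 :> R by rewrite pnatr_eq0 -lt0n bin_gt0 ltnW.
have l1 : l.+1%:R != 0 :> R by rewrite pnatr_eq0.
have E : l.+1%:R * 'C(l, s)%:R = s.+1%:R * 'C(l.+1, s.+1)%:R :> R.
  by rewrite -!natrM mul_bin_diag.
have E2 : 'C(l.+1, s.+1)%:R = 'C(l, s.+1)%:R + 'C(l, s)%:R :> R by rewrite -natrD binS.
have Q : s.+1%:R / l.+1%:R = 'C(l, s)%:R / 'C(l.+1, s.+1)%:R :> R.
  by apply/eqP; rewrite eqr_div // -E mulrC.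
rewrite Q E2; rewrite E2 in c3.
move: c1 c2 c3; move: ('C(l, s.+1)%:R : R) ('C(l, s)%:R : R) => u v u0 v0 uv.
by field; rewrite u0 v0 uv.
Qed.

(** A high moment turns the contraction [1 - kappa], possibly close to 1, into a factor as small as
    [alpha]. The 2 accounts for the two slices that feed each slice. *)
Lemma energy_bound (As : seq (seq int)) (dom : nat -> nat -> Prop) l F :
  {in As, forall A, exists x0 P, interval_seq A x0 P /\ (N <= P)%N} ->
  (forall s, dom l s -> tame (normalized l F s)) ->
  (forall pre A As' s, As = pre ++ A :: As' -> dom (size As' + l).+1 s ->
    exists2 s', [/\ s = s'.+1, (s' < size As' + l)%N,
       dom (size As' + l)%N s & dom (size As' + l)%N s'] &
       [/\ kappa <= s%:R / (size As' + l).+1%:R,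
         kappa * Emax <= s%:R / (size As' + l).+1%:R *
            (1 - s%:R / (size As' + l).+1%:R) * iota * theta &
         forall ys, insupp As' ys ->
         tame (normalized (size ys + l) (pushes e ys F) s') /\
         tame (normalized (size ys + l) (pushes e ys F) s)]) ->
  forall s, dom (size As + l)%N s ->
    expect As (fun ys => energy_exc (normalized (size ys + l) (pushes e ys F) s) ^+ k)
      <= (2 * ((1 - kappa) ^+ k + alpha)) ^+ size As * Emax ^+ k.
Proof.
elim: As => [|A As IH] iAs base step s ds.
  rewrite /= expr0 mul1r lerXn2r ?nnegrE ?exc0 //.
  by apply: energy_exc_le; case: (base s ds).
have [s' [-> sl d1 d0] [kq kE ht]] := step [::] A As s erefl ds.
have {}IH s0 : dom (size As + l)%N s0 ->
    expect As (fun ys => energy_exc (normalized (size ys + l) (pushes e ys F) s0) ^+ k)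
      <= (2 * ((1 - kappa) ^+ k + alpha)) ^+ size As * Emax ^+ k.
  apply: IH => //.
    by move=> B hB; apply: iAs; rewrite in_cons hB orbT.
  move=> pre B As' s1 E; apply: (step (A :: pre)); by rewrite E.
have [x0 [P [AP NP]]] : exists x0 P, interval_seq A x0 P /\ (N <= P)%N.
  by apply: iAs; rewrite mem_head.
have q01 : 0 <= (s'.+1%:R : R) / (size As + l).+1%:R <= 1.
  by rewrite divr_ge0 ?ler0n //= ler_pdivrMr ?ltr0n // mul1r ler_nat ltnW.
rewrite expect_cons.
apply: (@le_trans _ _ (expect As (fun ys => ((1 - kappa) ^+ k + alpha) *
   (energy_exc (normalized (size ys + l) (pushes e ys F) s'.+1) ^+ k +
    energy_exc (normalized (size ys + l) (pushes e ys F) s') ^+ k)))).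
  apply: expect_le => ys yA; have [h0 h1] := ht ys yA.
  apply: le_trans (energy_step AP NP q01 kq kE h1 h0).
  rewrite le_eqVlt; apply/orP; left; apply/eqP; rewrite /avg; congr (_ / _).
  apply: eq_bigr => x _; congr (_ ^+ k); rewrite /energy_exc; congr (Num.max _ (_ - _)).
  apply: eq_energy => t; rewrite /= (insupp_size yA) addSn.
  exact: normalized_push.
rewrite expectZ expectD /= exprS.
move: (IH _ d1) (IH _ d0).
set c := (1 - kappa) ^+ k + alpha.
set x := expect _ _; set y := expect _ _; set z := (2 * c) ^+ size As.
move=> hx hy.
have c0 : 0 <= c.
  case/andP: ka => ka0 ka1; apply: addr_ge0; first by rewrite exprn_ge0 // subr_ge0.
  apply: le_trans al; case/andP: l12 => l1 _.
  have eps0 : 0 <= eps1.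
    apply: addr_ge0; first apply: addr_ge0.
    - by apply: mulr_ge0 => //; rewrite subr_ge0.
    - by rewrite invr_ge0 ler0n.
    - by apply: divr_ge0; [apply: mulr_ge0; [exact: mulr_ge0|exact: ler0n]|exact: ltW].
  by rewrite addr_ge0 // divr_ge0 ?ler0n ?mulr_ge0 // ltW.
apply: (@le_trans _ _ (c * (z * Emax ^+ k + z * Emax ^+ k))).
  by apply: ler_wpM2l => //; exact: lerD.
rewrite le_eqVlt; apply/orP; left; apply/eqP; ring.
Qed.

End EnergyDecay.

(** * The three phases *)

Section Phases.
Variables (R : realFieldType) (V : finZmodType) (e : V) (N D Rr h : nat).
Variables (rho X : int) (c1 c2 q nR : R) (f : V -> R).
Hypotheses (N0 : (0 < N)%N) (e_inj : forall z : int, `|z| <= rho -> e *~ z = 0 -> z = 0)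
  (X0 : 0 <= X) (hrho : (X *+ h.*2 + D%:Z) *+ 2 <= rho) (ND : (N <= Rr * D)%N)
  (Rr0 : (0 < Rr)%N)
  (c10 : 0 < c1) (c20 : 0 < c2) (q0 : 0 < q) (qn : q ^+ 2 = nR)
  (h2 : c2 * nR <= (h.*2.+1)%:R)
  (f0 : forall t, 0 <= f t) (f1 : \sum_t f t <= 1).

(** The constant of [littlewood_offord]; divided by [q], the square root of [nR], it bounds the
    window masses of normalized slices. *)
Definition LOconst : R := Rr%:R * ((1 + 16 / (c1 * c2)) / 2).
Definition beta : R := LOconst / q.

Lemma beta_gt0 : 0 < beta.
Proof.
apply: divr_gt0 => //; apply: mulr_gt0; first by rewrite ltr0n.
apply: divr_gt0 => //; apply: addr_gt0 => //; apply: divr_gt0 => //.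
exact: mulr_gt0.
Qed.

Let nR0 : 0 < nR. Proof. by rewrite -qn exprn_gt0. Qed.

Definition block (zs : seq int) :=
  [/\ gapped D zs, size zs = h.*2 & all (fun x : int => `|x| <= X) zs].

Let G (xs : seq int) := pushes e xs (seed f).

Let G0 xs s t : 0 <= G xs s t.
Proof. by apply: pushes_ge0; exact: seed_ge0. Qed.

Let Gsum xs s : \sum_t G xs s t <= 'C(size xs, s)%:R.
Proof. exact: pushes_seed_sum_le. Qed.

Lemma window_block (zs : seq int) (b : nat -> V -> R) be l s : block zs ->
  (forall s t, 0 <= b s t) -> 0 <= be ->
  (forall s', (s' <= s <= s' + h.*2)%N -> \sum_t b s' t <= be * 'C(l, s')%:R) ->
  (s <= l + h.*2)%N -> (l + h.*2).+1%:R <= 2 * nR ->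
  c1 * nR <= (s.+1)%:R -> c1 * nR <= ((l + h.*2 - s).+1)%:R ->
  winb e N (pushes e zs b s) (be * beta * 'C(l + h.*2, s)%:R).
Proof.
move=> [gz sz zX] b0 be0 bb sl ln s1 s2.
have := littlewood_offord e_inj b0 be0 gz sz zX X0 hrho ND bb c10 c20 q0 qn sl ln s1 s2 h2.
by rewrite /beta /LOconst -mulrA.
Qed.

(** Pushes commute, so the block may be treated as pushed last, whatever surrounds it. *)
Lemma window_G (ys zs ex : seq int) s : block zs ->
  let l := size (ys ++ zs ++ ex) in
  (s <= l)%N -> l.+1%:R <= 2 * nR ->
  c1 * nR <= (s.+1)%:R -> c1 * nR <= ((l - s).+1)%:R ->
  winb e N (G (ys ++ zs ++ ex) s) (beta * 'C(l, s)%:R).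
Proof.
move=> bz /=.
have [gz sz zX] := bz.
have -> : size (ys ++ zs ++ ex) = (size (ys ++ ex) + h.*2)%N.
  by rewrite !size_cat sz addnA addnAC.
move=> sl ln s1 s2.
apply: (@eq_winb _ _ _ _ (pushes e zs (G (ys ++ ex)) s)).
  move=> t; rewrite /G !pushes_cat pushesC.
  by apply: eq_pushes => s' t'; rewrite -!pushes_cat.
rewrite -[beta]mul1r; apply: window_block => // s' _.
by rewrite mul1r.
Qed.

Lemma sum_expr_le (g : V -> R) k : (forall t, 0 <= g t) -> (0 < k)%N ->
  \sum_t g t ^+ k <= (\sum_t g t) ^+ k.
Proof.
move=> g0; case: k => // k _; rewrite [leRHS]exprS mulr_suml.
apply: ler_sum => t _; rewrite exprS; apply: ler_wpM2l => //.
rewrite lerXn2r ?nnegrE ?sumr_ge0 // (bigD1 t) //= lerDl.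
by rewrite sumr_ge0.
Qed.

Lemma potential_le_bin tau k xs s : 0 <= tau -> (0 < k)%N ->
  potential tau k (size xs) (G xs) s <= 'C(size xs, s)%:R ^+ k.
Proof.
move=> t0 k0; apply: (@le_trans _ _ (\sum_t G xs s t ^+ k)).
  apply: ler_sum => t _; rewrite lerXn2r ?nnegrE ?exc_ge0 ?G0 //.
  by rewrite ge_max G0 /= lerBlDr lerDl mulr_ge0 ?ler0n.
apply: le_trans (sum_expr_le (G0 xs s) k0) _.
by rewrite lerXn2r ?nnegrE ?ler0n ?Gsum // sumr_ge0.
Qed.

Lemma pr_exc_exists As (F : seq int -> nat -> V -> R) l tau k s bnd :
  (0 < k)%N -> 0 < tau * 'C(size As + l, s)%:R ->
  expect As (fun ys => potential tau k (size ys + l) (F ys) s) <= bnd ->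
  pr R As (fun ys => [exists t, 2 * tau * 'C(size As + l, s)%:R <= F ys s t])
    <= bnd / (tau * 'C(size As + l, s)%:R) ^+ k.
Proof.
move=> k0 c0 hb.
apply: le_trans (@markov R As (fun ys => potential tau k (size ys + l) (F ys) s) _
   ((tau * 'C(size As + l, s)%:R) ^+ k) _ _ _) _.
- by rewrite exprn_gt0.
- by move=> y _; exact: potential_ge0.
- move=> y yA /existsP[t ht]; rewrite /potential (bigD1 t) //=.
  apply: (@le_trans _ _ (exc tau (size y + l) (F y) s t ^+ k)); last first.
    by rewrite lerDl sumr_ge0 // => u _; rewrite exprn_ge0 ?exc_ge0.
  rewrite lerXn2r ?nnegrE ?exc_ge0 //; first exact: ltW.
  rewrite /exc (insupp_size yA) le_max; apply/orP; right.
  by move: ht; rewrite -mulrA; lra.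
by rewrite ler_wpM2r ?invr_ge0 ?exprn_ge0 // ltW.
Qed.

(** The total mass of a slice is at most its binomial coefficient. In edge slices, and in all slices
    at the start, this trivial bound suffices: [Q] is a common bound for its [k]-th power. Elsewhere
    the block [zs] supplies the window bound behind [rare]. *)
Lemma sup_phase As zs ex tau k Q : block zs -> {in As, forall A, spread R e N A} ->
  (size As + size (zs ++ ex)).+1%:R <= 2 * nR ->
  (0 < k)%N -> 0 < tau -> 2 ^+ k * (4 * beta / N%:R / tau) <= 2^-1 ->
  (forall s, 'C(size (zs ++ ex), s)%:R ^+ k <= Q) ->
  (forall l s, (l <= size As + size (zs ++ ex))%N ->
     (s%:R < c1 * nR \/ (l%:R - s%:R < c1 * nR)) -> 'C(l, s)%:R ^+ k <= Q) ->
  forall s, let l := (size As + size (zs ++ ex))%N in (s <= l)%N ->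
  pr R As (fun ys => [exists t, 2 * tau * 'C(l, s)%:R <= G (ys ++ zs ++ ex) s t])
    <= 3 ^+ size As * Q / (tau * 'C(l, s)%:R) ^+ k.
Proof.
move=> bz sAs ln k0 t0 kpi base atyp s /= sl.
set z0 := zs ++ ex in base atyp ln sl *; pose l0 := size z0.
have C0 : 0 < tau * 'C(size As + size z0, s)%:R.
  by rewrite mulr_gt0 // ltr0n bin_gt0.
have Q0 : 0 <= Q by apply: le_trans (base 0%N); rewrite exprn_ge0 ?ler0n.
apply: le_trans (pr_exc_exists (F := fun ys => G (ys ++ z0)) k0 C0 _) (lexx _).
have GE ys : G (ys ++ z0) = pushes e ys (G z0) by rewrite /G pushes_cat.
under eq_expect => ys _ do rewrite GE.
apply: (@potential_bound R V e N As (fun _ _ => True) tau (4 * beta / N%:R / tau)) => //.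
  by move=> s' _; apply: le_trans (potential_le_bin _ _ _ _) (base s') => //; exact: ltW.
move=> pre A As' s1 EAs _.
have sAs' : ((size As').+1 <= size As)%N by rewrite EAs size_cat /= leq_addl.
have det : 'C((size As' + l0).+1, s1)%:R ^+ k <= Q ->
    forall ys, insupp (A :: As') ys ->
      potential tau k (size ys + l0) (pushes e ys (G z0)) s1 <= Q.
  move=> hC ys yA; rewrite -GE -size_cat; apply: le_trans (potential_le_bin _ _ (ltW t0) k0) _.
  by rewrite size_cat (insupp_size yA) /= addSn.
have [lt1|ge1] := ltP (s1%:R) (c1 * nR).
  by left; apply: det; apply: atyp; [rewrite -addSn leq_add2r|left].
have [lt2|ge2] := ltP ((size As' + l0).+1%:R - s1%:R) (c1 * nR).
  by left; apply: det; apply: atyp; [rewrite -addSn leq_add2r|right].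
have cn : 0 < c1 * nR by exact: mulr_gt0.
right; case: s1 ge1 ge2 {det} => [|s1] ge1 ge2; first by move: (lt_le_trans cn ge1); rewrite ltxx.
exists s1; split => // ys yA.
have sz := insupp_size yA.
have sle : (s1.+1 <= size As' + l0)%N.
  have : 0 < (size As' + l0).+1%:R - s1.+1%:R :> R by apply: lt_le_trans ge2.
  by rewrite subr_gt0 ltr_nat ltnS.
have W s2 : (s2 <= size As' + l0)%N -> c1 * nR <= s2.+1%:R ->
    c1 * nR <= (size As' + l0 - s2).+1%:R ->
    rare e N tau (4 * beta / N%:R / tau) (size ys + l0) (pushes e ys (G z0)) s2.
  move=> h1 h3 h4; exists (G (ys ++ z0) s2), (beta * 'C(size ys + l0, s2)%:R),
     (tau * 'C(size ys + l0, s2)%:R).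
  have szl : size (ys ++ z0) = (size As' + l0)%N by rewrite size_cat sz.
  split.
  - by rewrite mulr_gt0 // ltr0n bin_gt0 sz.
  - by move=> t; exact: G0.
  - rewrite -size_cat; apply: window_G => //; rewrite -/z0 szl //.
    by apply: le_trans ln; rewrite ler_nat ltnS leq_add2r ltnW.
  - move=> t; rewrite -GE /exc lt_max ltxx /= subr_gt0; exact: ltW.
  - rewrite le_eqVlt; apply/orP; left; apply/eqP.
    have Nn : N%:R != 0 :> R by rewrite pnatr_eq0 -lt0n.
    move: (lt0r_neq0 t0) Nn; move: (N%:R : R) ('C(_, _)%:R : R) => u v tn un.
    by field; rewrite un tn.
have e2 : (size As' + l0).+1%:R - s1.+1%:R = (size As' + l0 - s1)%:R :> R.
  by rewrite -natrB // ltnW.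
rewrite e2 in ge2.
split; apply: W.
- exact: ltnW.
- exact: ge1.
- by apply: le_trans ge2 _; rewrite ler_nat.
- exact: sle.
- by apply: le_trans ge1 _; rewrite ler_nat.
- by apply: le_trans ge2 _; rewrite ler_nat -subSn // subSS.
Qed.

Variables (n m : nat) (S : R) (qq : R) (l1 : nat).

(* Along the decomposition of the slice [(m, n)] one only meets the slices
   [(s, l)] with [reach l s]. *)
Definition reach (l s : nat) := [/\ (l1 <= l)%N, (l <= n)%N, (s <= m)%N & (m <= s + (n - l))%N].

Hypotheses (nn : n.+1%:R <= 2 * nR) (S0 : 0 <= S) (qq0 : 0 < qq)
  (bulk : forall l s, reach l s -> [/\ (0 < s < l)%N, c1 * nR <= s%:R,
     c1 * nR <= (l - s)%:R, qq <= s%:R / l%:R & s%:R / l%:R <= 1 - qq]).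

Lemma reach_pred l s : (l1 <= l)%N -> reach l.+1 s.+1 -> reach l s.+1 /\ reach l s.
Proof. by rewrite /reach => hl [h1 h3 h4 h5]; split; split => //; move: h1 h3 h4 h5 hl; clear; lia. Qed.

Lemma reach_prefix k l s s' : (l1 <= l)%N -> reach (k + l) s ->
  (s' <= s <= s' + k)%N -> reach l s'.
Proof. by rewrite /reach => hl [h1 h3 h4 h5] h6; split => //; move: h1 h3 h4 h5 h6 hl; clear; lia. Qed.

Let bin_reach l s : reach l s -> 0 < 'C(l, s)%:R :> R.
Proof. by case/bulk => /andP[_ sl] _ _ _ _; rewrite ltr0n bin_gt0 ltnW. Qed.

Let sup_pushes z xs : size z = l1 ->
  (forall s, reach l1 s -> forall t, G z s t <= S * 'C(l1, s)%:R) ->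
  forall s, reach (size xs + l1) s ->
  forall t, G (xs ++ z) s t <= S * 'C(size xs + l1, s)%:R.
Proof.
move=> sz hS s rs t; rewrite /G pushes_cat; apply: pushes_le_cst => s' t' hs'.
by apply: hS; exact: reach_prefix rs hs'.
Qed.

Let window_reach ys zs ex s : block zs -> reach (size (ys ++ zs ++ ex)) s ->
  winb e N (G (ys ++ zs ++ ex) s) (beta * 'C(size (ys ++ zs ++ ex), s)%:R).
Proof.
move=> bz rs; have [/andP[_ sl] b1 b2 _ _] := bulk rs; have [_ ln _ _] := rs.
apply: window_G => //; first exact: ltnW.
- by apply: le_trans nn; rewrite ler_nat.
- by apply: le_trans b1 _; rewrite ler_nat.
- by apply: le_trans b2 _; rewrite ler_nat.
Qed.

Let scale_winb (g : V -> R) b (c : R) : 0 < c -> winb e N g (b * c) ->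
  winb e N (fun t => g t / c) b.
Proof. by move=> c0 gb a; rewrite -mulr_suml ler_pdivrMr. Qed.

Lemma lip_pushes j lam xi xs s : lip e j lam xi f -> 0 <= xi ->
  lip e j lam (xi * 'C(size xs, s)%:R) (G xs s).
Proof.
move=> fl xi0; rewrite /G -[size xs]addn0.
apply: (@pushes_pascal R V e (fun g a => lip e j lam a g)).
- move=> g h' a b x ga hb t i ij; rewrite mulrDr.
  have := ga t i ij; have := hb (t + e *~ x) i ij.
  by rewrite [t + e *~ x + _]addrAC; lra.
- by move=> g h' a gh ga t i ij; rewrite -!gh; exact: ga.
- move=> [|s'] _ t i ij; rewrite /seed /=; first by rewrite mulr1; exact: fl.
  by rewrite !mulr0 addr0.
Qed.

Section Phase2.
Variables (lam xi theta0 iota alpha kappa : R) (j r k : nat).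
Hypotheses (l12 : 1 <= lam <= 2) (xi0 : 0 <= xi)
  (j0 : (0 < j)%N) (r0 : (0 < r)%N) (th0 : 0 < theta0) (io0 : 0 <= iota)
  (io : 16 * iota * (j * r)%:R ^+ 2 <= 1)
  (al : 4 / j%:R + 8 * (8 * (lam - 1) + r%:R^-1 + 4 * xi * N%:R / beta) / theta0 <= alpha)
  (ka : 0 <= kappa <= 1) (kq : kappa <= qq)
  (kE : kappa * (2 * S) <= qq ^+ 2 * iota * (theta0 * beta / N%:R))
  (flip : lip e (j * r) lam xi f).

Let theta := theta0 * beta / N%:R.

Lemma energy_phase As ys zs ex : block zs -> size (ys ++ zs ++ ex) = l1 ->
  {in As, forall A, exists x0 P, interval_seq A x0 P /\ (N <= P)%N} ->
  (forall s, reach l1 s -> forall t, G (ys ++ zs ++ ex) s t <= S * 'C(l1, s)%:R) ->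
  forall s, reach (size As + l1) s ->
  pr R As (fun us => 2 * theta <=
      energy e N (normalized (size As + l1) (G (us ++ ys ++ zs ++ ex)) s)) <=
   (2 * ((1 - kappa) ^+ k + alpha)) ^+ size As * (2 * S) ^+ k / theta ^+ k.
Proof.
move=> bz sz iAs hS s rs.
have th : 0 < theta by rewrite divr_gt0 ?ltr0n // mulr_gt0 // beta_gt0.
set z := ys ++ zs ++ ex in sz hS *.
have Gz us : G (us ++ z) = pushes e us (G z) by rewrite /G pushes_cat.
have tm us s' : reach (size us + l1) s' ->
    tame e N beta lam xi (2 * S) j r (normalized (size us + l1) (pushes e us (G z)) s').
  move=> rs'; have C0 := bin_reach rs'; rewrite -Gz.
  have szz : size (us ++ z) = (size us + l1)%N by rewrite size_cat sz.
  have n0 t : 0 <= normalized (size us + l1) (G (us ++ z)) s' t.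
    by rewrite divr_ge0 ?ler0n.
  have n1 : \sum_t normalized (size us + l1) (G (us ++ z)) s' t <= 1.
    by rewrite /normalized -mulr_suml ler_pdivrMr // mul1r -szz.
  have nS t : normalized (size us + l1) (G (us ++ z)) s' t <= S.
    by rewrite ler_pdivrMr //; exact: sup_pushes.
  split => //.
  - apply: scale_winb => //; rewrite -szz /z catA; apply: window_reach => //.
    by rewrite -catA -/z szz.
  - move=> t i ij; rewrite /normalized -[xi](mulfK (lt0r_neq0 C0)) mulrA -mulrDl.
    apply: ler_wpM2r; first by rewrite invr_ge0 ler0n.
    by rewrite -szz; exact: (@lip_pushes (j * r)%N lam xi (us ++ z) s' flip xi0 t i ij).
  - exact: energy_le.
apply: le_trans (@markov R As (fun us => energy_exc e N beta theta0
     (normalized (size us + l1) (pushes e us (G z)) s) ^+ k) _ (theta ^+ k) _ _ _) _.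
- by rewrite exprn_gt0.
- by move=> y _; rewrite exprn_ge0 // le_max lexx.
- move=> y yA; rewrite Gz (insupp_size yA) => hE.
  apply: lerXn2r; rewrite ?nnegrE; [exact: ltW|by rewrite le_max lexx|].
  by rewrite le_max -/theta; apply/orP; right; lra.
apply: ler_wpM2r; first by rewrite invr_ge0 exprn_ge0 // ltW.
apply: (@energy_bound R V e N N0 beta lam xi theta0 iota alpha kappa (2 * S) j r k
  beta_gt0 l12 xi0 j0 r0 th0 io0 io al _ ka As reach l1 (G z)) => //.
- by rewrite mulr_ge0.
- by move=> s' rs'; exact: (tm [::]).
move=> pre A As' s1 EAs rs1.
have [/andP[s0 sl] b1 b2 b3 b4] := bulk rs1.
case: s1 rs1 s0 sl b1 b2 b3 b4 => // s1 rs1 _ sl b1 b2 b3 b4.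
have [r1 r2] := reach_pred (leq_addl _ _) rs1.
exists s1; first by split.
split.
- exact: le_trans kq b3.
- apply: le_trans kE _; apply: ler_wpM2r; first exact: ltW.
  apply: ler_wpM2r => //; rewrite expr2; apply: ler_pM; [exact: ltW|exact: ltW|exact: b3|].
  by move: b4; set x := _ / _; lra.
- by move=> us uA; rewrite (insupp_size uA); split; rewrite -(insupp_size uA);
    apply: tm; rewrite (insupp_size uA).
Qed.

End Phase2.

Let tau := 2 * beta / N%:R.

Let tau_gt0 : 0 < tau.
Proof. by rewrite divr_gt0 ?ltr0n // mulr_gt0 // beta_gt0. Qed.

Lemma excess_small th z l s : size z = l -> reach l s ->
  winb e N (G z s) (beta * 'C(l, s)%:R) ->
  energy e N (normalized l (G z) s) <= th * beta / N%:R ->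
  \sum_t exc tau l (G z) s t <= th * 'C(l, s)%:R.
Proof.
move=> sz rs wb hE; have C0 := bin_reach rs.
have E t : exc tau l (G z) s t =
    Num.max 0 (normalized l (G z) s t - 2 * beta / N%:R) * 'C(l, s)%:R.
  rewrite maxr_pMl ?ler0n // mul0r mulrBl /normalized divfK ?lt0r_neq0 //.
under eq_bigr => t _ do rewrite E.
rewrite -mulr_suml; apply: ler_wpM2r; first exact: ler0n.
apply: le_trans (excess_energy N0 beta_gt0 (scale_winb C0 wb)) _.
rewrite ler_pdivrMr ?beta_gt0 //; move: hE; rewrite ler_pdivlMr // ltr0n //.
Qed.

(** The block [w] brings the windows of the excess over [tau] down to [th * beta]. A point above
    [2 tau] has excess at least [tau], so it is hit with probability at most [2 th], whatever the
    height [S]. In the initial moment [S] bounds all factors but one and the total mass bounds that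
    one; the exponential decay comes from [c ^+ k]. *)
Lemma final_phase As w z th k : block w -> size z = l1 ->
  {in As, forall A, spread R e N A} -> 0 <= th -> (0 < k)%N ->
  2 ^+ k * (2 * th) <= 2^-1 ->
  (forall s, reach l1 s -> \sum_t exc tau l1 (G z) s t <= th * 'C(l1, s)%:R) ->
  (forall s, reach l1 s -> forall t, G z s t <= S * 'C(l1, s)%:R) ->
  (size As + h.*2 + l1 = n)%N -> forall c, 0 <= c ->
  (forall s, reach (h.*2 + l1) s -> 'C(h.*2 + l1, s)%:R <= c * 'C(n, m)%:R) ->
  (m <= n)%N ->
  pr R As (fun us => [exists t, 4 * tau * 'C(n, m)%:R <= G (us ++ w ++ z) m t]) <=
    3 ^+ size As * (S ^+ k.-1 * c ^+ k) / (2 * tau) ^+ k.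
Proof.
move=> bw sz sAs th0 k0 kpi hexc hS szn c c0 hc mn.
have [_ sw _] := bw.
pose l3 := (h.*2 + l1)%N.
have szn' : (size As + l3 = n)%N by rewrite /l3 addnA.
have Gw us : G (us ++ w ++ z) = pushes e us (G (w ++ z)) by rewrite /G pushes_cat.
have Gz : G (w ++ z) = pushes e w (G z) by rewrite /G pushes_cat.
have szwz : size (w ++ z) = l3 by rewrite size_cat sw sz.
have rn : reach n m by split => //; rewrite ?subnn ?addn0 // -szn leq_addl.
have Cn : 0 < 'C(n, m)%:R :> R by exact: bin_reach.
have W s : reach l3 s -> winb e N (exc tau l3 (G (w ++ z)) s) (th * beta * 'C(l3, s)%:R).
  move=> rs; have [/andP[_ sl] b1 b2 _ _] := bulk rs; have [_ ln _ _] := rs.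
  apply: (@winb_le _ _ _ _ _ (pushes e w (exc tau l1 (G z)) s)).
    by move=> t; rewrite Gz /l3 -sw; exact: exc_pushes.
  rewrite /l3 addnC; apply: window_block => //; rewrite 1?[(l1 + h.*2)%N]addnC.
  - by move=> s' t; exact: exc_ge0.
  - move=> s' hs'; apply: hexc; apply: reach_prefix rs _ => //.
  - exact: ltnW.
  - by apply: le_trans nn; rewrite ler_nat.
  - by apply: le_trans b1 _; rewrite ler_nat.
  - by apply: le_trans b2 _; rewrite ler_nat.
have Wy ys s : reach (size ys + l3) s ->
    winb e N (exc tau (size ys + l3) (G (ys ++ w ++ z)) s)
      (th * beta * 'C(size ys + l3, s)%:R).
  move=> rs; apply: (@winb_le _ _ _ _ _ (pushes e ys (exc tau l3 (G (w ++ z))) s)).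
    by move=> t; rewrite Gw; exact: exc_pushes.
  apply: winb_pushes => s' hs'; apply: W; apply: reach_prefix rs hs'.
  by rewrite /l3 leq_addl.
have tau2 : 0 < 2 * tau by exact: mulr_gt0.
have C0 : 0 < 2 * tau * 'C(size As + l3, m)%:R by rewrite szn' mulr_gt0.
have fin : expect As (fun ys => potential (2 * tau) k (size ys + l3) (G (ys ++ w ++ z)) m)
    <= 3 ^+ size As * (S ^+ k.-1 * (c * 'C(n, m)%:R) ^+ k).
  under eq_expect => ys _ do rewrite Gw.
  apply: (@potential_bound R V e N As reach (2 * tau) (2 * th)) => //.
  - by rewrite mulr_ge0 // exprn_ge0 // mulr_ge0 // ltW.
  - move=> s rs; have Cs := bin_reach rs.
    have sup t : G (w ++ z) s t <= S * 'C(l3, s)%:R.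
      by rewrite /l3 -sw; apply: sup_pushes => //; rewrite sw.
    apply: (@le_trans _ _ (\sum_t (S * 'C(l3, s)%:R) ^+ k.-1 * G (w ++ z) s t)).
      apply: ler_sum => t _; rewrite -{1}(prednK k0) exprSr.
      have eG : exc (2 * tau) l3 (G (w ++ z)) s t <= G (w ++ z) s t.
        by rewrite ge_max G0 /= lerBlDr lerDl mulr_ge0 ?ler0n // ltW.
      apply: ler_pM => //; rewrite ?exprn_ge0 ?exc_ge0 //.
      rewrite lerXn2r ?nnegrE ?exc_ge0 ?mulr_ge0 ?ler0n //.
      exact: le_trans eG (sup t).
    rewrite -mulr_sumr exprMn -mulrA; apply: ler_wpM2l; first exact: exprn_ge0.
    apply: (@le_trans _ _ ('C(l3, s)%:R ^+ k.-1 * 'C(l3, s)%:R)).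
      by apply: ler_wpM2l; [rewrite exprn_ge0 ?ler0n|rewrite -szwz; exact: Gsum].
    rewrite -exprSr prednK //; apply: lerXn2r; rewrite ?nnegrE ?ler0n //.
      by rewrite mulr_ge0 // ltW.
    exact: hc.
  - move=> pre A As' s1 EAs rs1; right.
    have [/andP[s0 sl] _ _ _ _] := bulk rs1.
    case: s1 rs1 s0 sl => // s1 rs1 _ sl.
    have l1l : (l1 <= size As' + l3)%N by rewrite /l3 addnA leq_addl.
    have [r1 r2] := reach_pred l1l rs1.
    exists s1; split => // ys yA.
    have sy := insupp_size yA.
    have hr s : reach (size ys + l3) s ->
        rare e N (2 * tau) (2 * th) (size ys + l3) (pushes e ys (G (w ++ z))) s.
      move=> rs; exists (exc tau (size ys + l3) (G (ys ++ w ++ z)) s),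
        (th * beta * 'C(size ys + l3, s)%:R), (tau * 'C(size ys + l3, s)%:R).
      split.
      - by rewrite mulr_gt0 // bin_reach.
      - by move=> t; exact: exc_ge0.
      - exact: Wy.
      - move=> t; rewrite -Gw /exc lt_max ltxx /= subr_gt0 => ht.
        by rewrite le_max; apply/orP; right; move: ht; rewrite -mulrA; lra.
      - rewrite le_eqVlt; apply/orP; left; apply/eqP; rewrite /tau.
        have Nn : N%:R != 0 :> R by rewrite pnatr_eq0 -lt0n.
        move: Nn; move: (N%:R : R) ('C(_, _)%:R : R) => u v un.
        by field.
    by split; apply: hr; rewrite sy.
  - by rewrite szn'.
have := @pr_exc_exists As (fun ys => G (ys ++ w ++ z)) l3 (2 * tau) k m _ k0 C0 fin.
have e4 : 2 * (2 * tau) = 4 * tau by ring.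
rewrite szn' e4.
move=> hp; apply: le_trans hp _.
rewrite le_eqVlt; apply/orP; left; apply/eqP.
rewrite (exprMn k c) (exprMn k (2 * tau)).
have d1 : 'C(n, m)%:R ^+ k != 0 :> R by rewrite expf_neq0 // lt0r_neq0.
have d2 : (2 * tau) ^+ k != 0 by rewrite expf_neq0 // lt0r_neq0.
move: d1 d2; move: ('C(n, m)%:R ^+ k : R) ((2 * tau) ^+ k) (c ^+ k)
  (S ^+ k.-1) (3 ^+ size As : R) => u v x' y' z' u0 v0.
by field; rewrite u0 v0.
Qed.

End Phases.

Section ThreePhases.
Variables (R : realFieldType) (V : finZmodType) (e : V) (N D Rr h : nat).
Variables (rho X : int) (c1 c2 q nR : R) (f : V -> R).
Hypotheses (N0 : (0 < N)%N) (e_inj : forall z : int, `|z| <= rho -> e *~ z = 0 -> z = 0)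
  (X0 : 0 <= X) (hrho : (X *+ h.*2 + D%:Z) *+ 2 <= rho) (ND : (N <= Rr * D)%N)
  (Rr0 : (0 < Rr)%N)
  (c10 : 0 < c1) (c20 : 0 < c2) (q0 : 0 < q) (qn : q ^+ 2 = nR)
  (h2 : c2 * nR <= (h.*2.+1)%:R)
  (f0 : forall t, 0 <= f t) (f1 : \sum_t f t <= 1).

Variables (Outer W Steps Main Z : seq (seq int)) (n m l1 l2 : nat).
Hypotheses (sZ : forall z, insupp Z z -> exists zs ex, z = zs ++ ex /\ block D h X zs)
  (sW : forall w, insupp W w -> block D h X w)
  (sMain : {in Main, forall A, spread R e N A})
  (sOuter : {in Outer, forall A, spread R e N A})
  (sSteps : {in Steps, forall A, exists x0 P, interval_seq A x0 P /\ (N <= P)%N})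
  (el1 : (size Main + size Z = l1)%N) (el2 : (size Steps + l1 = l2)%N)
  (en : (size Outer + h.*2 + l2 = n)%N) (mn : (m <= n)%N).

Variables (tau1 qq lam xi theta0 iota alpha kappa Q c B1 B2 : R) (j r k1 k2 k3 : nat).
Let beta := beta Rr c1 c2 q.
Let S := 2 * tau1.
Let tau := 2 * beta / N%:R.

Hypotheses (nn : n.+1%:R <= 2 * nR) (qq0 : 0 < qq)
  (bulk : forall l s, reach n m l1 l s -> [/\ (0 < s < l)%N, c1 * nR <= s%:R,
     c1 * nR <= (l - s)%:R, qq <= s%:R / l%:R & s%:R / l%:R <= 1 - qq]).
Hypotheses (k10 : (0 < k1)%N) (t10 : 0 < tau1)
  (kpi1 : 2 ^+ k1 * (4 * beta / N%:R / tau1) <= 2^-1)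
  (base : forall s, 'C(size Z, s)%:R ^+ k1 <= Q)
  (atyp : forall l s, (l <= n)%N ->
     (s%:R < c1 * nR \/ (l%:R - s%:R < c1 * nR)) -> 'C(l, s)%:R ^+ k1 <= Q)
  (hB1 : 0 <= B1)
  (B1P : forall s, reach n m l1 l1 s -> 3 ^+ size Main * Q / (tau1 * 'C(l1, s)%:R) ^+ k1 <= B1).
Hypotheses (l12 : 1 <= lam <= 2) (xi0 : 0 <= xi)
  (j0 : (0 < j)%N) (r0 : (0 < r)%N) (th0 : 0 < theta0) (io0 : 0 <= iota)
  (io : 16 * iota * (j * r)%:R ^+ 2 <= 1)
  (al : 4 / j%:R + 8 * (8 * (lam - 1) + r%:R^-1 + 4 * xi * N%:R / beta) / theta0 <= alpha)
  (ka : 0 <= kappa <= 1) (kq : kappa <= qq)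
  (kE : kappa * (2 * S) <= qq ^+ 2 * iota * (theta0 * beta / N%:R))
  (flip : lip e (j * r) lam xi f) (hB2 : 0 <= B2)
  (B2P : (2 * ((1 - kappa) ^+ k2 + alpha)) ^+ size Steps * (2 * S) ^+ k2 /
     (theta0 * beta / N%:R) ^+ k2 <= B2).
Hypotheses (k30 : (0 < k3)%N) (kpi3 : 2 ^+ k3 * (2 * (2 * theta0)) <= 2^-1)
  (c0 : 0 <= c)
  (hc : forall s, reach n m l1 (h.*2 + l2) s -> 'C(h.*2 + l2, s)%:R <= c * 'C(n, m)%:R).

Let G (xs : seq int) := pushes e xs (seed f).

Let good1 y := [forall s : 'I_n.+1, [&& (s <= m)%N & (m <= s + (n - l1))%N] ==>
  [forall t, G y s t < S * 'C(l1, s)%:R]].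
Let good2 y := [forall s : 'I_n.+1, [&& (s <= m)%N & (m <= s + (n - l2))%N] ==>
  (energy e N (normalized l2 (G y) s) < 2 * (theta0 * beta / N%:R))].
(** Dropping the coordinates of [Steps] recovers the suffix on which the first phase ended. *)
Let good12 y := good1 (drop (size Steps) y) && good2 y.

Let l1n : (l1 <= n)%N.
Proof. by rewrite -en -el2 addnA leq_addl. Qed.

Let l2n : (l2 <= n)%N.
Proof. by rewrite -en leq_addl. Qed.

Let good1P y : good1 y -> forall s, reach n m l1 l1 s ->
  forall t, G y s t <= S * 'C(l1, s)%:R.
Proof.
move=> /forallP g s [_ _ sm ms] t.
have sn : (s < n.+1)%N by rewrite ltnS (leq_trans sm).
by have := g (Ordinal sn); rewrite /= sm ms => /forallP/(_ t)/ltW.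
Qed.

Let good2P y : good2 y -> forall s, reach n m l2 l2 s ->
  energy e N (normalized l2 (G y) s) <= 2 * (theta0 * beta / N%:R).
Proof.
move=> /forallP g s [_ _ sm ms].
have sn : (s < n.+1)%N by rewrite ltnS (leq_trans sm).
by have := g (Ordinal sn); rewrite /= sm ms => /ltW.
Qed.

Let S0 : 0 <= S. Proof. by rewrite mulr_ge0 // ltW. Qed.

Lemma sup_phase_all : pr R (Main ++ Z) (fun y => ~~ good1 y) <= n.+1%:R * B1.
Proof.
rewrite /pr expect_cat_inner; apply: expect_le_cst; first by rewrite mulr_ge0 ?ler0n.
move=> z zZ; have [zs [ex [Ez bz]]] := sZ zZ.
have szZ : size (zs ++ ex) = size Z by rewrite -Ez (insupp_size zZ).
rewrite -(size_iota 0 n.+1).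
apply: (@pr_exists _ _ (seq.iota 0 n.+1) Main
  (fun s ys => [&& (s <= m)%N, (m <= s + (n - l1))%N &
     [exists t, 2 * tau1 * 'C(l1, s)%:R <= G (ys ++ z) s t]])
  (fun ys => ~~ good1 (ys ++ z))).
  move=> ys _ /forallPn[s]; rewrite negb_imply => /andP[/andP[sm ms] /forallPn[t ht]].
  apply/hasP; exists (nat_of_ord s); first by rewrite mem_iota add0n ltn_ord.
  by rewrite sm ms; apply/existsP; exists t; rewrite leNgt.
move=> s.
have [|nr] := boolP ((s <= m)%N && (m <= s + (n - l1))%N); last first.
  apply: expect_le_cst => // y _; move: nr; rewrite negb_and.
  by case/orP => /negbTE ->; rewrite ?andbF.
move=> /andP[sm ms].
have rs : reach n m l1 l1 s by split.
have [/andP[_ sl] _ _ _ _] := bulk rs.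
apply: le_trans (B1P rs).
have el : (size Main + size (zs ++ ex))%N = l1 by rewrite szZ.
have P1 := @sup_phase _ _ _ _ _ _ _ _ _ _ _ _ _ _ N0 e_inj X0 hrho ND c10 c20 q0 qn h2 f0 f1
  Main zs ex tau1 k1 Q bz sMain.
rewrite el in P1.
apply: le_trans (P1 _ k10 t10 kpi1 _ _ s _).
- by apply: expect_le => y _; rewrite Ez sm ms.
- by apply: le_trans nn; rewrite ler_nat.
- by rewrite szZ.
- by move=> l s' hl; apply: atyp; exact: leq_trans hl l1n.
- exact: ltnW.
Qed.

Lemma energy_phase_all :
  pr R (Steps ++ (Main ++ Z)) (fun y => ~~ good12 y) <= n.+1%:R * B1 + n.+1%:R * B2.
Proof.
apply: le_trans (@pr_cond R Steps (Main ++ Z) _ good1 (n.+1%:R * B2) _ _) _.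
- by rewrite mulr_ge0 ?ler0n.
- move=> y yM gy.
  have szy : size y = l1 by rewrite (insupp_size yM) size_cat.
  have [ys [zs [ex [Ey bz]]]] : exists ys zs ex, y = ys ++ zs ++ ex /\ block D h X zs.
    have [ys [z [-> _ /sZ[zs [ex [-> bz]]]]]] := insupp_cat yM.
    by exists ys, zs, ex.
  rewrite -(size_iota 0 n.+1).
  apply: (@pr_exists _ _ (seq.iota 0 n.+1) Steps
    (fun s us => [&& (s <= m)%N, (m <= s + (n - l2))%N &
      2 * (theta0 * beta / N%:R) <= energy e N (normalized l2 (G (us ++ y)) s)])
    (fun us => ~~ good12 (us ++ y))).
    move=> us uS; rewrite /good12.
    have -> : drop (size Steps) (us ++ y) = y by rewrite drop_size_cat // (insupp_size uS).
    rewrite gy andTb => /forallPn[s]; rewrite negb_imply => /andP[/andP[sm ms] ht].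
    apply/hasP; exists (nat_of_ord s); first by rewrite mem_iota add0n ltn_ord.
    by rewrite sm ms leNgt.
  move=> s.
  have [|nr] := boolP ((s <= m)%N && (m <= s + (n - l2))%N); last first.
    apply: expect_le_cst => // us _; move: nr; rewrite negb_and.
    by case/orP => /negbTE ->; rewrite ?andbF.
  move=> /andP[sm ms].
  have rs : reach n m l1 (size Steps + l1) s by rewrite el2; split => //; rewrite -el2 leq_addl.
  apply: le_trans B2P.
  have := @energy_phase _ _ _ _ _ _ _ _ _ _ _ _ _ _ N0 e_inj X0 hrho ND Rr0 c10 c20 q0 qn h2 f0 f1
    n m S qq l1 nn S0 qq0 bulk lam xi theta0 iota alpha kappa j r k2 l12 xi0 j0 r0 th0 io0
    io al ka kq kE flip Steps ys zs ex bz.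
  rewrite -Ey => P2; apply: le_trans (P2 szy sSteps (good1P gy) s rs).
  by apply: expect_le => us _; rewrite sm ms /= el2.
by rewrite lerD2r; exact: sup_phase_all.
Qed.

(** The factors [n.+1] are union bounds over slices; the last phase looks at the single slice
    [(n, m)]. The bound [S] survives [Steps] because averaging does not raise a supremum, and [W]
    needs no probabilistic estimate, as every outcome is a block. *)
Lemma three_phase_bound :
  pr R (Outer ++ W ++ Steps ++ Main ++ Z)
    (fun x => [exists t, 4 * tau * 'C(n, m)%:R <= G x m t]) <=
  n.+1%:R * B1 + n.+1%:R * B2 +
    3 ^+ size Outer * (S ^+ k3.-1 * c ^+ k3) / (2 * tau) ^+ k3.
Proof.
have tau0 : 0 < tau by rewrite divr_gt0 ?ltr0n // mulr_gt0 // beta_gt0.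
set B3 := 3 ^+ size Outer * _ / _.
have hB3 : 0 <= B3.
  apply: divr_ge0; last by apply: exprn_ge0; rewrite mulr_ge0 // ltW.
  by apply: mulr_ge0; [exact: exprn_ge0|apply: mulr_ge0; exact: exprn_ge0].
rewrite catA.
apply: le_trans (@pr_cond R (Outer ++ W) _ _ good12 B3 hB3 _) _; last first.
  by rewrite lerD2r; exact: energy_phase_all.
move=> v vS /andP[]; have [us [y [Ev uS yM]]] := insupp_cat vS.
rewrite Ev drop_size_cat ?(insupp_size uS) // -Ev => g1 g2.
have szu := insupp_size uS.
have szy : size y = l1 by rewrite (insupp_size yM) size_cat.
have szv : size v = l2 by rewrite Ev size_cat szu szy.
have [ys [z [Ey yM' zZ]]] := insupp_cat yM.
have [zs [ex [Ez bz]]] := sZ zZ.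
have bulk2 l s : reach n m l2 l s -> reach n m l1 l s.
  by case=> a1 a2 a3 a4; split => //; apply: leq_trans a1; rewrite -el2 leq_addl.
have sup s : reach n m l2 l2 s -> forall t, G v s t <= S * 'C(l2, s)%:R.
  move=> rs t; rewrite /G Ev pushes_cat -el2 -szu.
  apply: pushes_le_cst => s' t' hs'; apply: (good1P g1).
  have := bulk2 _ _ rs; rewrite -el2 -szu => rs'.
  exact: reach_prefix (leqnn _) rs' hs'.
have exs s : reach n m l2 l2 s ->
    \sum_t exc tau l2 (G v) s t <= 2 * theta0 * 'C(l2, s)%:R.
  move=> rs; have rs1 := bulk2 _ _ rs.
  have [/andP[_ sl] b1 b2 _ _] := bulk rs1.
  apply: (@excess_small _ _ _ _ _ _ _ _ _ _ N0 Rr0 c10 c20 q0 n m qq l1 bulk) => //.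
    rewrite -szv Ev Ey Ez catA.
    apply: (@window_G _ _ _ _ _ _ _ _ _ _ _ _ _ _ e_inj X0 hrho ND c10 c20 q0 qn h2 f0 f1) => //;
      rewrite -?catA -?Ez -?Ey -?Ev ?szv.
    - exact: ltnW.
    - by apply: le_trans nn; rewrite ler_nat.
    - by apply: le_trans b1 _; rewrite ler_nat.
    - by apply: le_trans b2 _; rewrite ler_nat.
  apply: le_trans (good2P g2 rs) _.
  by rewrite !mulrA.
have P := @final_phase _ _ _ _ _ _ _ _ _ _ _ _ _ _ N0 e_inj X0 hrho ND Rr0 c10 c20 q0 qn h2 f0 f1
  n m S qq l2 nn S0 (fun l s h => bulk (bulk2 l s h)) Outer.
rewrite /pr expect_cat_inner; apply: expect_le_cst => // w wW.
apply: le_trans (P w v (2 * theta0) k3 (sW wW) szv sOuter _ k30 kpi3 exs sup en c c0 _ mn).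
- by apply: expect_le => us' _; rewrite -catA.
- by rewrite mulr_ge0 // ltW.
- by move=> s rs; apply: hc; exact: bulk2.
Qed.

End ThreePhases.

(** * Choice of the constants *)

Section BinomialEstimates.
Variable R : realType.

Lemma bin_le_exp2 l s : 'C(l, s)%:R <= expR l%:R :> R.
Proof.
apply: (@le_trans _ _ (2 ^+ l)).
  rewrite -natrX ler_nat; have [sl|/bin_small -> //] := leqP s l.
  have := expnDn 1 1 l; rewrite addn1 => ->.
  rewrite (bigD1 (inord s)) //= !exp1n !muln1 inordK ?leq_addr //.
rewrite -[l%:R]mulr1 expRM_natl lerXn2r ?nnegrE ?expR_ge0 //.
by apply: le_trans (expR_ge1Dx 1).
Qed.

Lemma le_expR (x : R) : x <= expR x.
Proof. by apply: le_trans (expR_ge1Dx x); rewrite lerDr. Qed.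

Lemma expR_natX (x : R) k : expR x ^+ k = expR (x * k%:R).
Proof. by rewrite -expRM_natl mulrC. Qed.

Lemma bin_generating_le l s (y : R) : 0 < y -> 'C(l, s)%:R <= (1 + y) ^+ l / y ^+ s.
Proof.
move=> y0; rewrite ler_pdivlMr ?exprn_gt0 //.
have [sl|/bin_small ->] := leqP s l; last by rewrite mul0r exprn_ge0 // addr_ge0 // ltW.
rewrite exprDn (bigD1 (inord s)) //= inordK // expr1n mul1r -(mulr_natl (y ^+ s)).
by rewrite lerDl sumr_ge0 // => i _; rewrite expr1n mul1r mulrn_wge0 // exprn_ge0 // ltW.
Qed.

(** The generating function at [y = eps / 8]: [(1 + y) ^+ l] is at most [exp (y n)], and
    [y^-1 <= exp (y^-1)] bounds [y ^- s] by [exp (s / y)]. This crude substitute for entropy is why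
    [c1] is quadratic in [eps]. *)
Lemma bin_edge_le (eps c1 : R) n l s : 0 < eps <= 1 -> c1 <= eps ^+ 2 / 64 ->
  (l <= n)%N -> s%:R < c1 * n%:R \/ l%:R - s%:R < c1 * n%:R ->
  'C(l, s)%:R <= expR (eps / 4 * n%:R).
Proof.
move=> /andP[e0 e1] hc ln.
have key t : t%:R < c1 * n%:R -> 'C(l, t)%:R <= expR (eps / 4 * n%:R).
  move=> ht; pose y := eps / 8; have y0 : 0 < y by rewrite /y; lra.
  apply: le_trans (bin_generating_le l t y0) _.
  apply: (@le_trans _ _ (expR (y * n%:R) * expR (y^-1 * t%:R))).
    apply: ler_pM.
    - by rewrite exprn_ge0 // addr_ge0 // ltW.
    - by rewrite invr_ge0 exprn_ge0 // ltW.
    - apply: (@le_trans _ _ (expR y ^+ l)).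
        apply: lerXn2r; rewrite ?nnegrE ?expR_ge0 ?expR_ge1Dx //.
        by rewrite addr_ge0 // ltW.
      rewrite expR_natX ler_expR; apply: ler_wpM2l; first exact: ltW.
      by rewrite ler_nat.
    - rewrite -exprVn -expR_natX.
      apply: lerXn2r; rewrite ?nnegrE ?expR_ge0 ?le_expR //.
      by rewrite invr_ge0 ltW.
  rewrite -expRD ler_expR.
  have : y^-1 * t%:R <= y * n%:R.
    rewrite mulrC ler_pdivrMr //; apply: le_trans (ltW ht) _.
    rewrite mulrAC; apply: ler_wpM2r; first exact: ler0n.
    by apply: le_trans hc _; rewrite /y; lra.
  by rewrite /y; lra.
case=> [|ht]; first exact: key.
have [sl|/bin_small ->] := leqP s l; last exact: expR_ge0.
by rewrite -bin_sub //; apply: key; rewrite natrB.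
Qed.

(** Between [lo] and [hi] neighbouring binomial coefficients have ratio at most [Y] in both
    directions. *)
Lemma bin_shift (Y : R) l lo hi s t d : 1 <= Y ->
  l%:R <= Y * lo.+1%:R -> hi%:R <= Y * (l - hi).+1%:R -> (hi <= l)%N ->
  (lo <= s <= hi)%N -> (lo <= t <= hi)%N -> (t <= s + d)%N -> (s <= t + d)%N ->
  'C(l, t)%:R <= Y ^+ d * 'C(l, s)%:R.
Proof.
move=> Y1 hlo hhi hl sb tb td sd.
have Y0 : 0 <= Y by apply: le_trans Y1.
have up b : (lo <= b)%N -> 'C(l, b.+1)%:R <= Y * 'C(l, b)%:R.
  move=> lb; have := congr1 (fun k => k%:R : R) (mul_bin_left l b).
  rewrite !natrM => E.
  rewrite -(ler_pM2l (_ : 0 < b.+1%:R)) ?ltr0n // E mulrA.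
  apply: ler_wpM2r; first exact: ler0n.
  apply: (@le_trans _ _ l%:R); first by rewrite ler_nat leq_subr.
  by apply: le_trans hlo _; rewrite mulrC; apply: ler_wpM2r => //; rewrite ler_nat.
have down b : (b < hi)%N -> 'C(l, b)%:R <= Y * 'C(l, b.+1)%:R.
  move=> lb; have := congr1 (fun k => k%:R : R) (mul_bin_left l b).
  rewrite !natrM => E.
  have lb0 : 0 < (l - b)%:R :> R by rewrite ltr0n subn_gt0 (leq_trans lb).
  rewrite -(ler_pM2l lb0) -E mulrA.
  apply: ler_wpM2r; first exact: ler0n.
  apply: (@le_trans _ _ hi%:R); first by rewrite ler_nat.
  apply: le_trans hhi _; rewrite mulrC; apply: ler_wpM2r => //; rewrite ler_nat; lia.
have upk k : (s + k <= hi)%N -> 'C(l, s + k)%:R <= Y ^+ k * 'C(l, s)%:R.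
  elim: k => [|k IH] hk; first by rewrite addn0 mul1r.
  rewrite addnS exprS -mulrA; apply: le_trans (up _ _) _; first lia.
  by apply: ler_wpM2l => //; apply: IH; lia.
have downk k : (t + k <= hi)%N -> 'C(l, t)%:R <= Y ^+ k * 'C(l, t + k)%:R.
  elim: k => [|k IH] hk; first by rewrite addn0 mul1r.
  apply: le_trans (IH _) _; first lia.
  rewrite addnS exprSr -mulrA; apply: ler_wpM2l; first exact: exprn_ge0.
  by apply: down; lia.
have fin k : (k <= d)%N -> Y ^+ k * 'C(l, s)%:R <= Y ^+ d * 'C(l, s)%:R.
  by move=> kd; apply: ler_wpM2r; [exact: ler0n|rewrite ler_weXn2l].
have [st|ts] := leqP s t.
  apply: le_trans (fin (t - s)%N _); last lia.
  by have := upk (t - s)%N; rewrite subnKC //; apply; lia.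
apply: le_trans (fin (s - t)%N _); last lia.
by have := downk (s - t)%N; rewrite subnKC ?(ltnW ts) //; apply; lia.
Qed.

Lemma bin_vandermonde_le n l a0 (B : R) : (l <= n)%N -> 0 <= B ->
  (forall j, (j <= n - l)%N -> (j <= a0)%N -> 'C(l, a0 - j)%:R <= B) -> (a0 <= n)%N ->
  'C(n, a0)%:R <= n.+1%:R * expR (n - l)%:R * B.
Proof.
move=> ln B0 hB an.
have -> : 'C(n, a0)%:R = \sum_(j < a0.+1) ('C(n - l, j)%:R * 'C(l, a0 - j)%:R) :> R.
  rewrite -{1}(subnK ln) -binomial.Vandermonde natr_sum.
  by apply: eq_bigr => j _; rewrite natrM.
apply: (@le_trans _ _ (\sum_(j < a0.+1) (expR (n - l)%:R * B))).
  apply: ler_sum => j _.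
  have [jn|nj] := leqP j (n - l)%N; last first.
    by rewrite bin_small // mul0r mulr_ge0 ?expR_ge0.
  apply: ler_pM; rewrite ?ler0n ?bin_le_exp2 //.
  by apply: hB => //; rewrite -ltnS.
rewrite sumr_const card_ord -(mulr_natl (_ * _)) mulrA.
apply: ler_wpM2r => //; apply: ler_wpM2r; first exact: expR_ge0.
by rewrite ler_nat.
Qed.

(** The ratio of ['C(l, s)] to ['C(l.+1, s)] is [1 - s / l.+1], and to ['C(l.+1, s.+1)] it is
    [s.+1 / l.+1]. Both are at most [1 - qq] in the bulk, so any path inside [P] up to [(n, m)] will
    do. *)
Lemma bin_descent (qq : R) n m l s (P : nat -> nat -> Prop) : qq <= 1 ->
  (forall l s, P l s -> (l < n)%N -> P l.+1 s \/ P l.+1 s.+1) ->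
  (forall l s, P l.+1 s -> (s <= l.+1)%N /\ s%:R / l.+1%:R <= 1 - qq /\ qq <= s%:R / l.+1%:R) ->
  (forall s, P n s -> s = m) -> P l s -> (l <= n)%N ->
  'C(l, s)%:R <= (1 - qq) ^+ (n - l) * 'C(n, m)%:R.
Proof.
move=> q1 step bulk fin Pls ln.
have q0 : 0 <= 1 - qq by rewrite subr_ge0.
have := subnKC ln; move: (n - l)%N => k.
elim: k l s Pls {ln} => [|k IH] l s Pls E.
  by move: Pls; rewrite addn0 in E; rewrite E => /fin ->; rewrite mul1r.
have ln : (l < n)%N by rewrite -E addnS ltnS leq_addr.
have E' : (l.+1 + k)%N = n by rewrite addSnnS.
case: (step l s Pls ln) => P'.
  have [sl [_ b]] := bulk _ _ P'.
  have c : 'C(l, s)%:R <= (1 - qq) * 'C(l.+1, s)%:R.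
    have := congr1 (fun k => k%:R : R) (mul_bin_down l.+1 s).
    rewrite !natrM /= natrB // => E2.
    rewrite -(ler_pM2l (_ : 0 < l.+1%:R)) ?ltr0n // E2 mulrA.
    apply: ler_wpM2r; first exact: ler0n.
    by move: b; rewrite ler_pdivlMr ?ltr0n //; lra.
  apply: le_trans c _; rewrite exprS -mulrA; apply: ler_wpM2l => //; exact: IH.
have [sl [b _]] := bulk _ _ P'.
have c : 'C(l, s)%:R <= (1 - qq) * 'C(l.+1, s.+1)%:R.
  have := congr1 (fun k => k%:R : R) (mul_bin_diag l.+1 s).
  rewrite !natrM /= => E2.
  rewrite -(ler_pM2l (_ : 0 < l.+1%:R)) ?ltr0n // E2 mulrA.
  apply: ler_wpM2r; first exact: ler0n.
  by move: b; rewrite ler_pdivrMr ?ltr0n // mulrC.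
apply: le_trans c _; rewrite exprS -mulrA; apply: ler_wpM2l => //; exact: IH.
Qed.

Lemma poly_le_expR (eps : R) n : 0 < eps <= 1 -> 2048 / eps ^+ 2 <= n%:R ->
  n.+1%:R ^+ 2 <= expR (eps / 8 * n%:R).
Proof.
move=> /andP[e0 e1] hn.
have -> : eps / 8 * n%:R = (eps * n%:R / 32) * 4%:R by lra.
rewrite -expR_natX; apply: (@le_trans _ _ ((eps * n%:R / 32) ^+ 4)); last first.
  by rewrite lerXn2r ?nnegrE ?expR_ge0 ?le_expR // divr_ge0 ?mulr_ge0 ?ler0n // ltW.
have -> : (eps * n%:R / 32) ^+ 4 = ((eps * n%:R / 32) ^+ 2) ^+ 2 by rewrite -exprM.
have n1 : 1 <= n%:R :> R.
  apply: le_trans hn; rewrite ler_pdivlMr ?exprn_gt0 // mul1r; nra.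
have e20 : 0 < eps ^+ 2 by rewrite exprn_gt0.
rewrite lerXn2r ?nnegrE ?ler0n ?sqr_ge0 // -natr1.
move: hn; rewrite ler_pdivrMr //; move: n%:R n1 => x x1 h.
have -> : (eps * x / 32) ^+ 2 = x * (x * eps ^+ 2) / 1024 by field.
have : x * 2048 <= x * (x * eps ^+ 2) by apply: ler_wpM2l => //; lra.
lra.
Qed.

End BinomialEstimates.

Section Numerics.
Variable R : realType.

Lemma reach_bulk (p a gamma c1 : R) (n m l1 l s h : nat) :
  0 < p <= 2^-1 -> 0 < a -> a <= p / 512 -> 0 < gamma -> gamma <= p / 64 ->
  c1 <= p / 4 -> (0 < n)%N -> (n = 6 * h + l1)%N -> h%:R <= a * n%:R ->
  p * n%:R - gamma * n%:R <= m%:R <= p * n%:R + gamma * n%:R ->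
  reach n m l1 l s ->
  [/\ (0 < s < l)%N, c1 * n%:R <= s%:R, c1 * n%:R <= (l - s)%:R,
      p / 2 <= s%:R / l%:R & s%:R / l%:R <= 1 - p / 2] /\
  (3 / 4 * p * n%:R <= s%:R /\ 3 / 8 * n%:R <= l%:R - s%:R :> R).
Proof.
move=> /andP[p0 p1] a0 ap g0 gp cp n0 en ha /andP[m1 m2] [r1 r2 r3 r4].
have N0 : 0 < n%:R :> R by rewrite ltr0n.
have E1 : m%:R <= s%:R + 6 * h%:R :> R.
  by rewrite -natrM -natrD ler_nat; move: r1 r2 r4 en; clear; lia.
have E2 : s%:R <= m%:R :> R by rewrite ler_nat.
have E3 : n%:R <= l%:R + 6 * h%:R :> R by rewrite -natrM -natrD ler_nat; move: r1 en; clear; lia.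
have E4 : l%:R <= n%:R :> R by rewrite ler_nat.
have an : a * n%:R <= p * n%:R / 512.
  by rewrite mulrAC; apply: ler_wpM2r => //; exact: ltW.
have gn : gamma * n%:R <= p * n%:R / 64.
  by rewrite mulrAC; apply: ler_wpM2r => //; exact: ltW.
have pn : p * n%:R <= n%:R / 2.
  by rewrite mulrC; apply: ler_wpM2l => //; exact: ltW.
have pn0 : 0 < p * n%:R by exact: mulr_gt0.
have cn : c1 * n%:R <= p * n%:R / 4.
  by rewrite mulrAC; apply: ler_wpM2r => //; exact: ltW.
move: E1 E2 E3 E4 an gn pn pn0 cn ha m1 m2 N0.
clear ap gp cp g0 a0.
set x := n%:R; set y := p * x; set ga := gamma * x; set aa := a * x; set cc := c1 * x.
move=> E1 E2 E3 E4 an gn pn pn0 cn ha m1 m2 N0.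
have S1 : 3 / 4 * y <= s%:R by lra.
have S2 : 3 / 8 * x <= l%:R - s%:R by lra.
have sl : (s < l)%N by rewrite -(ltr_nat R); lra.
have s0 : (0 < s)%N by rewrite -(ltr_nat R); lra.
have l0 : 0 < l%:R :> R by rewrite ltr0n (leq_ltn_trans _ sl).
split; last by rewrite /y in S1; split => //; rewrite -mulrA.
split.
- by rewrite s0 sl.
- by lra.
- by rewrite natrB ?(ltnW sl) //; lra.
- rewrite ler_pdivlMr //; apply: le_trans S1.
  have : p * l%:R <= y by rewrite /y; apply: ler_wpM2l => //; exact: ltW.
  lra.
- rewrite ler_pdivrMr //.
  have : p * l%:R <= 2^-1 * x by apply: ler_pM => //; exact: ltW.
  lra.
Qed.

(** Of the factor [exp (eps n)] granted by the bound on [N], three parts [exp (eps n / 8)] are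
    spent: on the [6 h] removed coordinates, on moving from [pn] to [s], and on the two polynomial
    factors, one for [q] and one from Vandermonde's sum. Half of the exponent is kept. *)
Lemma bin_lower (p a gamma eps : R) (n m l1 s h N : nat) (q : R) :
  0 < p <= 2^-1 -> 0 < eps <= 1 -> 0 < a -> a <= eps * p / 512 ->
  0 < gamma -> gamma <= eps * p / 64 ->
  (0 < n)%N -> (n = 6 * h + l1)%N -> h%:R <= a * n%:R -> 1 <= a * n%:R ->
  p * n%:R - gamma * n%:R <= m%:R <= p * n%:R + gamma * n%:R ->
  2048 / eps ^+ 2 <= n%:R -> 8 / p <= n%:R -> 0 < q -> q <= n.+1%:R ->
  N%:R <= 'C(n, Num.truncn (p * n%:R))%:R * expR (- (eps * n%:R)) ->
  reach n m l1 l1 s ->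
  N%:R * q * expR (eps / 2 * n%:R) <= 'C(l1, s)%:R.
Proof.
move=> pp ee a0 ae g0 ge n0 en ha an1 hm ne pn8 q0 qn HN rs.
have [p0 p1] := andP pp; have [e0 e1] := andP ee.
have ep : eps * p <= p by rewrite ler_piMl // ltW.
have ap : a <= p / 512 by apply: le_trans ae _; rewrite ler_pM2r ?invr_gt0 ?ltr0n.
have gp : gamma <= p / 64 by apply: le_trans ge _; rewrite ler_pM2r ?invr_gt0 ?ltr0n.
have [_ [S1 S2]] := @reach_bulk p a gamma 0 n m l1 l1 s h pp a0 ap g0 gp
   (ltW (divr_gt0 p0 (ltr0n _ 4))) n0 en ha hm rs.
have nR : 0 < n%:R :> R by rewrite ltr0n.
have pn0 : 0 < p * n%:R by exact: mulr_gt0.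
have pn2 : p * n%:R <= n%:R / 2 by rewrite mulrC; apply: ler_wpM2l => //; exact: ltW.
have pn8' : 8 <= p * n%:R by rewrite mulrC -ler_pdivrMr.
have an : a * n%:R <= p * n%:R / 512.
  by rewrite mulrAC; apply: ler_wpM2r => //; exact: ltW.
have gn : gamma * n%:R <= p * n%:R / 64.
  by rewrite mulrAC; apply: ler_wpM2r => //; exact: ltW.
have [a1 a2] := andP (truncn_itv (ltW pn0)).
set a0' := Num.truncn (p * n%:R) in a1 a2 HN.
have hi0 : 0 <= 5 / 8 * n%:R :> R by rewrite mulr_ge0 ?divr_ge0 ?ler0n.
have lo0 : 0 <= p * n%:R / 4 by rewrite divr_ge0 // ltW.
have [hi1 hi2] := andP (truncn_itv hi0).
have [lo1 lo2] := andP (truncn_itv lo0).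
set hi := Num.truncn (5 / 8 * n%:R) in hi1 hi2; set lo := Num.truncn (p * n%:R / 4) in lo1 lo2.
(* [gamma n] for the distance from [m] to [pn], [6 a n] for the removed coordinates, and a further
   [a n], at least 1, for rounding. *)
pose D := (gamma + 7 * a) * n%:R.
have D0 : 0 <= D by rewrite mulr_ge0 ?ler0n // addr_ge0 ?mulr_ge0 ?ltW.
have [d1 d2] := andP (truncn_itv D0).
set d := (Num.truncn D).+1 in d2.
have dle : d%:R <= (gamma + 8 * a) * n%:R.
  by rewrite /d -natr1; move: d1; rewrite /D; lra.
(* This bounds the ratio of neighbouring binomial coefficients in the range from [pn / 4] to
   [5 n / 8], where both indices lie. *)
pose Y := 4 / p.
have Y1 : 1 <= Y by rewrite /Y ler_pdivlMr // mul1r; lra.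
have l1R : n%:R = 6 * h%:R + l1%:R :> R by rewrite {1}en natrD natrM.
have [r1 r2 r3 r4] := rs.
have E1 : m%:R <= s%:R + 6 * h%:R :> R.
  by rewrite -natrM -natrD ler_nat; move: r4 en; clear; lia.
have E2 : s%:R <= m%:R :> R by rewrite ler_nat.
have [m1 m2] := andP hm.
have hil : (hi <= l1)%N by rewrite -(ler_nat R); lra.
have shift t : (t <= a0')%N -> (a0' <= t + 6 * h)%N ->
    'C(l1, t)%:R <= Y ^+ d * 'C(l1, s)%:R.
  move=> ta at6.
  have t1 : t%:R <= p * n%:R :> R by apply: le_trans a1; rewrite ler_nat.
  have t2 : a0'%:R <= t%:R + 6 * h%:R :> R by rewrite -natrM -natrD ler_nat.
  rewrite -natr1 in a2.
  have dD : D = gamma * n%:R + 7 * (a * n%:R) by rewrite /D; ring.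
  apply: (@bin_shift R Y l1 lo hi s t d) => //.
  - apply: (@le_trans _ _ n%:R); first by rewrite l1R lerDr mulr_ge0.
    rewrite /Y mulrAC ler_pdivlMr // mulrC.
    by move: lo2; lra.
  - apply: (@le_trans _ _ n%:R); first by lra.
    rewrite /Y mulrAC ler_pdivlMr // mulrC.
    have : (l1 - hi).+1%:R = l1%:R - hi%:R + 1 :> R by rewrite -natr1 natrB.
    by move=> ->; lra.
  - apply/andP; split.
      by rewrite -(ler_nat R); apply: le_trans lo1 _; lra.
    rewrite truncn_ge_nat //; lra.
  - apply/andP; split.
      by rewrite -(ler_nat R); apply: le_trans lo1 _; lra.
    rewrite truncn_ge_nat //; lra.
  - by rewrite -(ler_nat R) natrD; apply: le_trans (_ : s%:R + D <= _); lra.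
  - by rewrite -(ler_nat R) natrD; apply: le_trans (_ : t%:R + D <= _); lra.
have B0 : 0 <= Y ^+ d * 'C(l1, s)%:R by rewrite mulr_ge0 ?exprn_ge0 // (le_trans _ Y1).
have an' : (a0' <= n)%N by rewrite -(ler_nat R); lra.
have V := @bin_vandermonde_le R n l1 a0' _ r2 B0 _ an'.
have {}V : 'C(n, a0')%:R <= n.+1%:R * expR (n - l1)%:R * (Y ^+ d * 'C(l1, s)%:R).
  apply: V => jj h1 h2; apply: shift; first exact: leq_subr.
  have : (n - l1 = 6 * h)%N by rewrite {1}en addnK.
  by move=> E; rewrite E in h1; move: h1 h2; clear; lia.
have Yd : Y ^+ d <= expR (eps / 8 * n%:R).
  apply: (@le_trans _ _ (expR Y ^+ d)).
    by rewrite lerXn2r ?nnegrE ?expR_ge0 ?le_expR // (le_trans _ Y1).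
  rewrite expR_natX ler_expR; apply: (@le_trans _ _ (Y * ((gamma + 8 * a) * n%:R))).
    by apply: ler_wpM2l => //; rewrite (le_trans _ Y1).
  rewrite mulrA; apply: ler_wpM2r; first exact: ltW.
  rewrite /Y mulrAC ler_pdivrMr //; lra.
have e6 : expR (n - l1)%:R <= expR (eps / 8 * n%:R).
  have -> : (n - l1 = 6 * h)%N by rewrite {1}en addnK.
  rewrite ler_expR natrM.
  have : a * n%:R <= eps / 1024 * n%:R.
    apply: ler_wpM2r; first exact: ltW.
    have : eps * p <= eps * 2^-1 by apply: ler_wpM2l => //; exact: ltW.
    lra.
  have : 0 <= eps * n%:R by rewrite mulr_ge0 ?ltW.
  lra.
have n2 := poly_le_expR ee ne.
apply: (@le_trans _ _ ('C(n, a0')%:R * expR (- (eps * n%:R)) * n.+1%:R * expR (eps / 2 * n%:R))).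
  apply: ler_wpM2r; first exact: expR_ge0.
  by apply: ler_pM => //; exact: ltW.
apply: (@le_trans _ _ (n.+1%:R * expR (n - l1)%:R * (Y ^+ d * 'C(l1, s)%:R) *
    expR (- (eps * n%:R)) * n.+1%:R * expR (eps / 2 * n%:R))).
  do 3 (apply: ler_wpM2r; first by rewrite ?expR_ge0 ?ler0n).
  exact: V.
have -> : n.+1%:R * expR (n - l1)%:R * (Y ^+ d * 'C(l1, s)%:R) *
    expR (- (eps * n%:R)) * n.+1%:R * expR (eps / 2 * n%:R) =
  (n.+1%:R ^+ 2 * (expR (n - l1)%:R * Y ^+ d)) *
    (expR (- (eps * n%:R)) * expR (eps / 2 * n%:R)) * 'C(l1, s)%:R by ring.
rewrite -[leRHS]mul1r; apply: ler_wpM2r; first exact: ler0n.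
apply: (@le_trans _ _ (expR (eps / 8 * n%:R) * (expR (eps / 8 * n%:R) * expR (eps / 8 * n%:R)) *
    (expR (- (eps * n%:R)) * expR (eps / 2 * n%:R)))).
  apply: ler_wpM2r; first by rewrite mulr_ge0 ?expR_ge0.
  apply: ler_pM; rewrite ?sqr_ge0 ?mulr_ge0 ?expR_ge0 ?exprn_ge0 ?(le_trans _ Y1) //.
  by apply: ler_pM; rewrite ?expR_ge0 ?exprn_ge0 ?(le_trans _ Y1).
rewrite -!expRD -[leRHS]expR0 ler_expR.
have : 0 <= eps * n%:R by rewrite mulr_ge0 ?ltW.
lra.
Qed.

End Numerics.

Section FailureBounds.
Variable R : realType.

Lemma three_le_expR2 : 3 <= expR 2 :> R.
Proof.
have -> : expR 2 = expR 1 ^+ 2 :> R by rewrite expR_natX mul1r.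
have h : (2 : R) <= expR 1 by apply: le_trans (expR_ge1Dx 1).
by rewrite expr2; nra.
Qed.

Lemma exp3_le k (x : R) : k%:R <= x -> 3 ^+ k <= expR (2 * x).
Proof.
move=> kx; apply: (@le_trans _ _ (expR 2 ^+ k)).
  by rewrite lerXn2r ?nnegrE ?expR_ge0 // three_le_expR2.
by rewrite expR_natX ler_expR ler_wpM2l.
Qed.

(** Each of the [k] factors gains [exp (- eps n / 4)], whereas [3 ^+ m0] loses at most
    [exp (2 n)]. *)
Lemma sup_phase_failure (M eps n T : R) m0 k :
  0 <= n -> m0%:R <= n -> expR (eps / 2 * n) <= T -> M + 8 <= eps * k%:R / 4 ->
  3 ^+ m0 * expR (eps / 4 * n) ^+ k / T ^+ k <= expR (- ((M + 5) * n)).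
Proof.
move=> n0 mn hT hk.
have T0 : 0 < T by apply: lt_le_trans hT; exact: expR_gt0.
rewrite ler_pdivrMr ?exprn_gt0 //.
apply: (@le_trans _ _ (expR (- ((M + 5) * n)) * expR (eps / 2 * n) ^+ k)); last first.
  by apply: ler_wpM2l; [exact: expR_ge0|apply: lerXn2r => //; rewrite nnegrE ?expR_ge0 // ltW].
apply: (@le_trans _ _ (expR (2 * n) * expR (eps / 4 * n) ^+ k)).
  by apply: ler_wpM2r; [rewrite exprn_ge0 ?expR_ge0|exact: exp3_le].
rewrite !expR_natX -!expRD ler_expR.
have : (M + 8) * n <= eps * k%:R / 4 * n by apply: ler_wpM2r.
lra.
Qed.

(** The ratio [x / y] of initial to target energy will depend on [M] but not on [n], so a large [n]
    dominates its power. *)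
Lemma energy_phase_failure (M a n w alpha kappa x y : R) h k :
  0 <= n -> 0 <= alpha -> 0 <= kappa <= 1 -> (1 - kappa) ^+ k <= alpha ->
  4 * alpha <= expR (- w) -> 0 <= w -> M + 6 <= w * a -> a * n <= h%:R ->
  0 <= x -> 0 < y -> (x / y) ^+ k <= n ->
  (2 * ((1 - kappa) ^+ k + alpha)) ^+ h * x ^+ k / y ^+ k <= expR (- ((M + 5) * n)).
Proof.
move=> n0 al0 /andP[k0 k1] hk ha w0 hw hn x0 y0 hxy.
rewrite -mulrA -expr_div_n.
have kk : 0 <= (1 - kappa) ^+ k by rewrite exprn_ge0 // subr_ge0.
apply: (@le_trans _ _ (expR (- w) ^+ h * expR n)).
  apply: ler_pM.
  - by rewrite exprn_ge0 // mulr_ge0 // addr_ge0.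
  - by rewrite exprn_ge0 // divr_ge0 // ltW.
  - by apply: lerXn2r; rewrite ?nnegrE ?expR_ge0 ?mulr_ge0 ?addr_ge0 //; lra.
  - by apply: le_trans hxy _; exact: le_expR.
rewrite expR_natX -expRD ler_expR.
have : w * (a * n) <= w * h%:R by apply: ler_wpM2l.
have : (M + 6) * n <= w * a * n by apply: ler_wpM2r.
lra.
Qed.

(** The height [S] of the first phase occurs only in the ratio [S / y], free of [n] and bounded
    through [B]. One factor [y^-1] is left over, because the mass was used once in place of [S]; it
    costs [H], which will be [N * sqrt n]. *)
Lemma final_phase_failure (M a n qq S y B H : R) h k :
  0 <= n -> 0 < qq <= 1 -> M + 12 <= qq * a * k.+1%:R -> a * n <= h%:R -> h%:R <= n ->
  0 <= S -> 0 < y -> 0 <= H -> H <= expR (2 * n) ->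
  (S / y) ^+ k / y <= H * B -> B <= n -> 0 <= B ->
  3 ^+ h * (S ^+ k * ((1 - qq) ^+ h) ^+ k.+1) / y ^+ k.+1 <= expR (- ((M + 5) * n)).
Proof.
move=> n0 /andP[q0 q1] hk hn hh S0 y0 H0 hH hS hB B0.
have -> : 3 ^+ h * (S ^+ k * ((1 - qq) ^+ h) ^+ k.+1) / y ^+ k.+1 =
    3 ^+ h * ((S / y) ^+ k / y) * ((1 - qq) ^+ h) ^+ k.+1.
  rewrite expr_div_n (exprSr y); have yn := lt0r_neq0 y0.
  have yk : y ^+ k != 0 by rewrite expf_neq0.
  move: yk; move: (y ^+ k) (((1 - qq) ^+ h) ^+ k.+1) => u v un.
  by field; rewrite yn un.
have q2 : 0 <= 1 - qq by rewrite subr_ge0.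
have hq : ((1 - qq) ^+ h) ^+ k.+1 <= expR (- ((M + 12) * n)).
  apply: (@le_trans _ _ ((expR (- qq) ^+ h) ^+ k.+1)).
    apply: lerXn2r; rewrite ?nnegrE ?exprn_ge0 ?expR_ge0 //.
    by apply: lerXn2r; rewrite ?nnegrE ?expR_ge0 ?expR_ge1Dx.
  rewrite !expR_natX ler_expR -!mulNr -subr_ge0.
  have : qq * k.+1%:R * (a * n) <= qq * k.+1%:R * h%:R.
    by apply: ler_wpM2l => //; rewrite mulr_ge0 ?ler0n // ltW.
  have : (M + 12) * n <= qq * a * k.+1%:R * n by apply: ler_wpM2r.
  lra.
apply: (@le_trans _ _ (expR (2 * n) * (expR (2 * n) * expR n) * expR (- ((M + 12) * n)))).
  apply: ler_pM => //.
  - rewrite mulr_ge0 ?exprn_ge0 // divr_ge0 ?exprn_ge0 ?divr_ge0 // ltW //.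
  - by rewrite !exprn_ge0.
  - apply: ler_pM; rewrite ?exprn_ge0 ?exp3_le //.
      by rewrite divr_ge0 ?exprn_ge0 ?divr_ge0 // ltW.
    apply: le_trans hS _; apply: ler_pM => //.
    exact: le_trans hB (le_expR _).
by rewrite -!expRD ler_expR; lra.
Qed.

Lemma failure_sum (M : R) n : (0 < n)%N ->
  n.+1%:R * expR (- ((M + 5) * n%:R)) + n.+1%:R * expR (- ((M + 5) * n%:R)) +
    expR (- ((M + 5) * n%:R)) <= expR (- (M * n%:R)).
Proof.
move=> n0; set E := expR (- ((M + 5) * n%:R)).
have n1 : 1 <= n%:R :> R by rewrite ler1n.
have E0 : 0 <= E by exact: expR_ge0.
apply: (@le_trans _ _ (3 * n.+1%:R * E)); first by rewrite -natr1; nra.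
apply: (@le_trans _ _ (expR (2 * n%:R) * expR n%:R * E)).
  apply: ler_wpM2r => //; apply: ler_pM => //.
    apply: le_trans three_le_expR2 _; rewrite ler_expR; lra.
  by rewrite -nat1r; exact: expR_ge1Dx.
rewrite /E -!expRD ler_expR; lra.
Qed.

End FailureBounds.

Section FiniteGroup.
Variable R : realType.

Lemma exists_natr_ge (x : R) : exists k : nat, (0 < k)%N /\ x <= k%:R.
Proof. by exists (Num.truncn x).+1; split => //; exact/ltW/truncnS_gt. Qed.

Lemma exists_contraction (kappa b : R) : 0 < kappa <= 1 -> 0 < b ->
  exists k, (1 - kappa) ^+ k <= b.
Proof.
move=> /andP[k0 k1] b0; have [k [_ hk]] := exists_natr_ge (- ln b / kappa).
exists k; apply: (@le_trans _ _ (expR (- kappa) ^+ k)).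
  by apply: lerXn2r; rewrite ?nnegrE ?expR_ge0 ?subr_ge0 ?expR_ge1Dx.
rewrite expR_natX -[b]lnK ?posrE // ler_expR.
move: hk; rewrite ler_pdivrMr //; lra.
Qed.

Lemma le_of_sum5 (x1 x2 x3 x4 x5 y : R) : 0 <= x1 -> 0 <= x2 -> 0 <= x3 -> 0 <= x4 ->
  0 <= x5 -> x1 + x2 + x3 + x4 + x5 <= y ->
  [/\ x1 <= y, x2 <= y, x3 <= y, x4 <= y & x5 <= y].
Proof. by move=> h1 h2 h3 h4 h5 h; split; lra. Qed.

Lemma le_natr_succ_of_sqr (q : R) n : q ^+ 2 = n%:R -> q <= n.+1%:R.
Proof. by rewrite -natr1 => <-; have := sqr_ge0 (q - 1); nra. Qed.

(** A quarter of [al] goes to the diagonal term [4 / j] and a quarter to each of the three errors of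
    [progression_fluct]. *)
Lemma leak_le (al th b N xi j r : R) : 0 < al -> 0 < th -> 0 < b -> 0 < N ->
  0 < j -> 0 < r -> 16 / al <= j -> 32 / (al * th) <= r -> xi <= al * b * th / (128 * N) ->
  4 / j + 8 * (8 * (1 + al * th / 256 - 1) + r^-1 + 4 * xi * N / b) / th <= al.
Proof.
move=> a0 t0 b0 N0 j0 r0 hj hr hx.
have at0 : 0 < al * th by exact: mulr_gt0.
have A1 : 4 / j <= al / 4.
  by rewrite ler_pdivrMr //; move: hj; rewrite ler_pdivrMr //; clear; lra.
have A2 : r^-1 <= al * th / 32.
  rewrite -div1r ler_pdivrMr //; move: hr; rewrite ler_pdivrMr //.
  by clear; set u := al * th; lra.
have A3 : 4 * xi * N / b <= al * th / 32.
  rewrite ler_pdivrMr //; move: hx; rewrite ler_pdivlMr ?mulr_gt0 //.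
  by clear; set u := xi * N; lra.
have -> : 1 + al * th / 256 - 1 = al * th / 256 by ring.
set X := 8 * _ + _ + _.
have A4 : X <= al * th * 3 / 32 by rewrite /X; move: A2 A3; clear; lra.
have A5 : 8 * X / th <= al * 3 / 4.
  by rewrite ler_pdivrMr //; move: A4; clear; lra.
by move: A1 A5; clear; lra.
Qed.

Lemma drop_budget (ka K Z t C q N : R) : 0 < q -> 0 < N ->
  ka * (4 * K) <= Z * (t * C) ->
  ka * (2 * (2 * (K / (N * q)))) <= Z * (t * (C / q) / N).
Proof.
move=> q0 N0 h.
have -> : ka * (2 * (2 * (K / (N * q)))) = ka * (4 * K) / (N * q).
  by field; rewrite !lt0r_neq0.
have -> : Z * (t * (C / q) / N) = Z * (t * C) / (N * q).
  by field; rewrite !lt0r_neq0.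
by apply: ler_wpM2r => //; rewrite invr_ge0 mulr_ge0 // ltW.
Qed.

Lemma hit_budget (k : nat) (C q N : R) : 0 < C -> 0 < q -> 0 < N ->
  2 ^+ k * (4 * (C / q) / N / (2 ^+ k * 8 * C / (N * q))) <= 2^-1.
Proof.
move=> C0 q0 N0; have t0 : 2 ^+ k != 0 :> R by rewrite expf_neq0 ?pnatr_eq0.
rewrite le_eqVlt; apply/orP; left; apply/eqP; move: t0; move: (2 ^+ k : R) => t t0.
by field; rewrite t0 !lt0r_neq0.
Qed.

Lemma threshold_ge (K q N C x : R) : 0 < q -> 0 < N -> 1 <= K -> 0 <= C ->
  N * q * x <= C -> x <= K / (N * q) * C.
Proof.
move=> q0 N0 K1 C0 h; have Nq : 0 < N * q by exact: mulr_gt0.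
rewrite mulrAC ler_pdivlMr // mulrC; apply: le_trans h _.
by rewrite ler_peMl.
Qed.

Lemma reach_sizes (p eps a gamma : R) (n m h : nat) :
  0 < p <= 2^-1 -> 0 < eps <= 1 -> 0 < a -> a <= eps * p / 512 ->
  0 < gamma -> gamma <= eps * p / 64 -> 2 / a <= n%:R -> h = Num.truncn (a * n%:R) ->
  p * n%:R - gamma * n%:R <= m%:R <= p * n%:R + gamma * n%:R ->
  [/\ h%:R <= a * n%:R, 1 <= a * n%:R, a * n%:R <= (h.*2)%:R, (h.*2)%:R <= n%:R :> R
     & (m <= n)%N] /\ (h.*2.+1)%:R <= eps / 4 * n%:R.
Proof.
move=> /andP[p0 p1] /andP[e0 e1] a0 ae g0 ge na he /andP[_ hm].
have an1 : 2 <= a * n%:R by rewrite mulrC -ler_pdivrMr.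
have n0 : 0 <= n%:R :> R by exact: ler0n.
have [hle hlt] := andP (truncn_itv (ltW (lt_le_trans (ltr0n R 2) an1))).
rewrite -he in hle hlt.
have h2R : (h.*2)%:R = 2 * h%:R :> R by rewrite -mul2n natrM.
have eppe : eps * p <= eps * 2^-1 by rewrite ler_pM2l.
have ann : a * n%:R <= eps / 1024 * n%:R.
  by apply: ler_wpM2r => //; apply: le_trans ae _; clear - eppe; lra.
have gn : gamma * n%:R <= eps / 128 * n%:R.
  by apply: ler_wpM2r => //; apply: le_trans ge _; clear - eppe; lra.
have pn : p * n%:R <= 2^-1 * n%:R by exact: ler_wpM2r.
have en : eps * n%:R <= 1 * n%:R by exact: ler_wpM2r.
have en0 : 0 <= eps * n%:R by rewrite mulr_ge0 // ltW.
move: hle hlt; rewrite -natr1 => hle hlt.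
clear - hle hlt an1 h2R ann gn pn en en0 hm.
split; last by rewrite -natr1 h2R; lra.
split; rewrite ?h2R; try lra.
by rewrite -(ler_nat R); lra.
Qed.

(** The quantifiers record the dependences. [lam] and [J], from which [eta] is computed, depend on
    [M] only among the late parameters; [xi] may also depend on [n] and [N], since it is made small
    by enlarging the group, which is chosen afterwards. *)
Lemma finite_group_bound (p eps amax : R) (Rr : nat) :
  0 < p <= 2^-1 -> 0 < eps <= 1 -> 0 < amax -> (0 < Rr)%N ->
  exists a gamma C0 : R, [/\ 0 < a <= amax, 0 < gamma < eps & 0 < C0] /\
  forall M, 1 <= M -> exists (n0 J : nat) (lam : R), (0 < n0)%N /\ 1 < lam /\
  forall n N : nat, (n0 <= n)%N -> (0 < N)%N ->
   N%:R <= 'C(n, Num.truncn (p * n%:R))%:R * expR (- (eps * n%:R)) ->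
  exists xi : R, 0 < xi <= C0 / (N%:R * Num.sqrt n%:R) /\
  forall (V : finZmodType) (e : V) (D : nat) (rho X : int) (f : V -> R)
    (Outer W Steps Main Z : seq (seq int)) (m : nat),
  let h := Num.truncn (a * n%:R) in
  (forall z : int, `|z| <= rho -> e *~ z = 0 -> z = 0) -> 0 <= X ->
  (X *+ h.*2 + D%:Z) *+ 2 <= rho -> (N <= Rr * D)%N ->
  (forall t, 0 <= f t) -> \sum_t f t <= 1 -> lip e J lam xi f ->
  (forall z, insupp Z z -> exists zs ex, z = zs ++ ex /\ block D h X zs) ->
  (forall w, insupp W w -> block D h X w) ->
  {in Main, forall A, spread R e N A} -> {in Outer, forall A, spread R e N A} ->
  {in Steps, forall A, exists x0 P, interval_seq A x0 P /\ (N <= P)%N} ->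
  size Outer = h.*2 -> size W = h.*2 -> size Steps = h.*2 -> size Z = h.*2.+1 ->
  (size Outer + size W + size Steps + size Main + size Z = n)%N ->
  p * n%:R - gamma * n%:R <= m%:R <= p * n%:R + gamma * n%:R ->
  pr R (Outer ++ W ++ Steps ++ Main ++ Z)
    (fun x => [exists t, 8 * C0 / (N%:R * Num.sqrt n%:R) * 'C(n, m)%:R
                         <= pushes e x (seed f) m t])
    <= expR (- (M * n%:R)).
Proof.
move=> pp ee am0 Rr0; have [p0 p1] := andP pp; have [e0 e1] := andP ee.
have ep0 : 0 < eps * p by exact: mulr_gt0.
pose a := Num.min amax (eps * p / 512).
have a0 : 0 < a by rewrite lt_min am0 divr_gt0.
have ae : a <= eps * p / 512 by rewrite ge_min lexx orbT.
pose gamma := eps * p / 64.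
have g0 : 0 < gamma by rewrite divr_gt0.
have eppe : eps * p <= eps * 2^-1 by rewrite ler_pM2l.
have epp : eps * p <= p by rewrite ler_piMl // ltW.
have ap : a <= p / 512 by apply: le_trans ae _; rewrite ler_pM2r ?invr_gt0 ?ltr0n.
have gp : gamma <= p / 64 by rewrite ler_pM2r ?invr_gt0 ?ltr0n.
(* The first entry makes edge slices small enough for [bin_edge_le]; the second keeps all reachable
   slices away from the edge. *)
pose c1 := Num.min (eps ^+ 2 / 64) (p / 4).
have c10 : 0 < c1 by rewrite lt_min !divr_gt0 ?exprn_gt0.
have c1e : c1 <= eps ^+ 2 / 64 by rewrite ge_min lexx.
have c1p : c1 <= p / 4 by rewrite ge_min lexx orbT.
pose C0 := LOconst Rr c1 a.
have C00 : 0 < C0.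
  have := @beta_gt0 R Rr c1 a 1 Rr0 c10 a0 ltr01.
  by rewrite /beta divr1.
have C01 : 1 <= C0.
  have c11 : c1 <= 8^-1 by apply: le_trans c1p _; lra.
  have a1 : a <= 1 by apply: le_trans ap _; lra.
  have ca : c1 * a <= 1.
    apply: (@le_trans _ _ (8^-1 * 1)); last by lra.
    by apply: ler_pM => //; exact: ltW.
  have r1 : 1 <= Rr%:R :> R by rewrite ler1n.
  have : 16 <= 16 / (c1 * a).
    by rewrite ler_pdivlMr ?mulr_gt0 // ler_piMr.
  rewrite /C0 /LOconst => h; rewrite -[leLHS]mulr1.
  by apply: ler_pM => //; lra.
exists a, gamma, C0; split.
  split => //; first by rewrite a0 ge_min lexx.
  by rewrite g0 /gamma /=; lra.
move=> M M1.
have [k1 [k10 hk1]] := exists_natr_ge (4 * (M + 8) / eps).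
have {}hk1 : M + 8 <= eps * k1%:R / 4.
  by move: hk1; rewrite ler_pdivrMr //; lra.
(* The height of the first phase in units of [(N * sqrt n)^-1]: there [2 ^+ k1] times the hitting
   probability is 1/2. *)
pose Kb := 2 ^+ k1 * 8 * C0.
have tk1 : 1 <= 2 ^+ k1 :> R by rewrite exprn_ege1 // ler1n.
have Kb1 : 1 <= Kb.
  by rewrite /Kb -[leLHS]mulr1; apply: ler_pM => //; lra.
have Kb0 : 0 < Kb by apply: lt_le_trans Kb1.
pose qq := p / 2.
have qq0 : 0 < qq by rewrite divr_gt0.
have qq1 : qq <= 1 by rewrite /qq; lra.
have qa0 : 0 < qq * a by exact: mulr_gt0.
(* With [k3 = k'.+1] the gain [(1 - qq) ^+ (2 h k3)] of the final phase is at most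
   [exp (- (M + 12) n)]. *)
have [k' [_ hk']] := exists_natr_ge ((M + 12) / (qq * a)).
have {}hk' : M + 12 <= qq * a * k'.+1%:R.
  move: hk'; rewrite ler_pdivrMr // [leRHS]mulrC => h; apply: le_trans h _.
  by apply: ler_wpM2l; [exact: ltW|rewrite ler_nat].
pose k3 := k'.+1.
(* The excess will have mass at most [2 * theta0], so the final hitting probability is at most
   [4 * theta0]; times [2 ^+ k3] this makes 1/2. *)
pose theta0 : R := 2 ^- (k3 + 3).
have th0 : 0 < theta0 by rewrite invr_gt0 exprn_gt0.
pose w := (M + 6) / a.
have w0 : 0 <= w by rewrite divr_ge0 ?ltW // addr_gt0 // (lt_le_trans _ M1).
(* Over at least [a n] steps the factor [4 * alpha] accumulates to [exp (- (M + 6) n)] or less. *)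
pose alpha := expR (- w) / 4.
have al0 : 0 < alpha by rewrite divr_gt0 ?expR_gt0.
have al1 : alpha <= 1.
  have : expR (- w) <= 1 by rewrite -expR0 ler_expR oppr_le0.
  by rewrite /alpha; lra.
have th1 : theta0 <= 1.
  by rewrite invf_le1 ?exprn_gt0 // exprn_ege1 // ler1n.
have at0 : 0 < alpha * theta0 by exact: mulr_gt0.
have [j [j0 hj]] := exists_natr_ge (16 / alpha).
have [r [r0 hr]] := exists_natr_ge (32 / (alpha * theta0)).
pose lam := 1 + alpha * theta0 / 256.
have lam1 : 1 < lam by rewrite ltrDl divr_gt0.
have lam2 : lam <= 2.
  have : alpha * theta0 <= 1 * 1 by apply: ler_pM => //; exact: ltW.
  by rewrite /lam; lra.
have jr0 : 0 < (j * r)%:R :> R by rewrite ltr0n muln_gt0 j0.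
pose iota : R := (16 * (j * r)%:R ^+ 2)^-1.
have io0 : 0 < iota by rewrite invr_gt0 mulr_gt0 // exprn_gt0.
(* The second entry is the relative drop guaranteed by a good step: the energy may start as high as
   [4 * Kb] units, so [kappa] depends on [M], which the moment [k2] repairs. *)
pose kappa := Num.min qq (qq ^+ 2 * iota * (theta0 * C0) / (4 * Kb)).
have ka0 : 0 < kappa.
  rewrite lt_min qq0 /=; apply: divr_gt0; last exact: mulr_gt0.
  by apply: mulr_gt0; [apply: mulr_gt0 => //; exact: exprn_gt0|exact: mulr_gt0].
have kaq : kappa <= qq by rewrite ge_min lexx.
have kaE : kappa * (4 * Kb) <= qq ^+ 2 * iota * (theta0 * C0).
  rewrite -ler_pdivlMr; first by rewrite ge_min lexx orbT.
  exact: mulr_gt0.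
have ka1 : kappa <= 1 by exact: le_trans kaq qq1.
have ka01 : 0 < kappa <= 1 by rewrite ka0.
have [k2 hk2] := exists_contraction ka01 al0.
pose L2 := (4 * Kb / (theta0 * C0)) ^+ k2.
have L20 : 0 <= L2.
  by apply: exprn_ge0; apply: ltW; apply: divr_gt0; exact: mulr_gt0.
pose B := (Kb / (2 * C0)) ^+ k' / (4 * C0).
have B0 : 0 <= B.
  apply: ltW; apply: divr_gt0; last exact: mulr_gt0.
  by apply: exprn_gt0; apply: divr_gt0 => //; exact: mulr_gt0.
(* [L2] and [B] collect the [M]-dependent ratios of heights that [n] has to dominate in the last two
   phases. *)
have [n0 [n00 hn0]] := exists_natr_ge (2 / a + 2048 / eps ^+ 2 + 8 / p + L2 + B).
exists n0, (j * r)%N, lam; do 2 split => //.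
move=> n N n0n N0 HN.
have {}hn0 : 2 / a + 2048 / eps ^+ 2 + 8 / p + L2 + B <= n%:R.
  by apply: le_trans hn0 _; rewrite ler_nat.
have p_1 : 0 <= 2 / a by rewrite divr_ge0 // ltW.
have p_2 : 0 <= 2048 / eps ^+ 2 by rewrite divr_ge0 // exprn_ge0 // ltW.
have p_3 : 0 <= 8 / p by rewrite divr_ge0 // ltW.
have [n_1 n_2 n_3 n_4 n_5] := le_of_sum5 p_1 p_2 p_3 L20 B0 hn0.
clear hn0.
have npos : (0 < n)%N by exact: leq_trans n0n.
have nR : 0 < n%:R :> R by rewrite ltr0n.
have NR : 0 < N%:R :> R by rewrite ltr0n.
pose q : R := Num.sqrt n%:R.
have q0 : 0 < q by rewrite sqrtr_gt0.
have qn : q ^+ 2 = n%:R by rewrite sqr_sqrtr // ltW.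
have qle : q <= n.+1%:R by exact: le_natr_succ_of_sqr.
have Nq0 : 0 < N%:R * q by exact: mulr_gt0.
(* The first entry meets the budget of [leak_le]; the second makes the truncation cost at most one
   unit of the final height. *)
pose xi := Num.min (alpha * (C0 / q) * theta0 / (128 * N%:R)) (C0 / (N%:R * q)).
have xi0 : 0 < xi.
  rewrite lt_min (divr_gt0 C00 Nq0) andbT; apply: divr_gt0; last exact: mulr_gt0.
  by apply: mulr_gt0 => //; apply: mulr_gt0 => //; exact: divr_gt0.
exists xi; split; first by rewrite xi0 ge_min lexx orbT.
move=> V e D rho X f Outer W Steps Main Z m h inj X0 hrho ND f0 f1 fl sZ sW sMain sOuter sSteps
  zO zW zS zZ zn hm.
have [[hle an1 h2n hn2 mn] h2e] :=
  @reach_sizes p eps a gamma n m h pp ee a0 ae g0 (lexx _) n_1 erefl hm.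
pose l1 := (size Main + size Z)%N.
pose l2 := (size Steps + l1)%N.
have en : (size Outer + h.*2 + l2)%N = n.
  by rewrite /l2 /l1 -[in RHS]zn zW !addnA.
have en6 : (n = 6 * h + l1)%N.
  by rewrite -en zO /l2 zS; clear; lia.
have bulk l s := @reach_bulk R p a gamma c1 n m l1 l s h pp a0 ap g0 gp c1p npos en6 hle hm.
pose tau1 := Kb / (N%:R * q).
have t10 : 0 < tau1 by rewrite divr_gt0.
have q_n := lt0r_neq0 q0; have N_n := lt0r_neq0 NR; have C_n := lt0r_neq0 C00.
have th_n := lt0r_neq0 th0; have K_n := lt0r_neq0 Kb0.
pose E := expR (- ((M + 5) * n%:R)).
have Edge l s : (l <= n)%N -> s%:R < c1 * n%:R \/ l%:R - s%:R < c1 * n%:R ->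
  'C(l, s)%:R ^+ k1 <= expR (eps / 4 * n%:R) ^+ k1.
  move=> ln hs; apply: lerXn2r; rewrite ?nnegrE ?expR_ge0 ?ler0n //.
  exact: bin_edge_le hs.
have szM : ((size Main)%:R : R) <= n%:R.
  rewrite ler_nat; apply: leq_trans (_ : l1 <= n)%N; first exact: leq_addr.
  by rewrite {1}en6 leq_addl.
have NqE : N%:R * q <= expR (2 * n%:R).
  have -> : 2 * n%:R = n%:R + n%:R :> R by rewrite mulr_natl mulr2n.
  rewrite expRD; apply: ler_pM; [exact: ltW|exact: ltW| |].
    apply: le_trans HN _; rewrite -[leRHS]mulr1; apply: ler_pM => //.
    - exact: expR_ge0.
    - exact: bin_le_exp2.
    - by rewrite -[leRHS]expR0 ler_expR oppr_le0 mulr_ge0 // ltW.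
  by apply: le_trans qle _; rewrite -nat1r; exact: expR_ge1Dx.
have comb := @three_phase_bound R V e N D Rr h rho X c1 a q n%:R f N0 inj X0 hrho ND Rr0 c10 a0 q0 qn
  _ f0 f1 Outer W Steps Main Z n m l1 l2 sZ sW sMain sOuter sSteps erefl erefl en mn
  tau1 qq lam xi theta0 iota alpha kappa (expR (eps / 4 * n%:R) ^+ k1)
  ((1 - qq) ^+ h.*2) E E j r k1 k2 k3.
have E8 : 8 * C0 / (N%:R * q) = 4 * (2 * (C0 / q) / N%:R).
  by clear -q_n N_n; field; rewrite q_n N_n.
rewrite -/q E8; apply: le_trans (comb _ _ _ _ k10 t10 _ _ _ _ _ _ (ltW xi0) j0 r0 th0
  (ltW io0) _ _ _ kaq _ fl _ _ (ltn0Sn _) _ _ _) _; clear comb.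
- by apply: le_trans h2n _; rewrite ler_nat.
- by rewrite -natrM ler_nat mul2n -addnn -addn1 leq_add2l.
- exact: qq0.
- by move=> l s rs; have [] := bulk l s rs.
- exact: hit_budget.
- move=> s; apply: lerXn2r; rewrite ?nnegrE ?expR_ge0 ?ler0n //.
  by apply: le_trans (bin_le_exp2 R _ _) _; rewrite ler_expR zZ.
- exact: Edge.
- exact: expR_ge0.
- move=> s rs; apply: sup_phase_failure => //; apply: threshold_ge => //.
  exact: (@bin_lower R p a gamma eps n m l1 s h N q pp ee a0 ae g0 (lexx _) npos en6 hle an1 hm
    n_2 n_3 q0 qle HN rs).
- by rewrite (ltW lam1) lam2.
- rewrite /iota -mulrA mulrCA mulVf //.
  by apply: lt0r_neq0; apply: mulr_gt0 => //; exact: exprn_gt0.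
- apply: leak_le => //; rewrite ?ltr0n //; first exact: divr_gt0.
  by rewrite ge_min lexx.
- by rewrite ka1 ltW.
- exact: drop_budget.
- exact: expR_ge0.
- rewrite zS; apply: (@energy_phase_failure R M a n%:R w) => //.
  + exact: ltW.
  + by rewrite ltW.
  + by rewrite /alpha mulrC divfK ?pnatr_eq0.
  + by rewrite /w divfK // lt0r_neq0.
  + by apply: mulr_ge0 => //; apply: mulr_ge0 => //; exact: ltW.
  + by apply: divr_gt0 => //; apply: mulr_gt0 => //; exact: divr_gt0.
  + apply: le_trans n_4; rewrite le_eqVlt; apply/orP; left; apply/eqP.
    rewrite /L2; congr (_ ^+ k2); rewrite /tau1 /beta -/C0.
    by clear -q_n N_n C_n th_n; field; rewrite q_n N_n C_n th_n.
- rewrite /theta0; have t0 : 2 ^+ k3 != 0 :> R by rewrite expf_neq0 ?pnatr_eq0.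
  rewrite exprD; move: t0; move: (2 ^+ k3 : R) => t t0; clear -t0.
  rewrite le_eqVlt; apply/orP; left; apply/eqP; field; by rewrite t0.
- by rewrite exprn_ge0 // subr_ge0.
- move=> s rs; have E2 : (n - (h.*2 + l2) = h.*2)%N.
    by rewrite -en zO -addnA addnK.
  rewrite -[X in _ ^+ X]E2.
  apply: (@bin_descent R qq n m (h.*2 + l2) s (reach n m l1)) => //.
  + move=> l s' [r1 r2 r3 r4] ln.
    have [c|c] := leqP m (s' + (n - l.+1)).
      by left; split => //; exact: leqW.
    right; split => //; [exact: leqW| |]; move: r1 r2 r3 r4 ln c; clear; lia.
  + move=> l s' rs'; have [[/andP[_ sl] _ _ b1 b2] _] := bulk _ _ rs'.
    by split; [exact: ltnW|].
  + by move=> s' [_ _ r3 r4]; apply/eqP; rewrite eqn_leq r3 /=; rewrite subnn addn0 in r4.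
  + by rewrite -en -addnA leq_addl.
rewrite -/(E).
apply: le_trans (failure_sum M npos); rewrite -/E.
rewrite lerD2l zO; apply: (@final_phase_failure R M a n%:R qq _ _ B (N%:R * q)) => //.
- by rewrite qq0.
- by rewrite mulr_ge0 // ltW.
- by apply: mulr_gt0 => //; apply: divr_gt0 => //; apply: mulr_gt0 => //; exact: divr_gt0.
- exact: ltW.
rewrite le_eqVlt; apply/orP; left; apply/eqP; rewrite /B /tau1 /beta -/C0.
have -> : 2 * (Kb / (N%:R * q)) / (2 * (2 * (C0 / q) / N%:R)) = Kb / (2 * C0).
  by clear -q_n N_n C_n; field; rewrite q_n N_n C_n.
move: ((Kb / (2 * C0)) ^+ k') => u.
by clear -q_n N_n C_n; field; rewrite q_n N_n C_n.
Qed.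

End FiniteGroup.

(** * From the integers to a finite cyclic group *)

Lemma prob_pr (R : realType) (A : nat -> {fset int}) n E :
  prob R A n E = pr R [seq enum_fset (A i) | i <- iota 1 n] E.
Proof.
rewrite /prob /samples /pr; elim: (iota 1 n) E => [|i s IH] E /=.
  by rewrite addn0 divr1.
rewrite size_allpairs natrM -sum1_count big_mkcond /= big_allpairs_dep /=.
rewrite /avg natr_sum invfM mulrA mulrAC; congr (_ / _).
rewrite mulr_suml; apply: eq_bigr => x _; rewrite -(IH (fun y => E (x :: y))).
by rewrite -sum1_count [in RHS]big_mkcond.
Qed.

Definition ffun_cons l (bv : bool * {ffun 'I_l -> bool}) : {ffun 'I_l.+1 -> bool} :=
  [ffun j => if unlift ord0 j is Some j' then bv.2 j' else bv.1].

Lemma ffun_cons_bij l : bijective (@ffun_cons l).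
Proof.
exists (fun v : {ffun 'I_l.+1 -> bool} => (v ord0, [ffun j : 'I_l => v (lift ord0 j)])).
  move=> [b v]; congr (_, _); first by rewrite ffunE unlift_none.
  by apply/ffunP => j; rewrite !ffunE liftK.
move=> v; apply/ffunP => j; rewrite !ffunE /=.
by case: unliftP => [j' ->|->]; rewrite ?ffunE.
Qed.

Lemma ffun_cons0 l (bv : bool * {ffun 'I_l -> bool}) : ffun_cons bv ord0 = bv.1.
Proof. by rewrite ffunE unlift_none. Qed.

Lemma ffun_consS l (bv : bool * {ffun 'I_l -> bool}) j :
  ffun_cons bv (lift ord0 j) = bv.2 j.
Proof. by rewrite ffunE liftK. Qed.

Lemma pushes_ffun (R : realFieldType) (f : int -> R) x s t :
  pushes (1 : int) x (seed f) s t =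
  \sum_(v : {ffun 'I_(size x) -> bool} | (\sum_(j < size x) nat_of_bool (v j))%N == s)
     f (t + \sum_(j < size x) (nat_of_bool (v j))%:Z * nth 0 x j).
Proof.
elim: x s t => [|x xs IH] s t /=.
  under eq_bigl => v do rewrite big_ord0.
  under eq_bigr => v _ do rewrite big_ord0 addr0.
  rewrite /seed eq_sym; case: eqP => _; last by rewrite big_pred0.
  by rewrite sumr_const cardT -cardE card_ffun card_ord expn0.
have sumE (b : bool) (v : {ffun 'I_(size xs) -> bool}) :
    (\sum_(j < (size xs).+1) nat_of_bool (ffun_cons (b, v) j) =
     b + \sum_(j < size xs) nat_of_bool (v j))%N.
  by rewrite big_ord_recl ffun_cons0; under eq_bigr => j _ do rewrite ffun_consS.
have dotE (b : bool) (v : {ffun 'I_(size xs) -> bool}) :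
    \sum_(j < (size xs).+1) (nat_of_bool (ffun_cons (b, v) j))%:Z * nth 0 (x :: xs) j =
    b%:Z * x + \sum_(j < size xs) (nat_of_bool (v j))%:Z * nth 0 xs j.
  by rewrite big_ord_recl ffun_cons0; under eq_bigr => j _ do rewrite ffun_consS.
rewrite (reindex (@ffun_cons (size xs))) /=; last exact/onW_bij/ffun_cons_bij.
rewrite (eq_bigl (fun bv : bool * {ffun 'I_(size xs) -> bool} => xpredT bv.1 &&
   (bv.1 + \sum_(j < size xs) nat_of_bool (bv.2 j) == s)%N)); last first.
  by move=> [b v]; rewrite sumE.
rewrite (eq_bigr (fun bv : bool * {ffun 'I_(size xs) -> bool} =>
   f (t + (bv.1%:Z * x + \sum_(j < size xs) (nat_of_bool (bv.2 j))%:Z * nth 0 xs j)))); last first.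
  by move=> [b v] _; rewrite -dotE.
rewrite -(pair_big_dep xpredT
  (fun (b : bool) (v : {ffun 'I_(size xs) -> bool}) => (b + \sum_(j < size xs) nat_of_bool (v j) == s)%N)
  (fun (b : bool) (v : {ffun 'I_(size xs) -> bool}) =>
     f (t + (b%:Z * x + \sum_(j < size xs) (nat_of_bool (v j))%:Z * nth 0 xs j)))) /=.
rewrite big_bool /= addrC /push; congr (_ + _).
  by rewrite IH; apply: eq_bigr => v _; rewrite mul0r add0r.
case: s => [|s]; first by rewrite big_pred0.
rewrite IH; apply: eq_big => [v|v _]; first by rewrite add1n eqSS.
by rewrite mul1r -!addrA intz.
Qed.

Lemma ravg_pushes (R : realType) (f : int -> R) x m n t : size x = n ->
  ravg f x m n t = ('C(n, m)%:R)^-1 * pushes (1 : int) x (seed f) m t.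
Proof. by move=> <-; rewrite /ravg pushes_ffun. Qed.

Section Truncation.
Variables (R : realType) (f : int -> R).
Hypotheses (f0 : forall t, 0 <= f t) (fl1 : in_l1 f) (fn : l1norm f = 1).

Lemma l1_sum_le (s : seq int) : uniq s -> \sum_(z <- s) f z <= 1.
Proof.
move=> us; rewrite -lee_fin -sumEFin.
suff <- : (\esum_(z in [set: int]) (`|f z|)%:E)%E = 1%:E.
  apply: esum_ge; exists [set` s]%classic; first by split => //; exact: finite_seq.
  rewrite -fsbig_seq //= le_eqVlt; apply/orP; left; apply/eqP.
  by apply: eq_bigr => z _; rewrite ger0_norm.
rewrite -fn /l1norm fineK // ge0_fin_numE; first exact: fl1.
by apply: esum_ge0 => z _; rewrite lee_fin.
Qed.

(** Otherwise arbitrarily many distinct integers, each beyond all the earlier ones, would have [f]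
    above [xi], against the total mass 1. *)
Lemma l1_small_outside (xi : R) : 0 < xi ->
  exists B : nat, forall z : int, B%:Z <= `|z| -> f z <= xi.
Proof.
move=> xi0; apply: contrapT => nB.
have H (k : nat) : exists s : seq int, [/\ uniq s, size s = k & all (fun z => xi < f z) s].
  elim: k => [|k [s [us ss sx]]]; first by exists [::].
  have [z [zb fz]] : exists z : int, (\sum_(y <- s) `|y|%N).+1%:Z <= `|z| /\ xi < f z.
    apply: contrapT => nz; apply: nB; exists (\sum_(y <- s) `|y|%N).+1 => z zb.
    by rewrite leNgt; apply/negP => fz; apply: nz; exists z.
  exists (z :: s); split => /=; rewrite ?ss ?fz ?us ?andbT //.
  apply/negP => zs; move: zb; rewrite (big_rem z zs) /= -abszE; lia.
have [s [us ss sx]] := H (Num.truncn xi^-1).+1.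
have := l1_sum_le us; apply/negP; rewrite -ltNge.
apply: (@lt_le_trans _ _ (xi * (size s)%:R)).
  by rewrite mulrC -ltr_pdivrMr // mul1r ss; exact: truncnS_gt.
rewrite mulr_natr -iter_addr_0 -(count_predT s) -big_const_seq !big_seq.
by apply: ler_sum => z zs; exact/ltW/(allP sx).
Qed.

(** Residues are represented in [[-K, K]]. A shift by at most [J] crosses the seam only from a point
    beyond [K - J], where [f] is at most [xi]. Including [rho] in [K] prevents short multiples of
    the generator from wrapping around. *)
Lemma cyclic_truncation (lam xi : R) (J : nat) (rho : int) : 0 < xi -> 0 <= lam ->
  (forall t i : int, `|i| <= J%:Z -> f t <= lam * f (t + i)) ->
  exists (V : finZmodType) (e : V) (g : V -> R) (phi : int -> V),
  [/\ forall z : int, `|z| <= rho -> e *~ z = 0 -> z = 0,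
     forall t, 0 <= g t, \sum_t g t <= 1, lip e J lam xi g &
     (forall z w, phi (z + w) = phi z + e *~ w) /\ (forall z, f z <= g (phi z) + xi)].
Proof.
move=> xi0 lam0 fl; have [B fB] := l1_small_outside xi0.
pose K := (B + J + `|rho| + 1)%N; pose Q := K.*2.+1.
have Q1 : (1 < Q)%N by rewrite /Q /K; lia.
have QE : (Zp_trunc Q).+2 = Q by exact: Zp_cast.
pose phi (z : int) : 'Z_Q := (z + K%:Z)%:~R.
pose g (c : 'Z_Q) := f ((c : nat)%:Z - K%:Z).
have cQ (c : 'Z_Q) : (c < Q)%N by rewrite -[X in (_ < X)%N]QE ltn_ord.
have phig (z : int) : `|z| <= K%:Z -> g (phi z) = f z.
  move=> zK; have [k kE] : exists k : nat, z + K%:Z = k%:Z.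
    by exists (absz (z + K%:Z)); rewrite gez0_abs //; lia.
  rewrite /g /phi kE -pmulrn val_Zp_nat // modn_small; last by rewrite /Q; lia.
  by rewrite -kE addrK.
have phiD z w : phi (z + w) = phi z + 1 *~ w by rewrite /phi addrAC rmorphD.
have gphi (c : 'Z_Q) : c = phi ((c : nat)%:Z - K%:Z).
  by rewrite /phi subrK -pmulrn natr_Zp.
have gK (c : 'Z_Q) : `|(c : nat)%:Z - K%:Z| <= K%:Z.
  by have := cQ c; rewrite /Q; lia.
have small (z : int) : K%:Z - J%:Z <= `|z| -> f z <= xi.
  by move=> h; apply: fB; move: h; rewrite /K; lia.
exists 'Z_Q, 1, g, phi; split.
- move=> z zr; suff H (k : nat) : (k <= K)%N -> k%:R = 0 :> 'Z_Q -> k = 0%N.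
    case: z zr => k kr; first by rewrite -pmulrn => /H ->//; rewrite /K; lia.
    rewrite NegzE mulrNz => /eqP; rewrite oppr_eq0 => /eqP.
    by rewrite -pmulrn => /H; rewrite /K => h; exfalso; lia.
  move=> kK /(congr1 val) /=; rewrite val_Zp_nat // modn_small //.
  by rewrite /Q; lia.
- by move=> t; exact: f0.
- rewrite -(big_map (fun c : 'Z_Q => (c : nat)%:Z - K%:Z) xpredT f).
  apply: l1_sum_le; rewrite map_inj_uniq; first exact: index_enum_uniq.
  by move=> c d /addIr [] /val_inj.
- move=> c i iJ; set w := (c : nat)%:Z - K%:Z.
  have fx : 0 <= lam * g (c + 1 *~ i) by apply: mulr_ge0 => //; exact: f0.
  have [wi|wi] := leP `|w + i| K%:Z; last first.
    apply: (@le_trans _ _ xi); last by rewrite lerDr.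
    by apply: small; rewrite -/w; lia.
  apply: (@le_trans _ _ (lam * g (c + 1 *~ i))); last by rewrite lerDl ltW.
  rewrite [X in g (X + _)]gphi -phiD phig //; exact: fl.
- split => // z; have [zK|zK] := leP `|z| K%:Z; first by rewrite phig // lerDl ltW.
  apply: (@le_trans _ _ xi); last by rewrite lerDr; exact: f0.
  by apply: small; lia.
Qed.

End Truncation.

Lemma pushes_transfer (R : realType) (V : finZmodType) (e : V) (phi : int -> V)
    (f : int -> R) (g : V -> R) xi x s t :
  (forall z w, phi (z + w) = phi z + e *~ w) -> (forall z, f z <= g (phi z) + xi) ->
  0 <= xi ->
  pushes (1 : int) x (seed f) s t <=
  pushes e x (seed g) s (phi t) + xi * 'C(size x, s)%:R.
Proof.
move=> phiD fg xi0; elim: x s t => [|x xs IH] [|s] t /=.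
- by rewrite bin0 mulr1.
- by rewrite bin0n mulr0 addr0 /seed.
- by rewrite /push !addr0 bin0 -(bin0 (size xs)); exact: IH.
rewrite /push binS natrD mulrDr addrACA; apply: lerD; first exact: IH.
by rewrite intz -phiD; exact: IH.
Qed.

Lemma int_interval_seq (S : {fset int}) : int_interval S ->
  exists x0, interval_seq (enum_fset S) x0 #|` S|.
Proof.
move=> [a [b Sab]]; pose P := if a <= b then absz (b - a + 1) else 0%N.
have SP : interval_seq (enum_fset S) a P.
  apply: uniq_perm; first exact: fset_uniq.
    by rewrite map_inj_uniq ?iota_uniq // => y z /addrI [].
  move=> x; have -> : (x \in enum_fset S) = (x \in S) by [].
  rewrite Sab; apply/idP/mapP => [/andP[ax xb]|[y]].
    exists (absz (x - a)); last by lia.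
    by rewrite mem_iota /P (le_trans ax xb); lia.
  by rewrite mem_iota /P => /andP[_]; case: ifP; lia.
by exists a; rewrite -[#|` S|]/(size (enum_fset S)) (size_interval_seq SP).
Qed.

(** * Spread and separation of the factors of an admissible set *)

Section Spread.
Variables (R : realFieldType) (V : finZmodType) (e : V) (N : nat).
Hypothesis N0 : (0 < N)%N.

Lemma winb_interval (g : V -> R) b a P : (forall t, 0 <= g t) -> winb e N g b ->
  \sum_(y < P) g (a + e *~ y%:Z) <= (P%:R / N%:R + 1) * b.
Proof.
move=> g0 gb; have Nr : 0 < N%:R :> R by rewrite ltr0n.
have b0 : 0 <= b by apply: le_trans (gb 0); apply: sumr_ge0.
apply: (@le_trans _ _ (\sum_(y < (P %/ N).+1 * N) g (a + e *~ y%:Z))).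
  apply: (@sum_ord_le R (fun y => g (a + e *~ y%:Z))) => //.
  by rewrite ltnW // ltn_ceil.
rewrite (@big_ord_mul R (fun y => g (a + e *~ y%:Z))).
apply: (@le_trans _ _ (\sum_(j < (P %/ N).+1) b)).
  apply: ler_sum => j _; apply: le_trans (gb (a + e *~ (j * N)%N%:Z)).
  by apply: ler_sum => i _; rewrite PoszD mulrzDr addrA.
rewrite sumr_const card_ord -(mulr_natl b) ler_wpM2r // -natr1 lerD2r.
by rewrite ler_pdivlMr // -natrM ler_nat leq_divM.
Qed.

Lemma interval_sum_le A x0 P (g : V -> R) b t : interval_seq A x0 P ->
  (forall t, 0 <= g t) -> winb e N g b ->
  \sum_(x <- A) g (t + e *~ x) <= (P%:R / N%:R + 1) * b /\
  \sum_(x <- A) g (t - e *~ x) <= (P%:R / N%:R + 1) * b.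
Proof.
move=> AP g0 gb; split; rewrite (sum_interval_seq _ AP).
  apply: le_trans (winb_interval (t + e *~ x0) P g0 gb).
  by apply: ler_sum => y _; rewrite mulrzDr addrA.
apply: le_trans (winb_interval (t - e *~ (x0 + P%:Z - 1)) P g0 gb).
rewrite (reindex_inj rev_ord_inj) /=; apply: ler_sum => y _.
rewrite -addrA -!mulrNz -mulrzDr.
have -> // : - (x0 + (P - y.+1)%N%:Z) = - (x0 + P%:Z - 1) + y%:Z.
by have := ltn_ord y; lia.
Qed.

(** An interval of length [P] is covered by at most [P / N + 1] windows. The two extra windows at
    most double the bound, since [2 N <= P1 + P2], and the overlap of the intervals doubles it
    again: hence the 4. A single interval is the case [I1 = I2]. *)
Lemma spread_cover A I1 I2 x1 P1 x2 P2 :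
  interval_seq I1 x1 P1 -> interval_seq I2 x2 P2 ->
  (forall F : int -> R, (forall x, 0 <= F x) ->
     \sum_(x <- A) F x <= \sum_(x <- I1) F x + \sum_(x <- I2) F x) ->
  (P1 + P2 <= 2 * size A)%N -> (2 * N <= P1 + P2)%N -> spread R e N A.
Proof.
move=> I1P I2P cov PA NP g b g0 gb t.
have Nr : 0 < N%:R :> R by rewrite ltr0n.
have b0 : 0 <= b by apply: le_trans (gb 0); apply: sumr_ge0.
have Ar : 0 < (size A)%:R :> R by rewrite ltr0n; lia.
have key s : s <= (P1%:R / N%:R + 1) * b + (P2%:R / N%:R + 1) * b ->
    s / (size A)%:R <= 4 * b / N%:R.
  move=> sle; rewrite ler_pdivrMr //; apply: le_trans sle _.
  have h1 : (P1%:R + P2%:R : R) <= 2 * (size A)%:R by rewrite -natrD -natrM ler_nat.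
  have h2 : (2 * N%:R : R) <= P1%:R + P2%:R by rewrite -natrD -natrM ler_nat.
  have -> : (P1%:R / N%:R + 1) * b + (P2%:R / N%:R + 1) * b =
      (P1%:R + P2%:R + 2 * N%:R) * (b / N%:R) by field; rewrite lt0r_neq0.
  have -> : 4 * b / N%:R * (size A)%:R = 4 * (size A)%:R * (b / N%:R) by ring.
  apply: ler_wpM2r; first by rewrite divr_ge0 // ltW.
  by clear -h1 h2; lra.
have [a1 a2] := interval_sum_le t I1P g0 gb.
have [c1 c2] := interval_sum_le t I2P g0 gb.
split; apply: key.
  by apply: le_trans (cov _ _) _ => //; exact: lerD.
by apply: le_trans (cov _ _) _ => //; exact: lerD.
Qed.

Lemma spread_interval (S : {fset int}) : int_interval S -> (N <= #|` S|)%N ->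
  spread R e N (enum_fset S).
Proof.
move=> /int_interval_seq[x0 Sx] NS; apply: (spread_cover Sx Sx).
- by move=> F F0; rewrite lerDl sumr_ge0.
- by rewrite mul2n addnn.
- by rewrite mul2n addnn leq_double.
Qed.

Lemma sum_fsetU_le (S T : {fset int}) (F : int -> R) : (forall x, 0 <= F x) ->
  \sum_(x <- enum_fset (S `|` T)%fset) F x <=
  \sum_(x <- enum_fset S) F x + \sum_(x <- enum_fset T) F x.
Proof.
move=> F0; rewrite -big_cat /=.
rewrite (perm_big (undup (enum_fset S ++ enum_fset T))) /=; last first.
  apply: uniq_perm; rewrite ?undup_uniq ?fset_uniq // => x.
  by rewrite mem_undup mem_cat; exact: in_fsetU.
elim: (_ ++ _) => //= x s IH; case: ifP => _; rewrite !big_cons.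
  by apply: le_trans IH _; rewrite lerDr.
by rewrite lerD2l.
Qed.

Lemma spread_two_intervals (S T : {fset int}) : int_interval S -> int_interval T ->
  (2 * N <= #|` S| + #|` T|)%N -> spread R e N (enum_fset (S `|` T)%fset).
Proof.
move=> /int_interval_seq[x0 Sx] /int_interval_seq[y0 Ty] NS.
apply: (spread_cover Sx Ty) => //; first exact: sum_fsetU_le.
by rewrite mul2n -addnn leq_add // fsubset_leq_card // ?fsubsetUl ?fsubsetUr.
Qed.

End Spread.

Lemma pr_swap (R : realFieldType) Us Bs Ss (E : seq int -> bool) :
  (forall u b s, E (u ++ b ++ s) = E (u ++ s ++ b)) ->
  pr R (Us ++ Bs ++ Ss) E = pr R (Us ++ Ss ++ Bs) E.
Proof.
move=> EC; rewrite /pr !(expect_cat Us); apply: eq_expect => u _.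
rewrite !expect_cat expect_exchange; apply: eq_expect => s _.
by apply: eq_expect => b _; rewrite EC.
Qed.

Lemma pr_le (R : realFieldType) As (E E' : seq int -> bool) :
  (forall y, insupp As y -> E y -> E' y) -> pr R As E <= pr R As E'.
Proof.
move=> EE; apply: expect_le => y yA; rewrite ler_nat.
by have := EE y yA; case: (E y) => // ->.
Qed.

Section Layout.
Variable A : nat -> {fset int}.

Definition layout (i0 k : nat) := [seq enum_fset (A i) | i <- iota i0 k].

Lemma size_layout i0 k : size (layout i0 k) = k.
Proof. by rewrite size_map size_iota. Qed.

Lemma layout_cat i0 k k' : layout i0 (k + k') = layout i0 k ++ layout (i0 + k) k'.
Proof. by rewrite /layout iotaD map_cat. Qed.

Lemma layout_in (P : seq int -> Prop) i0 k :
  (forall i, (i0 <= i < i0 + k)%N -> P (enum_fset (A i))) ->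
  {in layout i0 k, forall B, P B}.
Proof. by move=> PA B /mapP[i]; rewrite mem_iota => /PA Pi ->. Qed.

Lemma layout_bound i0 k (X : int) z :
  (forall i, (i0 <= i < i0 + k)%N -> forall a, a \in A i -> `|a| <= X) ->
  insupp (layout i0 k) z -> all (fun x : int => `|x| <= X) z.
Proof.
elim: k i0 z => [|k IH] i0 [|x z] //= AX /andP[xA zA].
rewrite (AX i0) //=; last by clear; lia.
by apply: (IH i0.+1) zA => i ik; apply: AX; move: ik; clear; lia.
Qed.

Lemma layout_gapped D j k z :
  (forall i, (j < i <= j + k)%N -> forall x y, x \in A (2 * i).-1 -> y \in A (2 * i)%N ->
     D%:Z <= `|x - y|) ->
  insupp (layout j.*2.+1 k.*2) z -> gapped D z.
Proof.
elim: k j z => [|k IH] j z AD; first by case: z.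
rewrite doubleS; case: z => [|x [|y z]] //=; first by rewrite /insupp /= andbF.
rewrite /insupp /= => /and3P[xA yA zA].
have -> /= : D%:Z <= `|x - y|.
  apply: (AD j.+1); first by clear; lia.
    by rewrite mul2n doubleS.
  by rewrite mul2n doubleS.
by apply: (IH j.+1) => [i ik|]; [apply: AD; move: ik; clear; lia | rewrite doubleS].
Qed.

End Layout.

Section Admissible.
Variables (R : realType) (N n : nat) (K1 K2 K3 delta : R) (A : nat -> {fset int}).
Hypotheses (N0 : (0 < N)%N) (dl : 0 < delta) (K1_gt1 : 1 < K1) (K12 : K1 < K2)
  (adm : admissible N n K1 K2 K3 delta A).

Let h0 := Num.truncn (delta * n%:R).

Let le_h0 i : (i <= h0)%N -> i%:R <= delta * n%:R.
Proof.
move=> ih; apply: (@le_trans _ _ h0%:R); first by rewrite ler_nat.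
by rewrite truncn_le mulr_ge0 // ltW.
Qed.

(** The left side is [N / Rr] rounded up. In the first alternative absolute values differ by at
    least [(K2 - K1) N]; in the second the two intervals lie on opposite sides of 0, each beyond
    [K1 N]. *)
Lemma admissible_gap Rr i (x y : int) : (0 < Rr)%N -> (K2 - K1)^-1 <= Rr%:R ->
  (1 <= i <= h0)%N -> x \in A (2 * i).-1 -> y \in A (2 * i)%N ->
  ((N.-1 %/ Rr).+1)%:Z <= `|x - y|.
Proof.
move=> Rr0 RK /andP[i1 ih] xA yA.
have Nr : 0 < N%:R :> R by rewrite ltr0n.
have Rr1 : 1 <= Rr%:R :> R by rewrite ler1n.
suff : N%:R <= Rr%:R * `|(x - y)%:~R| :> R.
  rewrite -intr_norm -abszE -pmulrn -natrM ler_nat => NR.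
  rewrite lez_nat ltn_divLR // mulnC; move: NR N0; clear; lia.
have RK' : 1 <= Rr%:R * (K2 - K1).
  by rewrite -ler_pdivrMr ?subr_gt0 // mul1r.
have fin (d : R) : K2 - K1 <= d \/ 1 <= d -> d * N%:R <= `|(x - y)%:~R| ->
    N%:R <= Rr%:R * `|(x - y)%:~R| :> R.
  move=> dd dN; apply: (@le_trans _ _ (Rr%:R * (d * N%:R))); last first.
    by rewrite ler_wpM2l.
  rewrite mulrA -[leLHS]mul1r ler_wpM2r ?ler0n //; case: dd => dd.
    by apply: le_trans RK' _; rewrite ler_wpM2l.
  by rewrite -[leLHS]mulr1; apply: ler_pM.
have [_ _ _ [P|Q]] := adm.
  have [[_ [_ yK]] [_ [_ xK]]] := P i i1 (le_h0 ih).
  apply: (fin (K2 - K1)); first by left.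
  have := yK y yA; have := xK x xA; rewrite rmorphB /= mulrBl.
  have := lerB_dist (x%:~R : R) y%:~R.
  by lra.
have [[_ [_ yK]] [_ [_ xK]]] := Q i i1 (le_h0 ih).
apply: (fin 1); first by right.
have := yK y yA; have := xK x xA; rewrite rmorphB /= mul1r.
have : 1 * N%:R <= K1 * N%:R by rewrite ler_wpM2r // ltW.
rewrite distrC; have := ler_norm (y%:~R - x%:~R : R); lra.
Qed.

Lemma admissible_spread (V : finZmodType) (e : V) i : (1 <= i <= h0.*2)%N ->
  spread R e N (enum_fset (A i)).
Proof.
move=> /andP[i1 ih]; have [_ _ _ PQ] := adm.
have N2 k : (2 * N + 1 <= k)%N -> (N <= k)%N by clear; lia.
have [odd_i|even_i] := boolP (odd i).
  have iE : i = (2 * uphalf i).-1 by move: odd_i; clear; lia.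
  have u1 : (1 <= uphalf i)%N by move: i1; clear; lia.
  have uh : (uphalf i <= h0)%N by move: ih; clear; lia.
  case: PQ => [P|Q].
    have [_ [_ [[I1 [I2 [i1I [i2I [AE sI]]]]] _]]] := P _ u1 (le_h0 uh).
    by rewrite iE AE; exact: spread_two_intervals.
  have [_ [iI [sI _]]] := Q _ u1 (le_h0 uh).
  by rewrite iE; apply: spread_interval => //; exact: N2.
have iE : i = (2 * i./2)%N by move: even_i; clear; lia.
have u1 : (1 <= i./2)%N by move: i1 even_i; clear; lia.
have uh : (i./2 <= h0)%N by move: ih; clear; lia.
case: PQ => [P|Q].
  have [[iI [sI _]] _] := P _ u1 (le_h0 uh).
  by rewrite iE; apply: spread_interval => //; exact: N2.
have [[iI [sI _]] _] := Q _ u1 (le_h0 uh).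
by rewrite iE; apply: spread_interval => //; exact: N2.
Qed.

Lemma admissible_tail i : (h0.*2.+1 < i <= n)%N ->
  int_interval (A i) /\ (N <= #|` A i|)%N.
Proof.
move=> /andP[ih ini]; have [_ _ T _] := adm; have [] // := T i ini.
  have h0lt : delta * n%:R < h0.+1%:R by exact: truncnS_gt.
  apply: (@lt_le_trans _ _ (2 * h0.+1%:R)); first by rewrite -mulrA ltr_pM2l.
  by rewrite -natrM ler_nat mul2n doubleS.
by move=> iI sI; split => //; move: sI; clear; lia.
Qed.

End Admissible.

Lemma log2_lipschitz_ratio (R : realType) (f : int -> R) (eta lam : R) (J : nat) :
  log2_lipschitz eta f -> 0 <= eta -> 0 < lam -> eta * (J%:R * ln 2) <= ln lam ->
  forall t i : int, `|i| <= J%:Z -> f t <= lam * f (t + i).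
Proof.
move=> [fp fl] eta0 lam0 etal t i iJ.
have l2 : 0 < ln 2 :> R by rewrite ln_gt0 // ltr1n.
rewrite -ler_ln ?posrE ?mulr_gt0 // lnM ?posrE //.
have := fl t (t + i); rewrite /log2 -mulrBl => /(le_trans (ler_norm _)).
rewrite ler_pdivrMr // opprD addrA subrr add0r mulrNz normrN -lerBlDr => h.
apply: le_trans h _; apply: le_trans etal; rewrite -mulrA ler_wpM2l //.
apply: ler_wpM2r; first exact: ltW.
by rewrite -intr_norm [J%:R]pmulrn ler_int.
Qed.

(** A bound [c / 2] at all points would pass to the supremum. Giving up the factor 2 avoids asking
    that it be attained. *)
Lemma supnorm_gt (R : realType) (g : int -> R) (c : R) : 0 < c -> c <= supnorm g ->
  exists t, c / 2 < `|g t|.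
Proof.
move=> c0 cg; apply: contrapT => nex.
suff : supnorm g <= c / 2 by move: cg c0; clear; lra.
apply: ge_sup; first by exists `|g 0|; exists 0.
by move=> _ [t _ <-]; rewrite leNgt; apply/negP => h; apply: nex; exists t.
Qed.

Unset Implicit Arguments.

Theorem theorem3p1 (R : realType) (p : R) :
  0 < p <= 2^-1 ->
  exists c : R, 0 < c /\
  forall (delta K1 K2 K3 : R),
    0 < delta < 4^-1 -> 1 < K1 -> K1 < K2 -> K2 < K3 ->
  forall eps : R, 0 < eps <= c ->
  exists (L gamma : R), 0 < L /\ 0 < gamma < eps /\
  forall M : R, 1 <= M ->
  exists (n0 : nat) (eta : R), (1 <= n0)%N /\ 0 < eta <= 1 /\
  forall (n N : nat) (A : nat -> {fset int}) (f : int -> R),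
    (n0 <= n)%N ->
    (1 <= N)%N ->
    N%:R <= 'C(n, Num.truncn (p * n%:R))%:R * expR (- (eps * n%:R)) ->
    admissible N n K1 K2 K3 delta A ->
    (forall t, 0 <= f t) -> in_l1 f -> l1norm f = 1 ->
    log2_lipschitz eta f ->
  forall m : nat,
    p * n%:R - gamma * n%:R <= m%:R <= p * n%:R + gamma * n%:R ->
    @prob R A n (fun x => L / (N%:R * Num.sqrt n%:R) <= supnorm (ravg f x m n))
      <= expR (- (M * n%:R)).
Proof.
(* The estimates only ask for [eps <= 1]. *)
move=> p0; exists 1; split => // delta K1 K2 K3 /andP[d0 d4] K1_gt1 K12 _ eps eps0.
pose Rr := (Num.truncn (K2 - K1)^-1).+1.
have RrK : (K2 - K1)^-1 <= Rr%:R by exact/ltW/truncnS_gt.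
(* The bound [delta / 8] makes room for three blocks of [h] pairs among the first [delta n]
   pairs. *)
have [a [gamma [C0 [[/andP[a0 ad] g0 C00] Hbound]]]] :=
  @finite_group_bound R p eps (delta / 8) Rr p0 eps0 (divr_gt0 d0 (ltr0Sn R 7)) (ltn0Sn _).
(* [18 = 2 * (8 + 1)]: a factor 2 for passing from the supremum to a point, and one unit
   [C0 / (N * sqrt n)] for the truncation. *)
exists (18 * C0), gamma; split; first by rewrite mulr_gt0.
split => // M M1; have [n0 [J [lam [n00 [lam1 HM]]]]] := Hbound M M1.
have l2 : 0 < ln 2 :> R by rewrite ln_gt0 // ltr1n.
have J1l2 : 0 < J.+1%:R * ln 2 :> R by rewrite mulr_gt0.
have lam0 : 0 < lam by apply: lt_trans lam1.
(* So [f] varies by a factor at most [lam] over distance [J]; the successor keeps the denominator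
   nonzero. *)
pose eta := Num.min 1 (ln lam / (J.+1%:R * ln 2)).
have eta0 : 0 < eta by rewrite lt_min ltr01 divr_gt0 // ln_gt0.
have etaJ : eta * (J%:R * ln 2) <= ln lam.
  apply: (@le_trans _ _ (eta * (J.+1%:R * ln 2))).
    by rewrite ler_pM2l // ler_pM2r // ler_nat.
  by rewrite -ler_pdivlMr // ge_min lexx orbT.
exists (maxn n0 3), eta; split; first by rewrite leq_max n00.
split; first by rewrite eta0 ge_min lexx.
move=> n N A f; rewrite geq_max => /andP[n0n n3] N0 NB adm f0 fl1 fn flip m mn.
have [xi [/andP[xi0 xiC] Hxi]] := HM n N n0n N0 NB.
set h := Num.truncn (a * n%:R) in Hxi.
pose X : int := (n * N)%N%:Z; pose D := (N.-1 %/ Rr).+1.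
have [V [e [g [phi [einj ge0 gsum glip [phiD fg]]]]]] :=
  @cyclic_truncation R f f0 fl1 fn lam xi J ((X *+ h.*2 + D%:Z) *+ 2) xi0 (ltW lam0)
    (log2_lipschitz_ratio flip (ltW eta0) lam0 etaJ).
have npos : 0 < n%:R :> R by rewrite ltr0n; move: n3; clear; lia.
pose h0 := Num.truncn (delta * n%:R).
have hle : h%:R <= a * n%:R by rewrite truncn_le mulr_ge0 // ltW.
have h0le : h0%:R <= delta * n%:R by rewrite truncn_le mulr_ge0 // ltW.
have h3 : (3 * h <= h0)%N.
  rewrite truncn_ge_nat; last by rewrite mulr_ge0 // ltW.
  rewrite natrM.
  apply: (@le_trans _ _ (3 * (delta / 8 * n%:R))); last first.
    by rewrite mulrA ler_wpM2r ?ler0n //; move: d0; clear; lra.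
  rewrite ler_pM2l //; apply: le_trans hle _.
  by rewrite ler_wpM2r ?ler0n.
have h0n : (h0.*2 + 1 + h.*2 <= n)%N.
  rewrite -(ler_nat R) !natrD -!muln2 !natrM.
  have n3R : 3 <= n%:R :> R by rewrite ler_nat.
  have u1 : h0%:R <= 4^-1 * n%:R :> R.
    by apply: le_trans h0le _; rewrite ler_pM2r // ltW.
  have u2 : h%:R <= 32^-1 * n%:R :> R.
    apply: le_trans hle _; rewrite ler_pM2r //.
    by apply: le_trans ad _; move: d4; clear; lra.
  by move: n3R u1 u2; clear; lra.
have [r0 h0E] : exists r0, h0 = (3 * h + r0)%N by exists (h0 - 3 * h)%N; rewrite subnKC.
have [r1 nE] : exists r1, n = (h0.*2 + 1 + h.*2 + r1)%N.
  by exists (n - (h0.*2 + 1 + h.*2))%N; rewrite subnKC.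
(* Coordinate [h0.*2.+1] need not satisfy any condition: it is the extra one
   in [Z]. *)
pose i1 := (h.*2).*2.+1; pose i2 := (h.*2 + r0).*2.+1; pose i3 := h0.*2.+2.
pose Outer := layout A 1 h.*2; pose W := layout A h.*2.+1 h.*2.
pose Mid := layout A i1 r0.*2; pose Z := layout A i2 h.*2.+1.
(* [Steps] is taken beyond the pairs, where every factor is a single interval, as the energy
   argument requires; inside the pairs a factor may be a union of two. *)
pose Steps := layout A i3 h.*2; pose Rest := layout A (i3 + h.*2) r1.
have layoutE : layout A 1 n = (Outer ++ W) ++ (Mid ++ Z) ++ (Steps ++ Rest).
  have -> : n = (h.*2 + h.*2 + (r0.*2 + h.*2.+1) + (h.*2 + r1))%N.
    by rewrite {1}nE h0E; clear; lia.
  rewrite !layout_cat -!catA; congr (_ ++ (_ ++ (_ ++ (_ ++ (_ ++ _)))));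
    congr layout; rewrite /i1 /i2 /i3 ?h0E; clear; lia.
rewrite prob_pr -/(layout A 1 n) layoutE.
pose H : R := N%:R * Num.sqrt n%:R; rewrite -/H in xiC Hxi *.
have H0 : 0 < H by rewrite mulr_gt0 ?ltr0n // sqrtr_gt0.
pose E (x : seq int) := [exists t, 8 * C0 / H * 'C(n, m)%:R <= pushes e x (seed g) m t].
have npE : (size ((Outer ++ W) ++ (Mid ++ Z) ++ (Steps ++ Rest)) = n)%N.
  by rewrite -layoutE size_layout.
apply: (@le_trans _ _ (pr R ((Outer ++ W) ++ (Mid ++ Z) ++ (Steps ++ Rest)) E)).
  apply: pr_le => x /insupp_size; rewrite npE => xn LE.
  have LH0 : 0 < 18 * C0 / H by rewrite divr_gt0 // mulr_gt0.
  have [t tLE] := supnorm_gt LH0 LE; apply/existsP; exists (phi t).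
  have Cnm : 0 < 'C(n, m)%:R :> R.
    (* For [m > n] the binomial coefficient is 0 and so is its inverse, hence the average
       vanishes. *)
    rewrite ltr0n bin_gt0 leqNgt; apply/negP => nm; move: tLE; rewrite ravg_pushes //.
    by rewrite bin_small // invr0 mul0r normr0 ltNge divr_ge0 // ltW.
  move: tLE; rewrite ravg_pushes // ger0_norm; last first.
    rewrite mulr_ge0 ?invr_ge0 ?ler0n //; apply: pushes_ge0; exact: seed_ge0.
  rewrite ltr_pdivlMl // => tLE.
  have := pushes_transfer x m t phiD fg (ltW xi0); rewrite xn.
  move/(lt_le_trans tLE); rewrite -ltrBlDr mulrC -mulrBl => /ltW; apply: le_trans.
  rewrite ler_wpM2r ?ler0n //; move: xiC; rewrite -[18 * C0 / H]mulrA -[8 * C0 / H]mulrA.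
  by move: (C0 / H) => u; clear; lra.
have EC u b s : E (u ++ b ++ s) = E (u ++ s ++ b).
  apply: eq_existsb => t; congr (_ <= _); rewrite !pushes_cat.
  by apply: eq_pushes => s' t'; exact: pushesC.
(* The event is symmetric in the coordinates, so the order of the indices can be changed into the
   order in which the phases reveal them. *)
rewrite pr_swap // -!catA (catA Rest).
have bd i0 k z : (0 < i0)%N -> (i0 + k <= n.+1)%N -> insupp (layout A i0 k) z ->
    all (fun x : int => `|x| <= X) z.
  move=> i00 ik; apply: layout_bound => i ii; have [_ bnd _ _] := adm; apply: bnd.
  by move: i00 ik ii; clear; lia.
have blk j z : (j + h <= h0)%N -> insupp (layout A j.*2.+1 h.*2) z -> block D h X z.
  move=> jh zL; split.
  - apply: layout_gapped zL => i ij x y.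
    apply: (@admissible_gap R N n K1 K2 K3 delta A N0 d0 K1_gt1 K12 adm Rr) => //.
    by rewrite -/h0; move: ij jh; clear; lia.
  - by rewrite (insupp_size zL) size_layout.
  - by apply: bd zL => //; rewrite nE; move: jh; clear; lia.
have sprd i0 k : (0 < i0)%N -> (i0 + k <= h0.*2.+1)%N ->
    {in layout A i0 k, forall B, spread R e N B}.
  move=> i00 ik; apply: layout_in => i ii.
  by apply: (admissible_spread N0 d0 adm); rewrite -/h0; move: i00 ik ii; clear; lia.
have tail i0 k : (h0.*2.+1 < i0)%N -> (i0 + k <= n.+1)%N ->
    forall i, (i0 <= i < i0 + k)%N -> int_interval (A i) /\ (N <= #|` A i|)%N.
  move=> i00 ik i ii; apply: (admissible_tail adm); rewrite -/h0.
  by move: i00 ik ii; clear; lia.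
apply: (Hxi V e D _ X g Outer W Steps (Rest ++ Mid) Z m) => //.
- exact: einj.
- by rewrite mulnC -{1}(prednK N0) /D ltn_ceil.
- move=> z; rewrite /Z -addn1 layout_cat => /insupp_cat[zs [ex [-> zsL _]]].
  by exists zs, ex; split => //; apply: blk zsL; rewrite h0E; clear; lia.
- by move=> w; apply: blk; rewrite h0E; clear; lia.
- move=> B; rewrite mem_cat => /orP[|]; last first.
    by apply: sprd => //; rewrite /i1 h0E; clear; lia.
  apply: layout_in => i ii.
  have [iI iN] : int_interval (A i) /\ (N <= #|` A i|)%N.
    apply: (tail (i3 + h.*2)%N r1) ii; first by rewrite /i3; clear; lia.
    by rewrite nE /i3; clear; lia.
  exact: spread_interval.
- by apply: sprd => //; rewrite h0E; clear; lia.
- apply: (layout_in (P := fun B => exists x0 P, interval_seq B x0 P /\ (N <= P)%N)) => i ii.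
  have [iI iN] : int_interval (A i) /\ (N <= #|` A i|)%N.
    apply: (tail i3 h.*2) ii; first by rewrite /i3; clear; lia.
    by rewrite nE /i3; clear; lia.
  by have [x0 Ax] := int_interval_seq iI; exists x0, #|` A i|.
- exact: size_layout.
- exact: size_layout.
- exact: size_layout.
- exact: size_layout.
- by rewrite size_cat !size_layout nE h0E; clear; lia.
Qed.
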